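(* Let $1\le r\le s$ and $r'\le 2r-2$. Then every local proper holomorphic map from $\mathbb B^{r,s}$ to $\mathbb B^{r',s',t'}$ is quasi-standard.
   Context: Let $r,s,t\ge 0$ be integers with $n=r+s+t>0$. $\mathbb C^{r,s,t}$ denotes $\mathbb C^n$ equipped with the (possibly degenerate, indefinite) Hermitian form $\langle z,w\rangle_{r,s,t}=\sum_{j=1}^{r}z_j\bar w_j-\sum_{j=r+1}^{r+s}z_j\bar w_j$, and $\mathbb P^{r,s,t}$ is its projectivization; $\mathbb P^{r,s}=\mathbb P^{r,s,0}$, $\mathbb B^{r,s}=\mathbb B^{r,s,0}$. A point $[z]$ is positive or null according as $\langle z,z\rangle_{r,s,t}>0$ or $=0$. The generalized ball $\mathbb B^{r,s,t}$ is the set of positive points and $\partial\mathbb B^{r,s,t}$ the set of null points. A local proper holomorphic map from $\mathbb B^{r,s,t}$ to $\mathbb B^{r',s',t'}$ is a holomorphic map $f:U\to\mathbb P^{r',s',t'}$ on a connected open set $U\subset\mathbb P^{r,s,t}$ with $U\cap\partial\mathbb B^{r,s,t}\ne\varnothing$, $f(U\cap\mathbb B^{r,s,t})\subset\mathbb B^{r',s',t'}$ and $f(U\cap\partial\mathbb B^{r,s,t})\subset\partial\mathbb B^{r',s',t'}$. A complex linear subspace $H$ (or $\mathbb PH$) is a null space if the form vanishes identically on $H$. $f$ is standard if it is induced by a linear isometry $\mathbb C^{r,s,t}\to\mathbb C^{r',s',t'}$ (a linear map $L$ with $\langle Lu,Lv\rangle_{r',s',t'}=\langle u,v\rangle_{r,s,t}$);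 null if $f(U)$ is contained in a null space. $f$ is quasi-standard if either $f$ is standard, or there is a decomposition $\mathbb C^{r',s',t'}=A\oplus B$ into nonzero subspaces with $\langle a,b\rangle_{r',s',t'}=0$ for all $a\in A,b\in B$ such that $\pi_A\circ f$ is standard and $\pi_B\circ f$ is null, where $\pi_A:\mathbb P^{r',s',t'}\dashrightarrow\mathbb PA$, $\pi_B:\mathbb P^{r',s',t'}\dashrightarrow\mathbb PB$ are induced by the linear projections, and $\mathbb PA,\mathbb PB$ carry the restricted forms. *)

(* Defs.v *)
From HB Require Import structures.
From mathcomp Require Import all_boot all_order all_algebra.
From mathcomp Require Import all_classical all_reals all_analysis.
From mathcomp.real_closed Require Import complex.
Import Order.TTheory GRing.Theory Num.Theory.
Import numFieldNormedType.Exports.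
Set Implicit Arguments.
Unset Strict Implicit.
Unset Printing Implicit Defensive.
Local Open Scope ring_scope.
Local Open Scope classical_set_scope.

Definition sgn_coef (R : realType) (r s : nat) (j : nat) : R[i] :=
  if (j < r)%N then 1 else if (j < r + s)%N then -1 else 0.

Definition hform (R : realType) (r s t : nat) (z w : 'rV[R[i]]_(r + s + t)) : R[i] :=
  \sum_(j < r + s + t) sgn_coef R r s j * z 0 j * (w 0 j)^*.

Definition propto (R : realType) (n : nat) (u v : 'rV[R[i]]_n) : Prop :=
  exists c : R[i], c != 0 /\ u = c *: v.

(* holomorphic map on an open set W of C^n: complex (R[i]-linear) Frechet
   differentiability at every point of W *)
Definition holo (R : realType) (n m : nat) (W : set 'rV[R[i]]_n)
    (G : 'rV[R[i]]_n -> 'rV[R[i]]_m) : Prop :=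
  @open ('rV[R[i]]_n : normedModType R[i]) W /\
  (forall z : ('rV[R[i]]_n : normedModType R[i]), W z ->
     differentiable (G : ('rV[R[i]]_n : normedModType R[i]) ->
                         ('rV[R[i]]_m : normedModType R[i])) z).

(* An open subset of P^{n-1} is represented by its preimage (cone) in
   C^n \ {0}: an open set not containing 0, stable under nonzero scalings. *)
Definition proj_open (R : realType) (n : nat) (U : set 'rV[R[i]]_n) : Prop :=
  @open ('rV[R[i]]_n : normedModType R[i]) U /\ ~ U 0 /\
  (forall z (c : R[i]), U z -> c != 0 -> U (c *: z)).

(* A map U -> P^{m-1} is given by a representative function F (F z is a
   nonzero vector representing f([z])), well defined on projective points;
   it is holomorphic iff it admits local holomorphic lifts. *)
Definition proj_holo_map (R : realType) (n m : nat) (U : set 'rV[R[i]]_n)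
    (F : 'rV[R[i]]_n -> 'rV[R[i]]_m) : Prop :=
  (forall z, U z -> F z != 0) /\
  (forall z (c : R[i]), U z -> c != 0 -> propto (F (c *: z)) (F z)) /\
  (forall z, U z -> exists (W : set 'rV[R[i]]_n) (G : 'rV[R[i]]_n -> 'rV[R[i]]_m),
      W z /\ W `<=` U /\ holo W G /\ (forall w, W w -> propto (G w) (F w))).

Definition local_proper_map (R : realType) (r s t r' s' t' : nat)
    (U : set 'rV[R[i]]_(r + s + t))
    (F : 'rV[R[i]]_(r + s + t) -> 'rV[R[i]]_(r' + s' + t')) : Prop :=
  proj_open U /\
  @connected ('rV[R[i]]_(r + s + t) : normedModType R[i]) U /\
  proj_holo_map U F /\
  (exists z, U z /\ hform z z = 0) /\
  (forall z, U z -> 0 < hform z z -> 0 < hform (F z) (F z)) /\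
  (forall z, U z -> hform z z = 0 -> hform (F z) (F z) = 0).

Definition lin_isometry (R : realType) (r s t r' s' t' : nat)
    (L : 'M[R[i]]_(r + s + t, r' + s' + t')) : Prop :=
  forall u v : 'rV[R[i]]_(r + s + t), hform (u *m L) (v *m L) = hform u v.

Definition standard_map (R : realType) (r s t r' s' t' : nat)
    (U : set 'rV[R[i]]_(r + s + t))
    (F : 'rV[R[i]]_(r + s + t) -> 'rV[R[i]]_(r' + s' + t')) : Prop :=
  exists L : 'M[R[i]]_(r + s + t, r' + s' + t'),
    lin_isometry L /\
    (forall z, U z -> z *m L != 0 /\ propto (F z) (z *m L)).

Definition null_space (R : realType) (r' s' t' : nat)
    (H : 'M[R[i]]_(r' + s' + t')) : Prop :=
  forall x y : 'rV[R[i]]_(r' + s' + t'),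
    (x <= H)%MS -> (y <= H)%MS -> hform x y = 0.

Definition null_map (R : realType) (n r' s' t' : nat)
    (U : set 'rV[R[i]]_n) (F : 'rV[R[i]]_n -> 'rV[R[i]]_(r' + s' + t')) : Prop :=
  exists H : 'M[R[i]]_(r' + s' + t'),
    null_space H /\ (forall z, U z -> (F z <= H)%MS).

(* f is quasi-standard.  A and B are row spaces of square matrices;
   pi_A v = v *m proj_mx A B (projection onto A along B), similarly pi_B. *)
Definition quasi_standard (R : realType) (r s t r' s' t' : nat)
    (U : set 'rV[R[i]]_(r + s + t))
    (F : 'rV[R[i]]_(r + s + t) -> 'rV[R[i]]_(r' + s' + t')) : Prop :=
  standard_map U F \/
  exists A B : 'M[R[i]]_(r' + s' + t'),
    A != 0 /\ B != 0 /\ mxdirect (A + B)%MS /\ row_full (A + B)%MS /\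
    (forall a b, (a <= A)%MS -> (b <= B)%MS -> hform a b = 0) /\
    (exists L : 'M[R[i]]_(r + s + t, r' + s' + t'),
       (L <= A)%MS /\ lin_isometry L /\
       (exists z, U z /\ F z *m proj_mx A B != 0) /\
       (forall z, U z -> F z *m proj_mx A B != 0 ->
          z *m L != 0 /\ propto (F z *m proj_mx A B) (z *m L))) /\
    (exists H : 'M[R[i]]_(r' + s' + t'),
       (H <= B)%MS /\ null_space H /\
       (forall z, U z -> (F z *m proj_mx B A <= H)%MS)).

(* Main.v *)
Require Import Defs.
From HB Require Import structures.
From mathcomp Require Import all_boot all_order all_algebra.
From mathcomp Require Import all_classical all_reals all_analysis.
From mathcomp.real_closed Require Import complex.
From mathcomp Require Import ring lra zify.
Import Order.TTheory GRing.Theory Num.Theory.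
Set Implicit Arguments.
Unset Strict Implicit.
Unset Printing Implicit Defensive.
Local Open Scope ring_scope.

(** Let [G] be a local holomorphic lift of the map near a null point and [K z w = <G z, G w>].
    Polarization along null lines gives [K z w = 0] for orthogonal null vectors [z], [w].

    Since [r' < 2 r], among [r] mutually orthogonal hyperbolic planes there is one whose image
    contains no two orthogonal positive vectors; Hopf's lemma in that plane yields a null point
    where the derivative of [G] is transversal to the null cone.  Since [r' <= 2 r - 2], any
    [2 r - 1] pairwise orthogonal null vectors of the target have a combination in the radical,
    which forces [K z w * K z' w' = K z w' * K z' w] when [z, z'] and [w, w'] lie on two null lines
    through a null point [p] orthogonal to both.  Letting [z'] tend to [p] and moving [p], one
    finds [K z w = g z * conj (g w) * <z, w>] on an open set.

    There [G / g] preserves the forms, so it is the sum of a linear isometry [L] and of a map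
    into a null subspace orthogonal to the image of [L].  The identity theorem along the
    connected domain gives the same splitting everywhere.  The function theory that is needed
    (Goursat by bisection, maximum principle, Hopf, Schwarz) is derived without integrals. *)

(** No power series is at hand, so every identity is obtained on complex lines from one fact: a
    function differentiable on a square and zero on one side of it is zero at the center. A complex
    line in a null direction [e] through [z], with [<e, z>] nonzero, meets the null cone in a real
    line, which is placed on that side. Polarization only says that [K] vanishes where the form
    does, on null vectors. Instead of dividing [K] by the form, ratios are compared. The minors
    give, for orthogonal null [w], [w2], a constant ratio between [K z w / <z, w>] and
    [K z w2 / <z, w2>]; chains of such pairs lead to a base point [c0], and the factor [g] is read
    off from [K z c0 / <z, c0>]. The number [2 r - 1] counts two points on each of [r - 1] null
    lines through [p], and [p] itself. For [r = 1] the bound gives [r' = 0], incompatible with the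
    existence of a positive point. The target form sees vectors only up to null parts: a map
    preserving the forms need not be linear, only its component along the image of [L] is. *)

Section OneVariable.
Variable R : realType.
Local Notation C := R[i].
Implicit Types (f g : C -> C) (z w : C) (d e M : R).

(* The norm of [R[i]] takes values in [R[i]]; [nc] is the modulus as a real number. *)
Definition nc (z : C) : R := Normc.normc z.

Lemma nc_normr z : `|z| = (nc z)%:C%C.
Proof. by case: z. Qed.

Lemma nc_ge0 z : 0 <= nc z.
Proof. by case: z => a b; apply: sqrtr_ge0. Qed.

Lemma ncM z w : nc (z * w) = nc z * nc w.
Proof. exact: Normc.normcM. Qed.

Lemma nc_eq0 z : (nc z == 0) = (z == 0).
Proof.
apply/eqP/eqP => [|->]; [exact: Normc.eq0_normc | exact: Normc.normc0].
Qed.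

Lemma nc0 : nc 0 = 0. Proof. exact: Normc.normc0. Qed.
Lemma nc1 : nc 1 = 1. Proof. exact: Normc.normc1. Qed.

Lemma nc_gt0 z : (0 < nc z) = (z != 0).
Proof. by rewrite lt_neqAle nc_ge0 andbT eq_sym nc_eq0. Qed.

Lemma ncD z w : nc (z + w) <= nc z + nc w.
Proof. exact: le_normcD. Qed.

Lemma ncN z : nc (- z) = nc z. Proof. exact: normcN. Qed.

Lemma ncB z w : nc (z - w) <= nc z + nc w.
Proof. by rewrite -(ncN w) ncD. Qed.

Lemma nc_distC z w : nc (z - w) = nc (w - z).
Proof. by rewrite -ncN opprB. Qed.

Lemma nc_sub_ge z w : nc z - nc w <= nc (z - w).
Proof. by have := ncD (z - w) w; rewrite subrK; lra. Qed.

Lemma ncV z : nc z^-1 = (nc z)^-1.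
Proof. exact: Normc.normcV. Qed.

Lemma ncX z n : nc (z ^+ n) = nc z ^+ n.
Proof. by elim: n => [|n IH]; rewrite ?expr0 ?nc1 // !exprS ncM IH. Qed.

Lemma nc_real (x : R) : nc x%:C%C = `|x|.
Proof. by rewrite /nc /= expr0n /= addr0 sqrtr_sqr. Qed.

Lemma nc_i : nc 'i%C = 1.
Proof. by rewrite /nc /= expr0n /= expr1n add0r sqrtr1. Qed.

Lemma nc_sqr z : nc z ^+ 2 = complex.Re z ^+ 2 + complex.Im z ^+ 2.
Proof. by case: z => a b; rewrite /nc /= sqr_sqrtr // addr_ge0 ?sqr_ge0. Qed.

Lemma nc_conj z : nc (z^*)%C = nc z.
Proof. by case: z => a b; rewrite /nc /= sqrrN. Qed.

Lemma cImM z w : complex.Im (z * w) =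
  complex.Re z * complex.Im w + complex.Im z * complex.Re w.
Proof. by case: z => a b; case: w => c d /=; ring. Qed.

Lemma nc_ge_Re z : `|complex.Re z| <= nc z.
Proof.
rewrite -(ler_pXn2r (n:=2)) ?nnegrE ?nc_ge0 // nc_sqr real_normK ?num_real //.
by rewrite lerDl sqr_ge0.
Qed.

Lemma nc_ge_Im z : `|complex.Im z| <= nc z.
Proof.
rewrite -(ler_pXn2r (n:=2)) ?nnegrE ?nc_ge0 // nc_sqr real_normK ?num_real //.
by rewrite lerDr sqr_ge0.
Qed.

Lemma nc_le_ReIm z : nc z <= `|complex.Re z| + `|complex.Im z|.
Proof.
rewrite -(ler_pXn2r (n:=2)) ?nnegrE ?nc_ge0 ?addr_ge0 // nc_sqr sqrrD.
rewrite !real_normK ?num_real //.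
have : 0 <= `|complex.Re z| * `|complex.Im z| by rewrite mulr_ge0.
lra.
Qed.

(** * Complex differentiability in Caratheodory form *)

Definition ccont f z := forall e, 0 < e ->
  exists2 d, 0 < d & forall w, nc (w - z) < d -> nc (f w - f z) < e.

(** Away from [z] the slope [p] is forced to be the difference quotient, and [p z] is the
    derivative. The rules for sums and products become algebraic identities between slopes. *)
Definition cdiff f z := exists2 p : C -> C, ccont p z &
  forall w, f w = f z + p w * (w - z).

Lemma ccont_ext f g z : f =1 g -> ccont f z -> ccont g z.
Proof.
move=> fg cf e e0; have [d d0 H] := cf e e0; exists d => // w /H.
by rewrite !fg.
Qed.

Lemma ccont_cst c z : ccont (fun=> c) z.
Proof. by move=> e e0; exists 1 => // w _; rewrite subrr nc0. Qed.

Lemma ccont_id z : ccont id z.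
Proof. by move=> e e0; exists e. Qed.

Lemma ccont_bounded f z : ccont f z ->
  exists2 d, 0 < d & forall w, nc (w - z) < d -> nc (f w) < nc (f z) + 1.
Proof.
move=> /(_ 1 ltr01)[d d0 H]; exists d => // w /H.
by have := nc_sub_ge (f w) (f z); lra.
Qed.

Lemma ccontD f g z : ccont f z -> ccont g z -> ccont (fun w => f w + g w) z.
Proof.
move=> cf cg e e0; have e2 : 0 < e / 2 by lra.
have [d1 d10 H1] := cf _ e2; have [d2 d20 H2] := cg _ e2.
exists (Num.min d1 d2); first by rewrite lt_min d10.
move=> w; rewrite lt_min => /andP[/H1 h1 /H2 h2].
have := ncD (f w - f z) (g w - g z).
have -> : f w - f z + (g w - g z) = f w + g w - (f z + g z) by ring.
by lra.
Qed.

Lemma ccontM f g z : ccont f z -> ccont g z -> ccont (fun w => f w * g w) z.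
Proof.
move=> cf cg e e0; have [d0 d00 H0] := ccont_bounded cf.
have fz0 := nc_ge0 (f z); have gz0 := nc_ge0 (g z).
have e1 : 0 < e / 2 / (nc (f z) + 1) by rewrite divr_gt0 //; lra.
have e2 : 0 < e / 2 / (nc (g z) + 1) by rewrite divr_gt0 //; lra.
have [d1 d10 H1] := cf _ e2; have [d2 d20 H2] := cg _ e1.
exists (Num.min d0 (Num.min d1 d2)); first by rewrite !lt_min d00 d10.
move=> w; rewrite !lt_min => /and3P[/H0 h0 /H1 h1 /H2 h2].
have -> : f w * g w - f z * g z = f w * (g w - g z) + (f w - f z) * g z by ring.
apply: le_lt_trans (ncD _ _) _; rewrite !ncM.
have : nc (f w) * nc (g w - g z) < e / 2.
  apply: (@le_lt_trans _ _ ((nc (f z) + 1) * nc (g w - g z))).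
    by rewrite ler_wpM2r ?nc_ge0 //; lra.
  by rewrite mulrC -ltr_pdivlMr //; lra.
have : nc (f w - f z) * nc (g z) <= e / 2.
  apply: (@le_trans _ _ (nc (f w - f z) * (nc (g z) + 1))).
    by rewrite ler_wpM2l ?nc_ge0 //; lra.
  by rewrite -ler_pdivlMr; [exact: ltW|lra].
lra.
Qed.

Lemma ccontV f z : ccont f z -> f z != 0 -> ccont (fun w => (f w)^-1) z.
Proof.
move=> cf fz; have fz0 : 0 < nc (f z) by rewrite nc_gt0.
move=> e e0.
have e1 : 0 < Num.min (nc (f z) / 2) (e * (nc (f z) ^+ 2 / 2)).
  have := exprn_gt0 2 fz0 => ?; by rewrite lt_min !divr_gt0 //= mulr_gt0 ?divr_gt0.
have [d d0 H] := cf _ e1; exists d => // w /H; rewrite lt_min => /andP[h1 h2].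
have fw0 : nc (f z) / 2 < nc (f w).
  by have := nc_sub_ge (f z) (f w); rewrite nc_distC; lra.
have fw : f w != 0 by rewrite -nc_gt0; lra.
have -> : (f w)^-1 - (f z)^-1 = - (f w - f z) / (f w * f z).
  by field; rewrite fw fz.
rewrite ncM ncN ncV ncM ltr_pdivrMr ?mulr_gt0 //; last by lra.
apply: lt_le_trans h2 _; rewrite ler_wpM2l ?(ltW e0) //.
have -> : nc (f z) ^+ 2 / 2 = nc (f z) / 2 * nc (f z) by ring.
by rewrite ler_wpM2r ?nc_ge0 // ltW.
Qed.

Lemma ccontX f z n : ccont f z -> ccont (fun w => f w ^+ n) z.
Proof.
move=> cf; elim: n => [|n IH]; first exact: ccont_cst.
by apply: (@ccont_ext (fun w => f w * f w ^+ n)) (ccontM cf IH) => w; rewrite exprS.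
Qed.

Lemma cdiff_ccont f z : cdiff f z -> ccont f z.
Proof.
move=> [p cp E]; apply: (@ccont_ext (fun w => f z + p w * (w - z))) => //.
apply: ccontD; first exact: ccont_cst.
by apply: ccontM => //; apply: ccontD; [exact: ccont_id|exact: ccont_cst].
Qed.

Lemma cdiff_ext f g z : f =1 g -> cdiff f z -> cdiff g z.
Proof. by move=> fg [p cp E]; exists p => // w; rewrite -!fg. Qed.

Lemma cdiff_cst c z : cdiff (fun=> c) z.
Proof. by exists (fun=> 0) => [|w]; [exact: ccont_cst|rewrite mul0r addr0]. Qed.

Lemma cdiff_id z : cdiff id z.
Proof. by exists (fun=> 1) => [|w]; [exact: ccont_cst|rewrite /=; ring]. Qed.

Lemma cdiffD f g z : cdiff f z -> cdiff g z -> cdiff (fun w => f w + g w) z.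
Proof.
move=> [p cp E] [q cq F]; exists (fun w => p w + q w); first exact: ccontD.
by move=> w; rewrite E F; ring.
Qed.

Lemma cdiffM f g z : cdiff f z -> cdiff g z -> cdiff (fun w => f w * g w) z.
Proof.
move=> df [q cq F]; have cf := cdiff_ccont df; case: df => [p cp E].
exists (fun w => p w * g z + f w * q w).
  by apply: ccontD; apply: ccontM => //; exact: ccont_cst.
by move=> w; rewrite F {1}E; rewrite [X in _ = _ + (_ + X * _) * _]E; ring.
Qed.

Lemma cdiffN f z : cdiff f z -> cdiff (fun w => - f w) z.
Proof.
move=> df; apply: (@cdiff_ext (fun w => -1 * f w)) (cdiffM (cdiff_cst _ _) df).
by move=> w; rewrite mulN1r.
Qed.

Lemma cdiffB f g z : cdiff f z -> cdiff g z -> cdiff (fun w => f w - g w) z.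
Proof. by move=> df /cdiffN; exact: cdiffD. Qed.

Lemma cdiffX f z n : cdiff f z -> cdiff (fun w => f w ^+ n) z.
Proof.
move=> cf; elim: n => [|n IH]; first exact: cdiff_cst.
by apply: (@cdiff_ext (fun w => f w * f w ^+ n)) (cdiffM cf IH) => w; rewrite exprS.
Qed.

(* [f w] may vanish away from [z]; there the difference quotient itself is the slope. *)
Lemma cdiffV f z : cdiff f z -> f z != 0 -> cdiff (fun w => (f w)^-1) z.
Proof.
move=> df fz; have cf := cdiff_ccont df; case: df => [p cp E].
exists (fun w => if f w == 0 then - (f z)^-1 / (w - z) else - (p w / (f w * f z))).
  have cg : ccont (fun w => - (p w / (f w * f z))) z.
    apply: (@ccont_ext (fun w => -1 * (p w * (f w * f z)^-1))).
      by move=> w; rewrite mulN1r.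
    apply: ccontM; first exact: ccont_cst.
    apply: ccontM => //; apply: ccontV; last by rewrite mulf_neq0.
    by apply: ccontM => //; exact: ccont_cst.
  have fz0 : 0 < nc (f z) by rewrite nc_gt0.
  move=> e e0; have [d1 d10 H1] := cf _ fz0; have [d2 d20 H2] := cg _ e0.
  exists (Num.min d1 d2); first by rewrite lt_min d10.
  move=> w; rewrite lt_min => /andP[/H1 h1 /H2 h2].
  rewrite (negPf fz); case: eqP => [fw|//].
  by move: h1; rewrite fw sub0r ncN ltxx.
move=> w; case: eqP => [fw|/eqP fw].
  rewrite fw invr0; case: (eqVneq w z) => [wz|wz]; first by move: fz; rewrite -wz fw eqxx.
  by field; rewrite fz subr_eq0 wz.
have : p w * (w - z) = f w - f z by rewrite [in RHS]E; ring.
move=> h; rewrite mulNr mulrAC h; field; rewrite fw fz //.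
Qed.

Lemma cdiff_affine f a b z : cdiff f (a + b * z) -> cdiff (fun w => f (a + b * w)) z.
Proof.
move=> [p cp E]; exists (fun w => p (a + b * w) * b); last first.
  by move=> w; rewrite E; ring.
apply: ccontM; last exact: ccont_cst.
move=> e e0; have [d d0 H] := cp _ e0.
have nb := nc_ge0 b.
exists (d / (nc b + 1)); first by rewrite divr_gt0 //; lra.
move=> w hw; apply: H.
have -> : a + b * w - (a + b * z) = b * (w - z) by ring.
rewrite ncM; apply: le_lt_trans (_ : (nc b + 1) * nc (w - z) < d).
  by rewrite ler_wpM2r ?nc_ge0 //; lra.
by rewrite mulrC -ltr_pdivlMr //; lra.
Qed.

(** Reflecting both the variable and the value turns an antiholomorphic dependence into a
    holomorphic one. The second argument of the pulled back form is treated in this way. *)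
Lemma cdiff_conj f z : cdiff f (z^*)%C -> cdiff (fun w => (f (w^*)%C)^*%C) z.
Proof.
move=> [p cp E]; exists (fun w => (p (w^*)%C)^*%C).
  move=> e e0; have [d d0 H] := cp _ e0; exists d => // w hw.
  by rewrite -rmorphB /= nc_conj; apply: H; rewrite -rmorphB /= nc_conj.
by move=> w; rewrite E rmorphD rmorphM rmorphB /= conjcK conjcK.
Qed.

End OneVariable.

(** * Goursat subdivision and the maximum principle *)

Section Goursat.
Variable R : realType.
Local Notation C := R[i].
Local Notation I' := ('i%C : C).
Implicit Types (f g : C -> C) (z w a b c d u : C) (e M : R).

Lemma bisection_sup (x : nat -> R) :
  (forall k, x k <= x k.+1 /\ x k.+1 + 2^-1 ^+ k.+1 <= x k + 2^-1 ^+ k) ->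
  exists x0, forall k, x k <= x0 <= x k + 2^-1 ^+ k.
Proof.
move=> H.
have h0 k : 0 < (2^-1 : R) ^+ k by rewrite exprn_gt0 // invr_gt0.
have up k j : x k <= x (k + j)%N.
  elim: j => [|j IH]; first by rewrite addn0.
  by rewrite addnS; apply: le_trans IH (proj1 (H _)).
have dn k j : x (k + j)%N + 2^-1 ^+ (k + j) <= x k + 2^-1 ^+ k.
  elim: j => [|j IH]; first by rewrite addn0.
  by rewrite addnS; apply: le_trans (proj2 (H _)) IH.
have bd k j : x j <= x k + 2^-1 ^+ k.
  case: (leqP k j) => kj.
    by have := dn k (j - k)%N; rewrite subnKC //; have := h0 j; lra.
  by have := up j (k - j)%N; rewrite subnKC ?(ltnW kj) //; have := h0 k; lra.
pose E := [set y | exists k, y = x k]%classic.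
have ubE : has_ubound E by exists (x 0%N + 2^-1 ^+ 0) => _ [k ->].
exists (sup E) => k; apply/andP; split.
  by apply: (ub_le_sup ubE); exists k.
by apply: ge_sup => [|_ [j ->]]; [exists (x 0%N), 0%N|].
Qed.

(** Here [bad x y k] refers to the dyadic square with lower left corner [(x, y)] and side [2^-k];
    nested bad squares shrink to [(x0, y0)]. This is the compactness argument behind Goursat's lemma
    and, with [y] ignored, for the unit interval. *)
Lemma square_bisection (bad : R -> R -> nat -> Prop) :
  (forall x y k, bad x y k -> exists x' y',
     [/\ x' = x \/ x' = x + 2^-1 ^+ k.+1, y' = y \/ y' = y + 2^-1 ^+ k.+1
       & bad x' y' k.+1]) ->
  bad 0 0 0%N ->
  exists x0 y0, forall k, exists x y,
    [/\ 0 <= x, x + 2^-1 ^+ k <= 1, 0 <= y, y + 2^-1 ^+ k <= 1 &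
    [/\ bad x y k, x <= x0 <= x + 2^-1 ^+ k & y <= y0 <= y + 2^-1 ^+ k]].
Proof.
move=> step b0.
have h0 k : 0 < (2^-1 : R) ^+ k by rewrite exprn_gt0 // invr_gt0.
have hS k : (2^-1 : R) ^+ k = 2 * 2^-1 ^+ k.+1 by rewrite exprS; field.
pose T := (R * R * nat)%type.
(* Guarding the relation by [bad] makes it total, as dependent choice demands; badness along the
   sequence is recovered in [inv]. *)
pose Rel (s s' : T) := bad s.1.1 s.1.2 s.2 -> [/\ s'.2 = s.2.+1, bad s'.1.1 s'.1.2 s'.2,
   s'.1.1 = s.1.1 \/ s'.1.1 = s.1.1 + 2^-1 ^+ s.2.+1 &
   s'.1.2 = s.1.2 \/ s'.1.2 = s.1.2 + 2^-1 ^+ s.2.+1].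
have tot s : {s' | Rel s s'}.
  apply: cid; rewrite /Rel; case: (pselect (bad s.1.1 s.1.2 s.2)) => [bs|nb]; last by exists s.
  by have [x' [y' [Hx Hy B]]] := step _ _ _ bs; exists (x', y', s.2.+1).
have [f [f0 fS]] := @dependent_choice T Rel tot (0, 0, 0%N).
have inv k : (f k).2 = k /\ bad (f k).1.1 (f k).1.2 (f k).2.
  elim: k => [|k [E B]]; first by rewrite f0.
  by have [E' B' _ _] := fS k B; rewrite E' E in B' *.
have stx k : (f k.+1).1.1 = (f k).1.1 \/ (f k.+1).1.1 = (f k).1.1 + 2^-1 ^+ k.+1.
  by have [E B] := inv k; have [_ _ + _] := fS k B; rewrite E.
have sty k : (f k.+1).1.2 = (f k).1.2 \/ (f k.+1).1.2 = (f k).1.2 + 2^-1 ^+ k.+1.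
  by have [E B] := inv k; have [_ _ _] := fS k B; rewrite E.
have [x0 Hx] := @bisection_sup (fun k => (f k).1.1)
   ltac:(move=> k /=; have := hS k; have := h0 k.+1; move: (2^-1 ^+ k.+1) (2^-1 ^+ k) (stx k) => u v [] -> ? ?; split; lra).
have [y0 Hy] := @bisection_sup (fun k => (f k).1.2)
   ltac:(move=> k /=; have := hS k; have := h0 k.+1; move: (2^-1 ^+ k.+1) (2^-1 ^+ k) (sty k) => u v [] -> ? ?; split; lra).
exists x0, y0 => k; exists (f k).1.1, (f k).1.2.
have [E B] := inv k.
have bdx : 0 <= (f k).1.1 /\ (f k).1.1 + 2^-1 ^+ k <= 1.
  elim: {E B} k => [|k [IH1 IH2]]; first by rewrite f0 expr0 /=; lra.
  have := hS k; have := h0 k.+1.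
  by move: (2^-1 ^+ k.+1) (2^-1 ^+ k) IH2 (stx k) => u v ? [] -> ? ?; split; lra.
have bdy : 0 <= (f k).1.2 /\ (f k).1.2 + 2^-1 ^+ k <= 1.
  elim: {E B bdx} k => [|k [IH1 IH2]]; first by rewrite f0 expr0 /=; lra.
  have := hS k; have := h0 k.+1.
  by move: (2^-1 ^+ k.+1) (2^-1 ^+ k) IH2 (sty k) => u v ? [] -> ? ?; split; lra.
by case: bdx bdy => ? ? [? ?]; split=> //; split=> //; move: B; rewrite E.
Qed.

(** Midpoint sum over [2^n] equal pieces of the segment, in place of a line integral. It is exact on
    affine functions and compatible with affine substitutions at every finite [n], so no limit has
    to exist. *)
Fixpoint segsum (n : nat) (g : C -> C) (a b : C) : C :=
  if n is m.+1 then segsum m g a ((a + b) / 2) + segsum m g ((a + b) / 2) b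
  else (b - a) * g ((a + b) / 2).

Lemma segsum_anti n g a b : segsum n g b a = - segsum n g a b.
Proof.
elim: n a b => [|n IH] a b /=; first by rewrite [b + a]addrC; ring.
by rewrite [b + a]addrC (IH ((a + b) / 2) b) (IH a); ring.
Qed.

Lemma segsum_affine n g a b u c :
  segsum n g (u + c * a) (u + c * b) = c * segsum n (fun z => g (u + c * z)) a b.
Proof.
elim: n a b => [|n IH] a b /=.
  have -> : (u + c * a + (u + c * b)) / 2 = u + c * ((a + b) / 2) by field.
  by ring.
have -> : (u + c * a + (u + c * b)) / 2 = u + c * ((a + b) / 2) by field.
by rewrite !IH; ring.
Qed.

Lemma segsum_lin n g1 g2 k a b :
  segsum n (fun z => g1 z + k * g2 z) a b = segsum n g1 a b + k * segsum n g2 a b.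
Proof. by elim: n a b => [|n IH] a b /=; rewrite ?IH; ring. Qed.

Lemma segsum_aff n u c a b :
  segsum n (fun z => u + c * z) a b = (b - a) * (u + c * ((a + b) / 2)).
Proof. by elim: n a b => [|n IH] a b //=; rewrite !IH; field. Qed.

Lemma segsum_bound n g a b M :
  (forall t : R, 0 < t < 1 -> nc (g (a + t%:C%C * (b - a))) <= M) ->
  nc (segsum n g a b) <= M * nc (b - a).
Proof.
elim: n a b => [|n IH] a b E /=.
  have -> : (a + b) / 2 = a + (2^-1 : R)%:C%C * (b - a).
    by rewrite fmorphV rmorph_nat; field.
  by rewrite ncM mulrC ler_wpM2r ?nc_ge0 //; apply: E; lra.
have n2 : nc (2^-1 : C) = 2^-1.
  rewrite ncV; congr (_^-1).
  have -> : (2 : C) = (2 : R)%:C%C by rewrite rmorph_nat.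
  by rewrite nc_real ger0_norm.
have h1 : nc (segsum n g a ((a + b) / 2)) <= M * (nc (b - a) / 2).
  have -> : nc (b - a) / 2 = nc ((a + b) / 2 - a).
    have -> : (a + b) / 2 - a = (b - a) / 2 by field.
    by rewrite ncM n2.
  apply: IH => t /andP[t0 t1].
  have -> : a + t%:C%C * ((a + b) / 2 - a) = a + (t / 2)%:C%C * (b - a).
    by rewrite rmorphM fmorphV rmorph_nat /=; field.
  by apply: E; lra.
have h2 : nc (segsum n g ((a + b) / 2) b) <= M * (nc (b - a) / 2).
  have -> : nc (b - a) / 2 = nc (b - (a + b) / 2).
    have -> : b - (a + b) / 2 = (b - a) / 2 by field.
    by rewrite ncM n2.
  apply: IH => t /andP[t0 t1].
  have -> : (a + b) / 2 + t%:C%C * (b - (a + b) / 2) = a + ((1 + t) / 2)%:C%C * (b - a).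
    by rewrite rmorphM fmorphV rmorphD rmorph1 rmorph_nat /=; field.
  by apply: E; lra.
by apply: le_trans (ncD _ _) _; lra.
Qed.

Definition sqsum n g a d : C :=
  segsum n g a (a + d) + segsum n g (a + d) (a + d + I' * d) +
  segsum n g (a + d + I' * d) (a + I' * d) + segsum n g (a + I' * d) a.

(** The first halving at level [n.+1] cuts each side at a corner of the quarters, and the sums over
    the inner sides cancel exactly, being taken twice with opposite orientations. *)
Lemma sqsum_split n g a d : sqsum n.+1 g a d =
  sqsum n g a (d / 2) + sqsum n g (a + d / 2) (d / 2) +
  sqsum n g (a + d / 2 + I' * (d / 2)) (d / 2) + sqsum n g (a + I' * (d / 2)) (d / 2).
Proof.
rewrite /sqsum /=.
set d2 := d / 2.
have -> : d = d2 + d2 by rewrite /d2; field.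
have -> : (a + (a + (d2 + d2))) / 2 = a + d2 by field.
have -> : (a + (d2 + d2) + (a + (d2 + d2) + I' * (d2 + d2))) / 2 =
  a + d2 + d2 + I' * d2 by field.
have -> : (a + (d2 + d2) + I' * (d2 + d2) + (a + I' * (d2 + d2))) / 2 =
  a + d2 + I' * d2 + I' * d2 by field.
have -> : (a + I' * (d2 + d2) + a) / 2 = a + I' * d2 by field.
have -> : a + (d2 + d2) = a + d2 + d2 by ring.
have -> : a + d2 + d2 + I' * (d2 + d2) = a + d2 + d2 + I' * d2 + I' * d2 by ring.
have -> : a + d2 + I' * d2 + d2 = a + d2 + d2 + I' * d2 by ring.
have -> : a + I' * d2 + d2 = a + d2 + I' * d2 by ring.
have -> : a + I' * (d2 + d2) = a + I' * d2 + I' * d2 by ring.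
rewrite (segsum_anti n g (a + d2) (a + d2 + I' * d2)).
rewrite (segsum_anti n g (a + d2 + I' * d2) (a + d2 + d2 + I' * d2)).
rewrite (segsum_anti n g (a + I' * d2) (a + d2 + I' * d2)).
rewrite (segsum_anti n g (a + d2 + I' * d2) (a + d2 + I' * d2 + I' * d2)).
ring.
Qed.

(* The four subsquares have the center [c] as a common corner. *)
Lemma sqsum_center n g c d : sqsum n.+1 g (c - d - I' * d) (d + d) =
  sqsum n g c d + sqsum n g c (I' * d) + sqsum n g c (- d) + sqsum n g c (- (I' * d)).
Proof.
have ii : I' * I' = -1 by rewrite -expr2 sqr_i.
rewrite /sqsum /=.
have iid x : I' * (I' * x) = - x by rewrite mulrA ii mulN1r.
rewrite !mulrN !iid !opprK.
have -> : (c - d - I' * d + (c - d - I' * d + (d + d))) / 2 = c - I' * d by field.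
have -> : (c - d - I' * d + (d + d) + (c - d - I' * d + (d + d) + I' * (d + d))) / 2
  = c + d by field.
have -> : (c - d - I' * d + (d + d) + I' * (d + d) + (c - d - I' * d + I' * (d + d))) / 2
  = c + I' * d by field.
have -> : (c - d - I' * d + I' * (d + d) + (c - d - I' * d)) / 2 = c - d by field.
have -> : c - d - I' * d + (d + d) = c - I' * d + d by ring.
have -> : c - I' * d + d + I' * (d + d) = c + d + I' * d by ring.
have -> : c - d - I' * d + I' * (d + d) = c + I' * d - d by ring.
have -> : c - d - I' * d = c - d - I' * d by ring.
rewrite (segsum_anti n g c (c + d)) (segsum_anti n g c (c + I' * d)).
rewrite (segsum_anti n g c (c - d)) (segsum_anti n g c (c - I' * d)).
ring.
Qed.

Lemma sqsum_lin n g1 g2 k a d :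
  sqsum n (fun z => g1 z + k * g2 z) a d = sqsum n g1 a d + k * sqsum n g2 a d.
Proof. by rewrite /sqsum !segsum_lin; ring. Qed.

Lemma sqsum_aff n u c a d : sqsum n (fun z => u + c * z) a d = 0.
Proof. by rewrite /sqsum !segsum_aff; field. Qed.

Lemma sqsum_scale n g u a d :
  sqsum n g (u + d * a) d = d * sqsum n (fun z => g (u + d * z)) a 1.
Proof.
rewrite /sqsum.
rewrite (_ : u + d * a + d + I' * d = u + d * (a + 1 + I' * 1)); last by ring.
rewrite (_ : u + d * a + I' * d = u + d * (a + I' * 1)); last by ring.
rewrite (_ : u + d * a + d = u + d * (a + 1)); last by ring.
by rewrite !segsum_affine; ring.
Qed.

End Goursat.

(** * Goursat's lemma on squares *)

Section Goursat2.
Variable R : realType.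
Local Notation C := R[i].
Local Notation I' := ('i%C : C).
Implicit Types (f g : C -> C) (z w a b c d u : C) (e M x y t : R).

Definition pt x y : C := Complex x y.

Lemma ptE x y : pt x y = x%:C%C + I' * y%:C%C.
Proof. exact: complexE. Qed.

Lemma ptDr x y t : pt x y + t%:C%C = pt (x + t) y.
Proof. by apply/eqP; rewrite eq_complex /= addr0 !eqxx. Qed.

Lemma ptDi x y t : pt x y + I' * t%:C%C = pt x (y + t).
Proof. by apply/eqP; rewrite eq_complex /= !mul0r !mul1r subr0 !addr0 add0r !eqxx. Qed.

Lemma expr_half_lt e : 0 < e -> exists k, (2^-1 : R) ^+ k < e.
Proof.
move=> e0; have := archi_boundP (ltW (divr_gt0 ltr01 e0)).
set k := Num.bound _ => hk; exists k.
rewrite exprVn -[e]invrK ltf_pV2 ?posrE ?exprn_gt0 ?invr_gt0 //.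
apply: lt_le_trans (_ : k%:R <= _); first by rewrite -div1r.
by rewrite -natrX ler_nat ltnW // ltn_expl.
Qed.

(** Plays the role of a bound [e] on the modulus of the integral around the square: only an eventual
    bound on the sums, without their convergence. *)
Definition small g a d e :=
  exists N, forall n, (N <= n)%N -> nc (sqsum n g a d) <= e.

Lemma small_le g a d e e' : e <= e' -> small g a d e -> small g a d e'.
Proof. by move=> ee [N H]; exists N => n /H h; apply: le_trans h ee. Qed.

Lemma sqsum_bound n g a d M :
  (forall t, 0 < t < 1 -> [/\ nc (g (a + pt t 0 * d)) <= M,
     nc (g (a + pt 1 t * d)) <= M, nc (g (a + pt t 1 * d)) <= M &
     nc (g (a + pt 0 t * d)) <= M]) ->
  nc (sqsum n g a d) <= 4 * M * nc d.
Proof.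
move=> H.
have nci (x : C) : nc (I' * x) = nc x by rewrite ncM nc_i mul1r.
have h1 : nc (segsum n g a (a + d)) <= M * nc d.
  have -> : nc d = nc (a + d - a) by congr nc; ring.
  apply: segsum_bound => t /H[+ _ _ _]; rewrite ptE.
  by congr (nc (g _) <= _); rewrite rmorph0; ring.
have h2 : nc (segsum n g (a + d) (a + d + I' * d)) <= M * nc d.
  have -> : nc d = nc (a + d + I' * d - (a + d)) by rewrite -nci; congr nc; ring.
  apply: segsum_bound => t /H[_ + _ _]; rewrite ptE.
  by congr (nc (g _) <= _); rewrite rmorph1; ring.
have h3 : nc (segsum n g (a + d + I' * d) (a + I' * d)) <= M * nc d.
  rewrite segsum_anti ncN.
  have -> : nc d = nc (a + d + I' * d - (a + I' * d)) by congr nc; ring.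
  apply: segsum_bound => t /H[_ _ + _]; rewrite ptE.
  by congr (nc (g _) <= _); rewrite rmorph1; ring.
have h4 : nc (segsum n g (a + I' * d) a) <= M * nc d.
  rewrite segsum_anti ncN.
  have -> : nc d = nc (a + I' * d - a) by rewrite -nci; congr nc; ring.
  apply: segsum_bound => t /H[_ _ _ +]; rewrite ptE.
  by congr (nc (g _) <= _); rewrite rmorph0; ring.
rewrite /sqsum.
set s1 := segsum _ _ _ _ in h1 *; set s2 := segsum _ _ _ _ in h2 *.
set s3 := segsum _ _ _ _ in h3 *; set s4 := segsum _ _ _ _ in h4 *.
have := ncD (s1 + s2 + s3) s4; have := ncD (s1 + s2) s3; have := ncD s1 s2.
lra.
Qed.

Lemma small_split g a d e1 e2 e3 e4 : small g a (d / 2) e1 ->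
  small g (a + d / 2) (d / 2) e2 -> small g (a + d / 2 + I' * (d / 2)) (d / 2) e3 ->
  small g (a + I' * (d / 2)) (d / 2) e4 -> small g a d (e1 + e2 + e3 + e4).
Proof.
move=> [n1 h1] [n2 h2] [n3 h3] [n4 h4]; exists (n1 + n2 + n3 + n4).+1%N => -[//|n].
rewrite ltnS => hn; rewrite sqsum_split.
have {}h1 := h1 n ltac:(by apply: leq_trans hn; rewrite -!addnA leq_addr).
have {}h2 := h2 n ltac:(by apply: leq_trans hn; rewrite [(n1 + n2)%N]addnC -!addnA leq_addr).
have {}h3 := h3 n ltac:(by apply: leq_trans hn; rewrite addnAC leq_addl).
have {}h4 := h4 n ltac:(by apply: leq_trans hn; rewrite leq_addl).
move: h1 h2 h3 h4.
set s1 := sqsum _ _ _ _; set s2 := sqsum _ _ _ _.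
set s3 := sqsum _ _ _ _; set s4 := sqsum _ _ _ _ => h1 h2 h3 h4.
have := ncD (s1 + s2 + s3) s4; have := ncD (s1 + s2) s3; have := ncD s1 s2.
lra.
Qed.

(** Bisection runs on the bound [e * h ^ 2], which a square of side [h] inherits from its four
    quarters. *)
Lemma goursat_unit g : (forall x y, 0 <= x <= 1 -> 0 <= y <= 1 -> cdiff g (pt x y)) ->
  forall e, 0 < e -> small g 0 1 e.
Proof.
move=> dg e e0; apply: contrapT => nS.
pose h k : R := 2^-1 ^+ k.
have h0 k : 0 < h k by rewrite exprn_gt0 // invr_gt0.
have hS k : h k.+1 = h k / 2 by rewrite /h exprSr.
pose bad x y k := ~ small g (pt x y) (h k)%:C%C (e * h k ^+ 2).
have b0 : bad 0 0 0%N by rewrite /bad /h expr0 expr1n mulr1.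
have step x y k : bad x y k -> exists x' y',
     [/\ x' = x \/ x' = x + 2^-1 ^+ k.+1, y' = y \/ y' = y + 2^-1 ^+ k.+1
       & bad x' y' k.+1].
  move=> bk; apply: contrapT => nb; apply: bk.
  have S x' y' : (x' = x \/ x' = x + h k.+1) -> (y' = y \/ y' = y + h k.+1) ->
      small g (pt x' y') (h k.+1)%:C%C (e * h k.+1 ^+ 2).
    by move=> Hx Hy; apply: contrapT => nS'; apply: nb; exists x', y'.
  have E : (h k)%:C%C / 2 = (h k.+1)%:C%C :> C.
    by rewrite hS rmorphM fmorphV rmorph_nat.
  have -> : e * h k ^+ 2 = e * h k.+1 ^+ 2 + e * h k.+1 ^+ 2 + e * h k.+1 ^+ 2
      + e * h k.+1 ^+ 2 by rewrite hS; field.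
  apply: small_split; rewrite E ?ptDr ?ptDi; apply: S; by [left|right].
have [x0 [y0 H]] := square_bisection step b0.
have [x00 y00] : 0 <= x0 <= 1 /\ 0 <= y0 <= 1.
  by have [x [y []]] := H 0%N; rewrite expr0 => ? ? ? ? [_ ? ?]; split; lra.
have [p cp E] := dg _ _ x00 y00.
(* The affine part of [g] at [z0] has sum zero. The remainder is at most [e / 8 * (2 * h)] on a
   boundary of length [4 * h], which makes exactly [e * h ^ 2]. *)
have [d d0 Hd] := cp (e / 8) ltac:(lra).
have [k hk] := @expr_half_lt (d / 2) ltac:(lra).
have [x [y [_ _ _ _ [bk Hx Hy]]]] := H k.
apply: bk; exists 0%N => n _.
rewrite -/(h k) in hk Hx Hy *; have hk0 := h0 k.
set z0 := pt x0 y0 in E Hd cp *.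
have -> : sqsum n g (pt x y) (h k)%:C%C =
    sqsum n (fun w => (p w - p z0) * (w - z0)) (pt x y) (h k)%:C%C.
  transitivity (sqsum n (fun w => (g z0 - p z0 * z0 + p z0 * w)
     + 1 * ((p w - p z0) * (w - z0))) (pt x y) (h k)%:C%C).
    by congr sqsum; apply/funext => w; rewrite E; ring.
  by rewrite (sqsum_lin n (fun w => g z0 - p z0 * z0 + p z0 * w)) sqsum_aff; ring.
have -> : e * h k ^+ 2 = 4 * (e / 8 * (2 * h k)) * nc ((h k)%:C%C : C).
  by rewrite nc_real gtr0_norm //; field.
apply: sqsum_bound => t t01.
have B x' y' : 0 <= x' <= 1 -> 0 <= y' <= 1 ->
    nc ((p (pt x y + pt x' y' * (h k)%:C%C) - p z0) * (pt x y + pt x' y' * (h k)%:C%C - z0))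
    <= e / 8 * (2 * h k).
  move=> Hx' Hy'.
  have nz : nc (pt x y + pt x' y' * (h k)%:C%C - z0) <= 2 * h k.
    apply: le_trans (nc_le_ReIm _) _; rewrite /= !mulr0 subr0 add0r.
    have ? : `|x + x' * h k - x0| <= h k by rewrite ler_norml; nra.
    have ? : `|y + y' * h k - y0| <= h k by rewrite ler_norml; nra.
    lra.
  rewrite ncM; apply: ler_pM; rewrite ?nc_ge0 //.
  by apply/ltW/Hd; apply: le_lt_trans nz _; lra.
by split; apply: B; lra.
Qed.

Lemma goursat g a d :
  (forall x y, 0 <= x <= 1 -> 0 <= y <= 1 -> cdiff g (a + pt x y * d)) ->
  forall e, 0 < e -> small g a d e.
Proof.
move=> dg e e0.
have nd := nc_ge0 d.
have [N H] := @goursat_unit (fun z => g (a + d * z))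
  ltac:(by move=> x y Hx Hy; apply: cdiff_affine; rewrite mulrC; exact: dg)
  (e / (nc d + 1)) ltac:(by rewrite divr_gt0 //; lra).
exists N => n /H hn.
have -> : sqsum n g a d = d * sqsum n (fun z => g (a + d * z)) 0 1.
  by rewrite -sqsum_scale; congr sqsum; ring.
rewrite ncM; apply: le_trans (_ : nc d * (e / (nc d + 1)) <= _).
  by rewrite ler_wpM2l.
by rewrite mulrA ler_pdivrMr; nra.
Qed.

(** The three quarters that miss the corner [c] are small by Goursat at any tolerance, so only the
    quarter at [c] matters; after [k] halvings its side is [d] times [2^-k]. *)
Lemma goursat_corner_step k g c d e e' :
  (forall x y, 0 <= x <= 1 -> 0 <= y <= 1 -> pt x y != 0 -> cdiff g (c + pt x y * d)) ->
  e < e' -> small g c (d * (2^-1 ^+ k)%:C%C) e -> small g c d e'.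
Proof.
elim: k d e e' => [|k IH] d e e' dg ee' S.
  by apply: small_le (ltW ee') _; move: S; rewrite expr0 rmorph1 mulr1.
have d2 : d / 2 = d * (2^-1 : R)%:C%C by rewrite fmorphV rmorph_nat.
have q0 : 0 < (e' - e) / 4 by lra.
have S1 : small g c (d / 2) ((e + e') / 2 - (e' - e)/4).
  apply: (IH _ e); [|lra|].
    move=> x y Hx Hy nz.
    have -> : pt x y * (d / 2) = pt (x / 2) (y / 2) * d.
      by rewrite !ptE !rmorphM fmorphV rmorph_nat /=; field.
    apply: dg; [lra|lra|]; apply: contra nz.
    rewrite !eq_complex /= => /andP[/eqP ? /eqP ?]; apply/andP; split; apply/eqP; lra.
  by move: S; rewrite exprS rmorphM d2 mulrA.
have -> : e' = ((e + e') / 2 - (e' - e)/4) + (e' - e) / 4 + (e' - e) / 4 + (e' - e) / 4.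
  by field.
have G x y : 0 <= x <= 2^-1 -> 0 <= y <= 2^-1 -> pt x y != 0 ->
    small g (c + pt x y * d) (d / 2) ((e' - e) / 4).
  move=> Hx Hy nz; apply: goursat => // x' y' Hx' Hy'.
  have -> : c + pt x y * d + pt x' y' * (d / 2) = c + pt (x + x' / 2) (y + y' / 2) * d.
    by rewrite !ptE !(rmorphD, rmorphM) fmorphV rmorph_nat /=; field.
  apply: dg; [lra|lra|]; apply: contra nz.
  by rewrite !eq_complex /= => /andP[/eqP ? /eqP ?]; apply/andP; split; apply/eqP; lra.
have half1 : 0 <= (2^-1 : R) <= 2^-1 by lra.
have half0 : 0 <= (0 : R) <= 2^-1 by lra.
have nz x : pt 2^-1 x != 0 by rewrite eq_complex /= invr_eq0 pnatr_eq0.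
have nz' x : pt x 2^-1 != 0 by rewrite eq_complex /= invr_eq0 pnatr_eq0 andbF.
apply: small_split => //.
- have -> : c + d / 2 = c + pt 2^-1 0 * d by rewrite ptE fmorphV rmorph_nat rmorph0; ring.
  exact: G.
- have -> : c + d / 2 + I' * (d / 2) = c + pt 2^-1 2^-1 * d.
    by rewrite ptE fmorphV rmorph_nat; ring.
  exact: G.
- have -> : c + I' * (d / 2) = c + pt 0 2^-1 * d.
    by rewrite ptE fmorphV rmorph_nat rmorph0; ring.
  exact: G.
Qed.

(** On a tiny square at the corner, continuity gives the crude bound length times maximum. The lemma
    is made for difference quotients, known to be continuous at their base point but not yet
    differentiable there. *)
Lemma goursat_corner g c d : ccont g c ->
  (forall x y, 0 <= x <= 1 -> 0 <= y <= 1 -> pt x y != 0 -> cdiff g (c + pt x y * d)) ->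
  forall e, 0 < e -> small g c d e.
Proof.
move=> cg dg e e0.
have [r r0 Hr] := ccont_bounded cg.
set M := nc (g c) + 1 in Hr.
have M0 : 0 < M by have := nc_ge0 (g c); rewrite /M; lra.
have nd := nc_ge0 d.
have q0 : 0 < Num.min (r / (2 * (nc d + 1))) (e / (8 * M * (nc d + 1))).
  by rewrite lt_min !divr_gt0 ?mulr_gt0 //; lra.
have [k] := expr_half_lt q0; rewrite lt_min => /andP[k1 k2].
have hk0 : 0 < (2^-1 : R) ^+ k by rewrite exprn_gt0 // invr_gt0.
apply: (@goursat_corner_step k _ _ _ (e / 2)) => //; first by lra.
set h := (2^-1 : R) ^+ k in k1 k2 hk0 *.
exists 0%N => n _.
have ndh : nc (d * h%:C%C) = nc d * h by rewrite ncM nc_real gtr0_norm.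
move: k1 k2; rewrite !ltr_pdivlMr ?mulr_gt0 //; try lra; move=> k1 k2.
apply: le_trans (_ : 4 * M * nc (d * h%:C%C) <= _); last first.
  rewrite ndh; move: k2; have -> : h * (8 * M * (nc d + 1)) = 2 * (4 * M * (nc d * h)) + 8 * M * h by ring.
  by have := mulr_gt0 M0 hk0; lra.
apply: sqsum_bound => t t01.
have B x' y' : 0 <= x' <= 1 -> 0 <= y' <= 1 -> nc (g (c + pt x' y' * (d * h%:C%C))) <= M.
  move=> Hx Hy; apply/ltW/Hr.
  have -> : c + pt x' y' * (d * h%:C%C) - c = pt x' y' * (d * h%:C%C) by ring.
  rewrite ncM ndh.
  have : nc (pt x' y') <= 2.
    by apply: le_trans (nc_le_ReIm _) _; rewrite /= !ger0_norm; lra.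
  have := nc_ge0 (pt x' y'); move: k1 hk0 nd.
  set n1 := nc (pt _ _); move: (nc d) => D.
  move=> k1 hk0 nd n0 n2; have : n1 * (D * h) <= 2 * (D * h) by rewrite ler_wpM2r // mulr_ge0 // ltW.
  by move: k1; rewrite mulrCA mulrDr; lra.
by split; apply: B; lra.
Qed.

End Goursat2.

(** * A Cauchy estimate at the center of a square *)

Section Center.
Variable R : realType.
Local Notation C := R[i].
Local Notation I' := ('i%C : C).
Implicit Types (f g : C -> C) (z w a b c d u : C) (e M x y t : R).

Lemma cdiff_local f g z r : 0 < r -> (forall w, nc (w - z) < r -> f w = g w) ->
  cdiff f z -> cdiff g z.
Proof.
move=> r0 fg [p cp E].
have zz : nc (z - z) < r by rewrite subrr nc0.
exists (fun w => if w == z then p z else (g w - g z) / (w - z)); last first.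
  move=> w; case: eqP => [->|/eqP wz]; first by rewrite subrr mulr0 addr0.
  by rewrite divfK ?subr_eq0 //; ring.
move=> e e0; have [d d0 H] := cp e e0; exists (Num.min d r); first by rewrite lt_min d0.
move=> w; rewrite lt_min => /andP[wd wr]; rewrite eqxx.
case: eqP => [_|/eqP wz]; first by rewrite subrr nc0.
rewrite -!fg // E.
have -> : f z + p w * (w - z) - f z = p w * (w - z) by ring.
by rewrite mulfK ?subr_eq0 //; apply: H.
Qed.

Lemma segsum_scal n g k a b : segsum n (fun z => k * g z) a b = k * segsum n g a b.
Proof. by elim: n a b => [|n IH] a b /=; rewrite ?IH; ring. Qed.

Lemma segsum_inv_scale n c a b : c != 0 ->
  segsum n (@GRing.inv C) (c * a) (c * b) = segsum n (@GRing.inv C) a b.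
Proof.
move=> c0; have := segsum_affine n (@GRing.inv C) a b 0 c; rewrite !add0r => ->.
rewrite -segsum_scal; congr segsum; apply/funext => z.
by rewrite add0r invfM mulrA mulfV // mul1r.
Qed.

Lemma segsum0 g a b : segsum 0 g a b = (b - a) * g ((a + b) / 2).
Proof. by []. Qed.

Lemma segsumS n g a b : segsum n.+1 g a b =
  segsum n g a ((a + b) / 2) + segsum n g ((a + b) / 2) b.
Proof. by []. Qed.

Lemma segsum_inv_Im n s t : -1 <= s -> s <= t -> t <= 1 ->
  (t - s) / 2 <= complex.Im (segsum n (@GRing.inv C) (pt 1 s) (pt 1 t)).
Proof.
have mid s' t' : (pt 1 s' + pt 1 t') / 2 = pt 1 ((s' + t') / 2) :> C.
  by rewrite !ptE !rmorphM !rmorphD fmorphV rmorph_nat rmorph1; field.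
elim: n s t => [|n IH] s t s1 st t1; last first.
  rewrite segsumS mid raddfD.
  have := IH s ((s + t) / 2) ltac:(lra) ltac:(lra) ltac:(lra).
  have := IH ((s + t) / 2) t ltac:(lra) ltac:(lra) ltac:(lra).
  lra.
rewrite segsum0 mid; set m := (s + t) / 2.
have hm : -1 <= m <= 1 by rewrite /m; lra.
rewrite cImM /= subrr mul0r add0r expr1n mul1r.
rewrite ler_pdivrMr; last by lra.
rewrite -mulrA ler_peMr; [by []|lra|].
rewrite mulrC -ler_pdivrMr ?invr_gt0; last by nra.
by rewrite invrK mul1r; nra.
Qed.

(** The four sides are rotations of the side from [1 - i] to [1 + i], and [dz / z] is invariant
    under rotation. Each contributes at least 1 to the imaginary part, by
    [(t - s) / (1 + m ^ 2) >= (t - s) / 2]. The bound 4 stands in for [2 pi]. *)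
Lemma sqsum_inv n : 4 <= complex.Im (sqsum n (@GRing.inv C) (0 - 1 - I' * 1) (1 + 1)).
Proof.
have ii : I' * I' = -1 by rewrite -expr2 sqr_i.
set s := segsum n (@GRing.inv C) (pt 1 (-1)) (pt 1 1).
have hs : 1 <= complex.Im s by have := @segsum_inv_Im n (-1) 1; rewrite -/s; lra.
have i0 : I' != 0 by rewrite -nc_gt0 nc_i.
have p1 : pt 1 (-1) = 1 - I' :> C by rewrite ptE rmorph1 rmorphN rmorph1; ring.
have p2 : pt 1 1 = 1 + I' :> C by rewrite ptE rmorph1; ring.
have e1 : - I' * (1 - I') = 0 - 1 - I' * 1.
  by transitivity (- I' + I' * I'); [ring|rewrite ii; ring].
have e2 : - I' * (1 + I') = 1 - I' * 1.
  by transitivity (- I' - I' * I'); [ring|rewrite ii; ring].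
have e3 : I' * (1 - I') = 1 + I' by transitivity (I' - I' * I'); [ring|rewrite ii; ring].
have e4 : I' * (1 + I') = - 1 + I' by transitivity (I' + I' * I'); [ring|rewrite ii; ring].
have -> : sqsum n (@GRing.inv C) (0 - 1 - I' * 1) (1 + 1) = s + s + s + s.
  rewrite /sqsum; congr (_ + _ + _ + _).
  - rewrite /s p1 p2 -(@segsum_inv_scale n (- I') (1 - I') (1 + I')) ?oppr_eq0 // e1 e2.
    by congr segsum; ring.
  - rewrite /s p1 p2; congr segsum; ring.
  - rewrite /s p1 p2 -(@segsum_inv_scale n I' (1 - I') (1 + I')) // e3 e4.
    by congr segsum; ring.
  - rewrite /s p1 p2 -(@segsum_inv_scale n (-1) (1 - I') (1 + I')) ?oppr_eq0 ?oner_eq0 //.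
    by congr segsum; ring.
by rewrite !raddfD /=; lra.
Qed.

Definition on_side x y : Prop := [/\ -1 <= x <= 1, -1 <= y <= 1 &
  [\/ x = 1, x = -1, y = 1 | y = -1]].

Lemma sqsum_boundary_bound n g M : (forall x y, on_side x y -> nc (g (pt x y)) <= M) ->
  nc (sqsum n g (0 - 1 - I' * 1) (1 + 1)) <= 8 * M.
Proof.
move=> H.
have -> : 8 * M = 4 * M * nc (1 + 1 : C).
  have -> : (1 + 1 : C) = (2 : R)%:C%C by rewrite rmorph_nat.
  by rewrite nc_real ger0_norm //; ring.
have E x y : 0 - 1 - I' * 1 + pt x y * (1 + 1) = pt (2 * x - 1) (2 * y - 1).
  by rewrite !ptE !rmorphB !rmorphM rmorph1 rmorph_nat; ring.
apply: sqsum_bound => t t01; rewrite !E.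
split; apply: H; (split; [lra|lra|]); [apply: Or44|apply: Or41|apply: Or43|apply: Or42]; lra.
Qed.

Lemma sqsum_boundary_ext n g1 g2 : (forall x y, on_side x y -> g1 (pt x y) = g2 (pt x y)) ->
  sqsum n g1 (0 - 1 - I' * 1) (1 + 1) = sqsum n g2 (0 - 1 - I' * 1) (1 + 1).
Proof.
move=> H; apply/eqP; rewrite -subr_eq0 -nc_eq0 eq_le nc_ge0 andbT.
have -> : sqsum n g1 (0 - 1 - I' * 1) (1 + 1) - sqsum n g2 (0 - 1 - I' * 1) (1 + 1) =
   sqsum n (fun z => g1 z + -1 * g2 z) (0 - 1 - I' * 1) (1 + 1).
  by rewrite sqsum_lin; ring.
apply: le_trans (@sqsum_boundary_bound _ _ 0 _) _; last by rewrite mulr0.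
by move=> x y /H ->; rewrite mulN1r subrr nc0.
Qed.

(** A substitute for Cauchy's formula. The difference quotient [p] has small sums over the four
    squares meeting at 0, so [f 0] times the sum of [1 / z] is close to the sum of [f / z]. The
    latter is at most [8 M] (length 8, modulus of [z] at least 1), the former at least [4 |f 0|],
    whence the factor 2. *)
Lemma center_bound f M :
  (forall x y, -1 <= x <= 1 -> -1 <= y <= 1 -> cdiff f (pt x y)) ->
  (forall x y, on_side x y -> nc (f (pt x y)) <= M) -> nc (f 0) <= 2 * M.
Proof.
move=> df fM.
have z0 : pt 0 0 = 0 :> C by [].
have [p cp E] : cdiff f 0 by rewrite -z0; apply: df; lra.
have pE w : w != 0 -> p w = (f w - f 0) / w.
  by move=> w0; rewrite [f w]E subr0 addrC addKr mulfK.
have dp x y : -1 <= x <= 1 -> -1 <= y <= 1 -> pt x y != 0 -> cdiff p (pt x y).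
  move=> Hx Hy nz.
  apply: (@cdiff_local (fun w => (f w - f 0) / w) _ _ (nc (pt x y))).
  - by rewrite nc_gt0.
  - move=> w hw; rewrite pE //; apply/eqP => w0; move: hw.
    by rewrite w0 sub0r ncN ltxx.
  apply: cdiffM; last by apply: cdiffV => //; exact: cdiff_id.
  by apply: cdiffB; [exact: df|exact: cdiff_cst].
have i2 x y : I' * pt x y = pt (- y) x.
  by apply/eqP; rewrite eq_complex /=; apply/andP; split; apply/eqP; ring.
have corner (d : C) : (d = 1 \/ d = I') \/ (d = -1 \/ d = - (I' * 1)) ->
    forall e, 0 < e -> small p 0 d e.
  move=> Hd; apply: goursat_corner => // x y Hx Hy nz; rewrite add0r mulrC.
  case: Hd => [[]|[]] ->; rewrite ?mulr1 ?mul1r ?mulNr ?mul1r ?i2.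
  - by apply: dp => //; lra.
  - apply: dp; [lra|lra|].
    by apply: contra nz; rewrite !eq_complex /= oppr_eq0 andbC.
  - rewrite (_ : - pt x y = pt (- x) (- y)) //; apply: dp; [lra|lra|].
    by apply: contra nz; rewrite !eq_complex /= !oppr_eq0.
  - rewrite (_ : - pt (- y) x = pt (- - y) (- x)) // opprK; apply: dp; [lra|lra|].
    by apply: contra nz; rewrite !eq_complex /= !oppr_eq0 andbC.
rewrite leNgt; apply/negP => lt.
(* The four corner squares contribute [4 * e], half of the presumed excess [4 |f 0| - 8 M]. *)
set e := (4 * nc (f 0) - 8 * M) / 8.
have e0 : 0 < e by rewrite /e; lra.
have [n1 h1] := corner 1 ltac:(by left; left) e e0.
have [n2 h2] := corner (I' * 1) ltac:(by left; right; rewrite mulr1) e e0.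
have [n3 h3] := corner (-1) ltac:(by right; left) e e0.
have [n4 h4] := corner (- (I' * 1)) ltac:(by right; right) e e0.
set n := (n1 + n2 + n3 + n4)%N.
have {}h1 := h1 n ltac:(by rewrite /n -!addnA leq_addr).
have {}h2 := h2 n ltac:(by rewrite /n [(n1 + n2)%N]addnC -!addnA leq_addr).
have {}h3 := h3 n ltac:(by rewrite /n addnAC leq_addl).
have {}h4 := h4 n ltac:(by rewrite /n leq_addl).
have hp : nc (sqsum n.+1 p (0 - 1 - I' * 1) (1 + 1)) <= 4 * e.
  rewrite sqsum_center; move: h1 h2 h3 h4.
  set s1 := sqsum _ _ _ _; set s2 := sqsum _ _ _ _.
  set s3 := sqsum _ _ _ _; set s4 := sqsum _ _ _ _ => h1 h2 h3 h4.
  have := ncD (s1 + s2 + s3) s4; have := ncD (s1 + s2) s3; have := ncD s1 s2.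
  lra.
have nz x y : on_side x y -> pt x y != 0.
  move=> [_ _ H]; rewrite eq_complex /=.
  by apply/negP => /andP[/eqP x0 /eqP y0]; case: H; lra.
have Ep : sqsum n.+1 p (0 - 1 - I' * 1) (1 + 1) =
    sqsum n.+1 (fun w => f w / w) (0 - 1 - I' * 1) (1 + 1)
    + - f 0 * sqsum n.+1 (@GRing.inv C) (0 - 1 - I' * 1) (1 + 1).
  rewrite -(sqsum_lin n.+1 (fun w => f w / w)); apply: sqsum_boundary_ext => x y /nz h.
  by rewrite pE //; ring.
have hf : nc (sqsum n.+1 (fun w => f w / w) (0 - 1 - I' * 1) (1 + 1)) <= 8 * M.
  apply: sqsum_boundary_bound => x y Hs; rewrite ncM ncV.
  have h := fM _ _ Hs; have := nc_ge0 (f (pt x y)).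
  have : 1 <= nc (pt x y).
    have := nc_ge_Re (pt x y); have := nc_ge_Im (pt x y) => /=.
    by have [_ _ []] := Hs => -> h1' h2'; move: h1' h2'; rewrite ?normrN ?normr1 //.
  move=> n1' fp; rewrite ler_pdivrMr; last exact: lt_le_trans ltr01 n1'.
  by apply: (le_trans h); apply: ler_peMr => //; exact: le_trans fp h.
have hk := sqsum_inv n.+1.
have := nc_ge_Im (sqsum n.+1 (@GRing.inv C) (0 - 1 - I' * 1) (1 + 1)).
rewrite ger0_norm; last by lra.
set k := sqsum _ (@GRing.inv C) _ _ in hk Ep *.
move=> hk'; move: Ep; set sp := sqsum _ p _ _ in hp *; set sf := sqsum _ _ _ _ in hf *.
move=> Ep; have : f 0 * k = sf - sp by rewrite Ep; ring.
move=> /(congr1 (@nc R)); rewrite ncM => En.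
have := ncB sf sp; rewrite -En.
have : nc (f 0) * 4 <= nc (f 0) * nc k by rewrite ler_wpM2l ?nc_ge0 //; lra.
by rewrite /e in hp; lra.
Qed.

End Center.

(** * The maximum principle on rectangles *)

Section MaxPrinciple.
Variable R : realType.
Local Notation C := R[i].
Local Notation I' := ('i%C : C).
Implicit Types (f g : C -> C) (z w a b c d u : C) (e M x y t : R).

Lemma mul_i_pt x y : I' * pt x y = pt (- y) x.
Proof. by apply/eqP; rewrite eq_complex /=; apply/andP; split; apply/eqP; ring. Qed.

Lemma oppr_pt x y : - pt x y = pt (- x) (- y). Proof. by []. Qed.

Lemma pt_scale x y t : pt x y * t%:C%C = pt (x * t) (y * t).
Proof. by apply/eqP; rewrite eq_complex /=; apply/andP; split; apply/eqP; ring. Qed.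

Lemma pt_scalel x y t : t%:C%C * pt x y = pt (x * t) (y * t).
Proof. by rewrite mulrC pt_scale. Qed.

Lemma ptD x y x' y' : pt x y + pt x' y' = pt (x + x') (y + y').
Proof. by []. Qed.

Lemma pt0 x : pt x 0 = x%:C%C. Proof. by []. Qed.

Lemma nc_pt_le x y M : `|x| <= M -> `|y| <= M -> nc (pt x y) <= 2 * M.
Proof. by move=> hx hy; apply: le_trans (nc_le_ReIm _) _; rewrite /=; lra. Qed.

(* The product of the four rotated copies of [f] is small on every side of the square. *)
Lemma one_side_bound0 f M0 M :
  (forall x y, -1 <= x <= 1 -> -1 <= y <= 1 -> cdiff f (pt x y) /\ nc (f (pt x y)) <= M0) ->
  (forall y, -1 <= y <= 1 -> nc (f (pt 1 y)) <= M) -> nc (f 0) ^+ 4 <= 2 * (M * M0 ^+ 3).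
Proof.
move=> df fM.
pose g z := f (0 + 1 * z) * f (0 + I' * z) * (f (0 + (-1) * z) * f (0 + (- I') * z)).
have gE x y : g (pt x y) =
    f (pt x y) * f (pt (- y) x) * (f (pt (- x) (- y)) * f (pt y (- x))).
  rewrite /g !add0r mul1r mulN1r mulNr mul_i_pt !oppr_pt opprK //.
have dg x y : -1 <= x <= 1 -> -1 <= y <= 1 -> cdiff g (pt x y).
  move=> hx hy; apply: cdiffM; apply: cdiffM; apply: cdiff_affine; rewrite add0r
    ?mul1r ?mulN1r ?mulNr ?mul_i_pt ?oppr_pt ?opprK.
  - by have [] := df x y hx hy.
  - by have [] := df (- y) x ltac:(lra) hx.
  - by have [] := df (- x) (- y) ltac:(lra) ltac:(lra).
  - by have [] := df y (- x) hy ltac:(lra).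
have prod3 (p q r s : R) : 0 <= p -> 0 <= q -> 0 <= r -> 0 <= s ->
    p <= M -> q <= M0 -> r <= M0 -> s <= M0 -> p * q * (r * s) <= M * M0 ^+ 3.
  move=> *; rewrite (_ : M * M0 ^+ 3 = M * M0 * (M0 * M0)); last by ring.
  by apply: ler_pM; rewrite ?mulr_ge0 //; apply: ler_pM.
have := @center_bound R g (M * M0 ^+ 3) dg.
have -> : nc (g 0) = nc (f 0) ^+ 4.
  by rewrite /g !mulr0 !addr0 !ncM; ring.
apply=> x y [hx hy]; rewrite gE !ncM.
have h1 := (df x y hx hy).2; have h2 := (df (- y) x ltac:(lra) hx).2.
have h3 := (df (- x) (- y) ltac:(lra) ltac:(lra)).2.
have h4 := (df y (- x) hy ltac:(lra)).2.
move: h1 h2 h3 h4 (nc_ge0 (f (pt x y))) (nc_ge0 (f (pt (- y) x))).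
move: (nc_ge0 (f (pt (- x) (- y)))) (nc_ge0 (f (pt y (- x)))).
move: (fM y hy) (fM x hx) (fM (- y) ltac:(lra)) (fM (- x) ltac:(lra)).
move=> f1 f2 f3 f4 + + + + + + + + E.
have {f1 f2 f3 f4} : [\/ nc (f (pt x y)) <= M, nc (f (pt (- y) x)) <= M,
    nc (f (pt (- x) (- y))) <= M | nc (f (pt y (- x))) <= M].
  by case: E => E; subst; rewrite ?opprK; [apply: Or41|apply: Or43|apply: Or44|apply: Or42].
move: (nc (f (pt x y))) (nc (f (pt (- y) x))) (nc (f (pt (- x) (- y)))).
move: (nc (f (pt y (- x)))) => s p q r H r0 s0 pM qM rM sM p0 q0.
case: H => H.
- exact: prod3.
- by rewrite [p * q]mulrC; apply: prod3.
- by rewrite mulrC; apply: prod3.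
- by rewrite mulrC [r * s]mulrC; apply: prod3.
Qed.

Lemma one_side_bound f c d M0 M :
  (forall x y, -1 <= x <= 1 -> -1 <= y <= 1 ->
     cdiff f (c + d * pt x y) /\ nc (f (c + d * pt x y)) <= M0) ->
  (forall y, -1 <= y <= 1 -> nc (f (c + d * pt 1 y)) <= M) ->
  nc (f c) ^+ 4 <= 2 * (M * M0 ^+ 3).
Proof.
move=> df fM; have := @one_side_bound0 (fun z => f (c + d * z)) M0 M.
rewrite mulr0 addr0; apply=> [x y hx hy|//].
by have [? ?] := df x y hx hy; split=> //; apply: cdiff_affine.
Qed.

(** The product of the four rotated copies vanishes on the whole boundary, so its value [f 0 ^ 4] at
    the center is zero. Polarization and all identity theorems below rest on this. *)
Lemma one_side_zero f :
  (forall x y, -1 <= x <= 1 -> -1 <= y <= 1 -> cdiff f (pt x y)) ->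
  (forall y, -1 <= y <= 1 -> f (pt 1 y) = 0) -> f 0 = 0.
Proof.
move=> df fM.
pose g z := f (0 + 1 * z) * f (0 + I' * z) * (f (0 + (-1) * z) * f (0 + (- I') * z)).
have gE x y : g (pt x y) =
    f (pt x y) * f (pt (- y) x) * (f (pt (- x) (- y)) * f (pt y (- x))).
  by rewrite /g !add0r mul1r mulN1r mulNr mul_i_pt !oppr_pt opprK.
have dg x y : -1 <= x <= 1 -> -1 <= y <= 1 -> cdiff g (pt x y).
  move=> hx hy; apply: cdiffM; apply: cdiffM; apply: cdiff_affine; rewrite add0r
    ?mul1r ?mulN1r ?mulNr ?mul_i_pt ?oppr_pt ?opprK; apply: df => //; lra.
have := @center_bound R g 0 dg; rewrite mulr0 => H.
have : nc (g 0) <= 0.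
  apply: H => x y [hx hy]; rewrite gE; case=> E; subst; rewrite ?opprK fM ?(mul0r, mulr0) ?nc0 //; lra.
rewrite le_eqVlt ltNge nc_ge0 orbF nc_eq0 /g !mulr0 !addr0 !mulf_eq0 !orbb.
by move/eqP.
Qed.

(** By Bernoulli's inequality a ratio above 1 has unbounded powers. The lemma removes multiplicative
    constants from estimates that hold for all [f ^ k]. *)
Lemma powers_le (a b K : R) : 0 <= a -> 0 <= b ->
  (forall k, a ^+ k <= K * b ^+ k) -> a <= b.
Proof.
move=> a0 b0 H; rewrite leNgt; apply/negP => ba.
have K0 : 0 < K by have := H 0%N; rewrite !expr0; lra.
case: (eqVneq b 0) => [bE|bn].
  by have := H 1%N; rewrite !expr1 bE mulr0; lra.
have b1 : 0 < b by rewrite lt_neqAle eq_sym bn.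
pose t := a / b - 1.
have t0 : 0 < t by rewrite subr_gt0 ltr_pdivlMr // mul1r.
have bern k : 1 + k%:R * t <= (1 + t) ^+ k.
  elim: k => [|k IH]; first by rewrite mul0r addr0.
  rewrite exprSr -[k.+1]addn1 natrD.
  have : (1 + k%:R * t) * (1 + t) <= (1 + t) ^+ k * (1 + t) by rewrite ler_wpM2r //; lra.
  have : 0 <= k%:R * t * t by rewrite !mulr_ge0 // ltW.
  rewrite (_ : (1 + k%:R * t) * (1 + t) = 1 + (k%:R + 1) * t + k%:R * t * t); last by ring.
  by move=> ?; apply: le_trans; rewrite lerDl.
have HK k : (1 + t) ^+ k <= K.
  by rewrite /t addrC subrK expr_div_n ler_pdivrMr ?exprn_gt0.
have := archi_boundP (ltW (divr_gt0 K0 t0)); set k := Num.bound _.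
rewrite ltr_pdivrMr // => hk; have := bern k; have := HK k; lra.
Qed.

(** [t] is the distance to the nearest side: the largest centered square has a whole side on the
    boundary of the box, and the last clause records which one. *)
Lemma box_radius x1 x2 y1 y2 x y : x1 < x < x2 -> y1 < y < y2 -> exists t, [/\
  forall v, -1 <= v <= 1 -> x1 <= x + v * t <= x2 /\ x1 <= x - v * t <= x2,
  forall v, -1 <= v <= 1 -> y1 <= y + v * t <= y2 /\ y1 <= y - v * t <= y2 &
  [\/ x + t = x2, x - t = x1, y + t = y2 | y - t = y1]].
Proof.
move=> hx hy.
have [t Et] : exists t, t = Num.min (Num.min (x2 - x) (x - x1)) (Num.min (y2 - y) (y - y1)).
  by eexists.
have t0 : 0 < t by rewrite Et !lt_min; apply/andP; split; apply/andP; split; lra.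
have [t1 t2 t3 t4] : [/\ t <= x2 - x, t <= x - x1, t <= y2 - y & t <= y - y1].
  by split; rewrite Et !ge_min lexx ?orbT.
have vt v : -1 <= v <= 1 -> - t <= v * t <= t by move=> ?; nra.
exists t; split=> //.
- by move=> v /vt ?; split; lra.
- by move=> v /vt ?; split; lra.
rewrite Et /Num.min; case: ifP => _; case: ifP => _.
- by apply: Or41; rewrite addrC subrK.
- by apply: Or42; rewrite subKr.
- by apply: Or43; rewrite addrC subrK.
- by apply: Or44; rewrite subKr.
Qed.

(** Let [M0] be the supremum over the box, finite by the a priori bound [B]. At an interior point
    the largest centered square has one side on the boundary, so [one_side_bound] gives
    [|f| ^ 4 <= 2 M M0 ^ 3]; passing to the supremum yields [M0 <= 2 M]. *)
Lemma box_bound2 f x1 x2 y1 y2 B M :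
  (forall x y, x1 <= x <= x2 -> y1 <= y <= y2 ->
     cdiff f (pt x y) /\ nc (f (pt x y)) <= B) ->
  (forall x y, x1 <= x <= x2 -> y1 <= y <= y2 ->
     [\/ x = x1, x = x2, y = y1 | y = y2] -> nc (f (pt x y)) <= M) ->
  forall x y, x1 <= x <= x2 -> y1 <= y <= y2 -> nc (f (pt x y)) <= 2 * M.
Proof.
move=> df fM xa ya hxa hya.
have [M0 [leM0 M0le]] : exists M0, (forall x y, x1 <= x <= x2 -> y1 <= y <= y2 ->
    nc (f (pt x y)) <= M0) /\
    (forall b : R, (forall x y, x1 <= x <= x2 -> y1 <= y <= y2 -> nc (f (pt x y)) <= b) -> M0 <= b).
  pose E := [set v | exists x y, [/\ x1 <= x <= x2, y1 <= y <= y2 & v = nc (f (pt x y))]]%classic.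
  exists (sup E); split=> [x y hx hy|b hb].
    apply: ub_le_sup; last by exists x, y.
    by exists B => _ [u [v [hu hv ->]]]; exact: (df u v hu hv).2.
  by apply: ge_sup => [|_ [x [y [hx hy ->]]]]; [exists (nc (f (pt xa ya))), xa, ya|exact: hb].
have M00 : 0 <= M0 by apply: le_trans (leM0 _ _ hxa hya); exact: nc_ge0.
have Mge0 : 0 <= M.
  by apply: le_trans (fM x1 ya _ hya _); [exact: nc_ge0|lra|apply: Or41].
suff : M0 <= 2 * M by move: (leM0 _ _ hxa hya); lra.
have [q [q0 q4]] : exists q, 0 <= q /\ q ^+ 4 = 2 * (M * M0 ^+ 3).
  exists (Num.sqrt (Num.sqrt (2 * (M * M0 ^+ 3)))); split; first exact: sqrtr_ge0.
  rewrite (exprM _ 2 2) !sqr_sqrtr ?sqrtr_ge0 //.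
  by rewrite !mulr_ge0 // exprn_ge0.
have : M0 <= Num.max M q.
  apply: M0le => x y hx hy.
  rewrite le_max.
  case: (pselect [\/ x = x1, x = x2, y = y1 | y = y2]) => [bd|nbd].
    by rewrite (fM x y hx hy bd).
  apply/orP; right.
  have hx' : x1 < x < x2.
    rewrite !lt_neqAle; have /andP[-> ->] := hx; rewrite !andbT.
    by apply/andP; split; apply/eqP => EE; apply: nbd; subst; [apply: Or41|apply: Or42].
  have hy' : y1 < y < y2.
    rewrite !lt_neqAle; have /andP[-> ->] := hy; rewrite !andbT.
    by apply/andP; split; apply/eqP => EE; apply: nbd; subst; [apply: Or43|apply: Or44].
  suff : nc (f (pt x y)) ^+ 4 <= q ^+ 4 by rewrite ler_pXn2r ?nnegrE ?nc_ge0.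
  rewrite q4.
  have [t [vx vy tE]] := box_radius hx' hy'.
  have step (s : C) : s = t%:C%C \/ s = - t%:C%C \/ s = I' * t%:C%C \/ s = - (I' * t%:C%C) ->
      (forall v, -1 <= v <= 1 -> nc (f (pt x y + s * pt 1 v)) <= M) ->
      nc (f (pt x y)) ^+ 4 <= 2 * (M * M0 ^+ 3).
    move=> Hs hs; apply: (@one_side_bound f (pt x y) s) => // u v hu hv.
    have [ux ux'] := vx u hu; have [vvx vx'] := vx v hv.
    have [uy uy'] := vy u hu; have [vvy vy'] := vy v hv.
    have [x' [y' [hx1 hy1 ->]]] : exists x' y', [/\ x1 <= x' <= x2, y1 <= y' <= y2 &
        pt x y + s * pt u v = pt x' y'].
      case: Hs => [->|[->|[->|->]]].
      - by exists (x + u * t), (y + v * t); rewrite pt_scalel ptD.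
      - by exists (x - u * t), (y - v * t); rewrite mulNr pt_scalel oppr_pt ptD.
      - by exists (x - v * t), (y + u * t); rewrite -mulrA pt_scalel mul_i_pt ptD.
      - exists (x + v * t), (y - u * t).
        by rewrite mulNr -mulrA pt_scalel mul_i_pt oppr_pt ptD opprK.
    by split; [exact: (df _ _ hx1 hy1).1|exact: leM0].
  have n1 : -1 <= (1 : R) <= 1 by lra.
  have [b1 b2] := vx _ n1; have [b3 b4] := vy _ n1; rewrite mul1r in b1 b2 b3 b4.
  case: tE => tE.
  - apply: (step t%:C%C) => // [|v /vy[hv _]]; first by left.
    by rewrite pt_scalel ptD mul1r; apply: fM => //; exact: Or42.
  - apply: (step (- t%:C%C)) => // [|v /vy[_ hv]]; first by right; left.
    by rewrite mulNr pt_scalel oppr_pt ptD mul1r; apply: fM => //; exact: Or41.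
  - apply: (step (I' * t%:C%C)) => // [|v /vx[_ hv]]; first by right; right; left.
    by rewrite -mulrA pt_scalel mul_i_pt ptD mul1r; apply: fM => //; exact: Or44.
  - apply: (step (- (I' * t%:C%C))) => // [|v /vx[hv _]]; first by right; right; right.
    rewrite mulNr -mulrA pt_scalel mul_i_pt oppr_pt ptD mul1r opprK; apply: fM => //.
    exact: Or43.
rewrite le_max => /orP[|M0q]; first by lra.
rewrite leNgt; apply/negP => lt.
have M0p : 0 < M0 by lra.
have : M0 ^+ 4 <= q ^+ 4 by rewrite ler_pXn2r ?nnegrE.
rewrite q4 (_ : M0 ^+ 4 = M0 * M0 ^+ 3); last by ring.
by rewrite mulrA ler_pM2r ?exprn_gt0 //; lra.
Qed.

(** Applied to [f ^ k], the preceding bound reads [|f| ^ k <= 2 M ^ k], and the factor 2 disappears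
    as [k] grows. *)
Lemma max_principle f x1 x2 y1 y2 B M :
  (forall x y, x1 <= x <= x2 -> y1 <= y <= y2 ->
     cdiff f (pt x y) /\ nc (f (pt x y)) <= B) ->
  (forall x y, x1 <= x <= x2 -> y1 <= y <= y2 ->
     [\/ x = x1, x = x2, y = y1 | y = y2] -> nc (f (pt x y)) <= M) ->
  forall x y, x1 <= x <= x2 -> y1 <= y <= y2 -> nc (f (pt x y)) <= M.
Proof.
move=> df fM x y hx hy.
have M0 : 0 <= M by apply: le_trans (fM x1 y _ hy _); [exact: nc_ge0|lra|apply: Or41].
apply: (@powers_le _ _ 2) => // [|k]; first exact: nc_ge0.
rewrite -ncX; apply: (@box_bound2 (fun z => f z ^+ k) x1 x2 y1 y2 (B ^+ k)) => //.
  move=> x' y' hx' hy'; have [h1 h2] := df x' y' hx' hy'.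
  by split; [exact: cdiffX|rewrite ncX lerXn2r ?nnegrE ?nc_ge0 // (le_trans (nc_ge0 _) h2)].
move=> x' y' hx' hy' bd; rewrite ncX lerXn2r ?nnegrE ?nc_ge0 //.
exact: fM.
Qed.

End MaxPrinciple.

(** * The lemmas of Hopf and Schwarz *)

Section HopfSchwarz.
Variable R : realType.
Local Notation C := R[i].
Local Notation I' := ('i%C : C).
Implicit Types (f g : C -> C) (z w a b c u : C) (d e M x y t : R).

(** Compactness of the unit interval by bisection; the second coordinate of [square_bisection] is a
    dummy. *)
Lemma locally_bounded_below (h : R -> R) :
  (forall t, 0 <= t <= 1 -> exists2 c, 0 < c &
     exists2 d, 0 < d & forall t', `|t' - t| < d -> c <= h t') ->
  exists2 m, 0 < m & forall t, 0 <= t <= 1 -> m <= h t.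
Proof.
move=> H; apply: contrapT => nm.
pose bad x (y : R) k := ~ exists2 m, 0 < m & forall t, x <= t <= x + 2^-1 ^+ k -> m <= h t.
have b0 : bad 0 0 0%N by rewrite /bad expr0 add0r.
have step x y k : bad x y k -> exists x' y',
     [/\ x' = x \/ x' = x + 2^-1 ^+ k.+1, y' = y \/ y' = y + 2^-1 ^+ k.+1
       & bad x' y' k.+1].
  move=> bk; apply: contrapT => nb; apply: bk.
  have hS : (2^-1 : R) ^+ k = 2^-1 ^+ k.+1 + 2^-1 ^+ k.+1 by rewrite exprS; field.
  have S x' : x' = x \/ x' = x + 2^-1 ^+ k.+1 ->
     exists2 m, 0 < m & forall t, x' <= t <= x' + 2^-1 ^+ k.+1 -> m <= h t.
    by move=> Hx; apply: contrapT => nS; apply: nb; exists x', y; split=> //; left.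
  have [m1 m10 h1] := S x ltac:(by left).
  have [m2 m20 h2] := S (x + 2^-1 ^+ k.+1) ltac:(by right).
  exists (Num.min m1 m2); first by rewrite lt_min m10.
  move=> t ht; rewrite ge_min; case: (lerP t (x + 2^-1 ^+ k.+1)) => tl.
    by rewrite h1 //; move: ht tl; move: (2^-1 ^+ k.+1) => u; lra.
  rewrite [X in _ || X]h2 ?orbT //; move: ht tl; rewrite hS; move: (2^-1 ^+ k.+1) => u; lra.
have [x0 [y0 Hb]] := square_bisection step b0.
have x01 : 0 <= x0 <= 1 by have [x [y []]] := Hb 0%N; rewrite expr0 => ? ? ? ? [_ ? ?]; lra.
have [c c0 [d d0 Hc]] := H _ x01.
have [k hk] := expr_half_lt d0.
have [x [y [_ _ _ _ [bk Hx _]]]] := Hb k.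
apply: bk; exists c => // t ht; apply: Hc; rewrite ltr_norml.
by move: ht Hx hk; move: (2^-1 ^+ k) => u; lra.
Qed.

(* The barrier is [Re (z + z^3 / d^2) = x (1 + (x^2 - 3 y^2) / d^2)], which is nonpositive on
   the sides [y = d] and [y = -d] of the box [0, d] x [-d, d]. *)
Lemma hopf f r : 0 < r -> (forall z, nc z < r -> cdiff f z) ->
  (forall z, nc z < r -> 0 < complex.Re z -> 0 < complex.Re (f z)) ->
  exists e d, [/\ 0 < e, 0 < d & forall x, 0 < x < d -> e * x <= complex.Re (f x%:C%C)].
Proof.
move=> r0 df fpos.
have [r1 r10 bf] : exists2 r1, 0 < r1 & forall w, nc w < r1 -> nc (f w) < nc (f 0) + 1.
  have [|d d0 H] := @ccont_bounded R f 0; first by apply/cdiff_ccont/df; rewrite nc0.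
  by exists d => // w hw; apply: H; rewrite subr0.
set B := nc (f 0) + 1 in bf; have B0 : 0 < B by have := nc_ge0 (f 0); rewrite /B; lra.
pose d := Num.min r r1 / 3.
have d0 : 0 < d by rewrite divr_gt0 // lt_min r0.
have [dr dr1] : 2 * d < r /\ 2 * d < r1.
  have : d <= r / 3 /\ d <= r1 / 3.
    by rewrite /d; split; rewrite ler_pM2r ?invr_gt0 // ge_min lexx ?orbT.
  by lra.
have inr x y : 0 <= x <= d -> - d <= y <= d -> nc (pt x y) < r /\ nc (pt x y) < r1.
  move=> hx hy; have := @nc_pt_le R x y d ltac:(rewrite ler_norml; lra) ltac:(rewrite ler_norml; lra).
  lra.
have fge0 y : - d <= y <= d -> 0 <= complex.Re (f (pt 0 y)).
  move=> hy; rewrite leNgt; apply/negP => lt.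
  have [h1 _] := inr 0 y ltac:(lra) hy.
  have cz := cdiff_ccont (df _ h1).
  have [e e0 He] := cz (- complex.Re (f (pt 0 y))) ltac:(lra).
  pose t := Num.min (e / 2) (d / 2).
  have [t0 te td] : [/\ 0 < t, t <= e / 2 & t <= d / 2].
    by rewrite /t; split; rewrite ?lt_min ?ge_min ?lexx ?orbT //; apply/andP; split; lra.
  have := He (pt t y); rewrite oppr_pt ptD subr0 subrr nc_real gtr0_norm //.
  move=> /(_ ltac:(lra)) h.
  have [h2 _] := inr t y ltac:(lra) hy.
  have h3 := fpos _ h2 t0.
  have := nc_ge_Re (f (pt t y) - f (pt 0 y)); rewrite raddfB /= ler_norml; lra.
have [m m0 Hm] : exists2 m, 0 < m & forall y, - d <= y <= d -> m <= complex.Re (f (pt d y)).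
  have [t ht|m m0 Hm] := @locally_bounded_below (fun t => complex.Re (f (pt d (2 * d * t - d)))).
    have hy : - d <= 2 * d * t - d <= d by nra.
    have [h1 _] := inr d _ ltac:(lra) hy.
    have p0 := fpos _ h1 d0.
    set v := complex.Re _ in p0.
    exists (v / 2); first by lra.
    have cz := cdiff_ccont (df _ h1).
    have [e e0 He] := cz (v / 2) ltac:(lra).
    exists (e / (2 * d)); first by rewrite divr_gt0 //; lra.
    move=> t'; rewrite ltr_pdivlMr; last by lra.
    move=> ht'; have := He (pt d (2 * d * t' - d)).
    rewrite oppr_pt ptD subrr.
    have -> : pt 0 (2 * d * t' - d - (2 * d * t - d)) = I' * ((t' - t) * (2 * d))%:C%C.
      by apply/eqP; rewrite eq_complex /=; apply/andP; split; apply/eqP; ring.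
    rewrite ncM nc_i mul1r nc_real normrM [`|2 * d|]ger0_norm; last by lra.
    move=> /(_ ht') h.
    have := nc_ge_Re (f (pt d (2 * d * t' - d)) - f (pt d (2 * d * t - d))).
    by rewrite raddfB /= -/v ler_norml; lra.
  exists m => // y hy; have := Hm ((y + d) / (2 * d)).
  have -> : 2 * d * ((y + d) / (2 * d)) - d = y by field; rewrite ?gt_eqF //; lra.
  by apply; rewrite divr_ge0 ?ler_pdivrMr; lra.
(* On the side [x = d] the barrier is at most [2 * d], so with [e * (2 * d) = m] the real part of
   [f] dominates [e] times the barrier there. *)
have [e Ee] : exists e, e = m / (2 * d) by eexists.
have e0 : 0 < e by rewrite Ee divr_gt0 //; lra.
have ed : e * (2 * d) = m by rewrite Ee divfK // gt_eqF //; lra.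
have dn0 : d%:C%C != 0 :> C by rewrite eq_complex /= gt_eqF.
pose ph z := f z - e%:C%C * (z + z ^+ 3 / d%:C%C ^+ 2).
have ReP x y : complex.Re (ph (pt x y)) =
    complex.Re (f (pt x y)) - e * (x * (1 + (x ^+ 2 - 3 * y ^+ 2) / d ^+ 2)).
  rewrite /ph raddfB; congr (_ - _).
  have -> : d%:C%C ^- 2 = (d ^- 2)%:C%C :> C by rewrite fmorphV rmorphXn.
  by rewrite !exprS expr0 /=; ring.
have dph z : nc z < r -> cdiff ph z.
  move=> /df dz; apply: cdiffB => //; apply: cdiffM; first exact: cdiff_cst.
  apply: cdiffD; first exact: cdiff_id.
  by apply: cdiffM; [apply: cdiffX; exact: cdiff_id|exact: cdiff_cst].
have [B2 EB2] : exists B2, B2 = B + e * (2 * d + 8 * d) by eexists.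
have bph z : nc z <= 2 * d -> nc z < r1 -> nc (ph z) <= B2.
  move=> hz hz1; rewrite EB2; apply: le_trans (ncB _ _) _; apply: lerD; first exact/ltW/bf.
  rewrite ncM nc_real gtr0_norm // ler_wpM2l ?(ltW e0) //.
  apply: le_trans (ncD _ _) _; apply: lerD => //.
  rewrite ncM ncV !ncX nc_real gtr0_norm // ler_pdivrMr ?exprn_gt0 //.
  apply: le_trans (_ : (2 * d) ^+ 3 <= _); last by rewrite le_eqVlt; apply/orP; left; apply/eqP; ring.
  by rewrite lerXn2r ?nnegrE ?nc_ge0 //; lra.
have phge0 x y : 0 <= x <= d -> - d <= y <= d -> [\/ x = 0, x = d, y = - d | y = d] ->
    0 <= complex.Re (ph (pt x y)).
  move=> hx hy; rewrite ReP.
  have d2 : 0 < d ^+ 2 by rewrite exprn_gt0.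
  have side : y ^+ 2 = d ^+ 2 -> 0 <= complex.Re (f (pt x y)) ->
      0 <= complex.Re (f (pt x y)) - e * (x * (1 + (x ^+ 2 - 3 * y ^+ 2) / d ^+ 2)).
    move=> -> h; rewrite subr_ge0; apply: le_trans h.
    rewrite pmulr_rle0 //; apply: mulr_ge0_le0; first by lra.
    have : (x ^+ 2 - 3 * d ^+ 2) / d ^+ 2 <= -2; last by lra.
    by rewrite ler_pdivrMr //; nra.
  have fg : 0 <= complex.Re (f (pt x y)).
    case: (eqVneq x 0) => [->|x0]; first exact: fge0.
    have [h1 _] := inr x y hx hy; apply/ltW/fpos => //=.
    by rewrite lt_neqAle eq_sym x0; lra.
  case=> E.
  - by move: fg; rewrite E mul0r mulr0 subr0.
  - rewrite subr_ge0 E; apply: le_trans (Hm y hy); rewrite -ed.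
    rewrite ler_wpM2l ?(ltW e0) // mulrC ler_wpM2r ?(ltW d0) //.
    have : (d ^+ 2 - 3 * y ^+ 2) / d ^+ 2 <= 1; last by lra.
    by rewrite ler_pdivrMr //; nra.
  - by apply: side => //; rewrite E sqrrN.
  - by apply: side => //; rewrite E.
exists e, d; split=> // x hx.
suff : 0 <= complex.Re (ph (pt x 0)).
  rewrite ReP expr0n mulr0 subr0 pt0 subr_ge0; apply: le_trans.
  have : 0 <= x ^+ 2 / d ^+ 2 by rewrite divr_ge0 ?exprn_ge0 //; lra.
  move: (x ^+ 2 / d ^+ 2) => u u0; rewrite ler_wpM2l ?(ltW e0) //; nra.
have B20 : 0 < B2 by rewrite EB2; nra.
clear EB2 Ee.
rewrite leNgt; apply/negP => lt; set v := complex.Re _ in lt.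
(* A bound on a real part is turned into one on a modulus. On the boundary [Re ph >= 0] and
   [|ph| <= B2] give [|N - ph| ^ 2 <= N ^ 2 + B2 ^ 2], whereas a real part [v < 0] inside would give
   at least [N ^ 2 + 2 B2 ^ 2]. *)
have [N EN] : exists N, N = B2 ^+ 2 / - v by eexists.
have N0 : 0 < N by rewrite EN divr_gt0 ?exprn_gt0 // oppr_gt0.
have nE z : nc (N%:C%C - z) ^+ 2 = N ^+ 2 - 2 * N * complex.Re z + nc z ^+ 2.
  by rewrite !nc_sqr !raddfB /=; ring.
have := @max_principle R (fun z => N%:C%C - ph z) 0 d (- d) d (N + B2)
  (Num.sqrt (N ^+ 2 + B2 ^+ 2)).
have bB2 x' y' : 0 <= x' <= d -> - d <= y' <= d -> nc (ph (pt x' y')) <= B2.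
  move=> hx' hy'; apply: bph; last exact: (inr _ _ hx' hy').2.
  by apply: nc_pt_le; rewrite ler_norml; lra.
have inner x' y' : 0 <= x' <= d -> - d <= y' <= d ->
    cdiff (fun z => N%:C%C - ph z) (pt x' y') /\ nc (N%:C%C - ph (pt x' y')) <= N + B2.
  move=> hx' hy'; split.
    by apply: cdiffB; [exact: cdiff_cst|apply: dph; exact: (inr _ _ hx' hy').1].
  by apply: le_trans (ncB _ _) _; rewrite nc_real gtr0_norm // lerD2l; exact: bB2.
have S0 : 0 <= N ^+ 2 + B2 ^+ 2 by rewrite addr_ge0 ?exprn_ge0 // ltW.
move=> /(_ inner) H; have {}H := H _ x 0 ltac:(lra) ltac:(lra).
have : nc (N%:C%C - ph (pt x 0)) <= Num.sqrt (N ^+ 2 + B2 ^+ 2).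
  apply: H => x' y' hx' hy' bd.
  rewrite -[X in X <= _]ger0_norm ?nc_ge0 // -sqrtr_sqr ler_sqrt // nE.
  have h1 := phge0 _ _ hx' hy' bd; have h2 := bB2 _ _ hx' hy'.
  have : nc (ph (pt x' y')) ^+ 2 <= B2 ^+ 2 by rewrite lerXn2r ?nnegrE ?nc_ge0 // ltW.
  have : 0 <= N * complex.Re (ph (pt x' y')) by rewrite mulr_ge0 // ltW.
  by lra.
rewrite -[X in X <= _]ger0_norm ?nc_ge0 // -sqrtr_sqr ler_sqrt // nE -/v.
have -> : 2 * N * v = - 2 * B2 ^+ 2 by rewrite EN; field; rewrite lt_eqF.
have := exprn_ge0 2 (nc_ge0 (ph (pt x 0))); have := exprn_gt0 2 B20; lra.
Qed.

Lemma slope_cdiff f (p : C -> C) : (forall w, f w = f 0 + p w * w) ->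
  forall z, z != 0 -> cdiff f z -> cdiff p z.
Proof.
move=> E z z0 dz; apply: (@cdiff_local R (fun w => (f w - f 0) / w) _ _ (nc z)).
- by rewrite nc_gt0.
- move=> w hw; have w0 : w != 0.
    by apply/eqP => w0; move: hw; rewrite w0 sub0r ncN ltxx.
  by rewrite [f w]E addrC addKr mulfK.
apply: cdiffM; last by apply: cdiffV => //; exact: cdiff_id.
by apply: cdiffB => //; exact: cdiff_cst.
Qed.

(* Riemann's removable singularity theorem is avoided by applying the maximum principle to
   [z * p z ^+ k], which is differentiable at [0] with derivative [p 0 ^+ k]. *)
Lemma schwarz f M :
  (forall x y, -1 <= x <= 1 -> -1 <= y <= 1 -> cdiff f (pt x y) /\ nc (f (pt x y)) <= M) ->
  f 0 = 0 ->
  forall x y, -1 <= x <= 1 -> -1 <= y <= 1 -> nc (f (pt x y)) <= M * nc (pt x y).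
Proof.
move=> df f0 x y hx hy.
have [p cp E] : cdiff f 0 by have [] := df 0 0 ltac:(lra) ltac:(lra).
have {}E w : f w = f 0 + p w * w by rewrite E subr0.
have M0 : 0 <= M by apply: le_trans (df x y hx hy).2; exact: nc_ge0.
case: (eqVneq (pt x y) 0) => [->|z0]; first by rewrite f0 nc0 mulr0.
have z0' : 0 < nc (pt x y) by rewrite nc_gt0.
rewrite E f0 add0r ncM ler_wpM2r ?nc_ge0 //.
have [r r0 br] := ccont_bounded cp.
pose B := Num.max (nc (p 0) + 1) (M / r).
have B0 : 0 <= B by rewrite le_max; have := nc_ge0 (p 0) => ?; apply/orP; left; lra.
have pB x' y' : -1 <= x' <= 1 -> -1 <= y' <= 1 -> nc (p (pt x' y')) <= B.
  move=> hx' hy'; rewrite le_max; case: (ltrP (nc (pt x' y')) r) => hr.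
    by rewrite ltW // br // subr0.
  apply/orP; right; rewrite ler_pdivlMr //.
  have := (df _ _ hx' hy').2; rewrite E f0 add0r ncM; apply: le_trans.
  by rewrite ler_wpM2l ?nc_ge0.
(* On the sides the modulus of [z] lies between 1 and 2, so [|p| <= M] and [|z p ^ k| <= 2 M ^ k].
   The constant [2 / |z|] at the given point does not depend on [k]. *)
apply: (@powers_le _ _ _ (2 / nc (pt x y))) => // [|k]; first exact: nc_ge0.
rewrite mulrAC ler_pdivlMr // mulrC -ncX -ncM.
have := @max_principle R (fun z => z * p z ^+ k) (-1) 1 (-1) 1 (2 * B ^+ k) (2 * M ^+ k).
apply=> //.
  move=> x' y' hx' hy'; split; last first.
    rewrite ncM ncX; apply: ler_pM; rewrite ?exprn_ge0 ?nc_ge0 //.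
      by have := @nc_pt_le R x' y' 1; rewrite mulr1; apply; rewrite ler_norml; lra.
    by rewrite lerXn2r ?nnegrE ?nc_ge0 // pB.
  case: (eqVneq (pt x' y') 0) => [->|nz].
    exists (fun z => p z ^+ k); first exact: ccontX.
    by move=> w; rewrite subr0 mul0r add0r mulrC.
  apply: cdiffM; first exact: cdiff_id.
  by apply: cdiffX; apply: slope_cdiff nz _ => //; exact: (df _ _ hx' hy').1.
move=> x' y' hx' hy' bd; rewrite ncM ncX; apply: ler_pM; rewrite ?exprn_ge0 ?nc_ge0 //.
  by have := @nc_pt_le R x' y' 1; rewrite mulr1; apply; rewrite ler_norml; lra.
rewrite lerXn2r ?nnegrE ?nc_ge0 //.
have n1 : 1 <= nc (pt x' y').
  have := nc_ge_Re (pt x' y'); have := nc_ge_Im (pt x' y') => /=.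
  by case: bd => -> h1' h2'; move: h1' h2'; rewrite ?normrN ?normr1.
have := (df _ _ hx' hy').2; rewrite E f0 add0r ncM; apply: le_trans.
by rewrite ler_peMr ?nc_ge0.
Qed.

End HopfSchwarz.

(** * Several complex variables *)

Section RowNorm.
Variable R : realType.
Local Notation C := R[i].
Implicit Types (n : nat).

(** The l1 norm, with real values. The matrix norm of the library takes values in [R[i]]; the two
    are compared only when the topology of the statement is unfolded. *)
Definition nr n (x : 'rV[C]_n) : R := \sum_j nc (x 0 j).

Lemma nr_ge0 n (x : 'rV[C]_n) : 0 <= nr x.
Proof. by apply: sumr_ge0 => j _; exact: nc_ge0. Qed.

Lemma nr0 n : nr (0 : 'rV[C]_n) = 0.
Proof. by rewrite /nr big1 // => j _; rewrite mxE nc0. Qed.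

Lemma nrD n (x y : 'rV[C]_n) : nr (x + y) <= nr x + nr y.
Proof.
by rewrite /nr -big_split /=; apply: ler_sum => j _; rewrite mxE; exact: ncD.
Qed.

Lemma nrZ n (a : C) (x : 'rV[C]_n) : nr (a *: x) = nc a * nr x.
Proof. by rewrite /nr mulr_sumr; apply: eq_bigr => j _; rewrite mxE ncM. Qed.

Lemma nrN n (x : 'rV[C]_n) : nr (- x) = nr x.
Proof. by rewrite -scaleN1r nrZ ncN nc1 mul1r. Qed.

Lemma nrB n (x y : 'rV[C]_n) : nr (x - y) <= nr x + nr y.
Proof. by rewrite -(nrN y) nrD. Qed.

Lemma nr_distC n (x y : 'rV[C]_n) : nr (x - y) = nr (y - x).
Proof. by rewrite -nrN opprB. Qed.

Lemma nr_coord n (x : 'rV[C]_n) j : nc (x 0 j) <= nr x.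
Proof.
rewrite /nr (bigD1 j) //= lerDl; apply: sumr_ge0 => i _; exact: nc_ge0.
Qed.

Lemma nr_eq0 n (x : 'rV[C]_n) : nr x = 0 -> x = 0.
Proof.
move=> x0; apply/rowP => j; rewrite mxE; apply/eqP; rewrite -nc_eq0 eq_le nc_ge0 andbT.
by rewrite -x0 nr_coord.
Qed.

Lemma nr_le_coord n (x : 'rV[C]_n) (M : R) : (forall j, nc (x 0 j) <= M) -> nr x <= n%:R * M.
Proof.
move=> H; apply: le_trans (_ : \sum_(j < n) M <= _); first exact: ler_sum.
by rewrite sumr_const card_ord mulr_natl.
Qed.

Lemma nr_triangle n (a b c : 'rV[C]_n) : nr (a - c) <= nr (a - b) + nr (b - c).
Proof. by have := nrD (a - b) (b - c); rewrite addrA subrK. Qed.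

Lemma ball_shift n (x v c : 'rV[C]_n) (a b e : R) :
  nr (x - c) < a -> nr v <= b -> a + b <= e -> nr (x + v - c) < e.
Proof. by move=> h1 h2 h3; rewrite addrAC; apply: le_lt_trans (nrD _ _) _; lra. Qed.

Lemma ball_dist n (x y c : 'rV[C]_n) (a b e : R) :
  nr (x - c) < a -> nr (y - c) < b -> a + b <= e -> nr (x - y) < e.
Proof.
move=> h1 h2 h3; apply: le_lt_trans (nr_triangle x c y) _.
by rewrite (nr_distC c); lra.
Qed.

Definition vcont n m (f : 'rV[C]_n -> 'rV[C]_m) p := forall e, 0 < e ->
  exists2 d, 0 < d & forall x, nr (x - p) < d -> nr (f x - f p) < e.

Definition gder n m (G : 'rV[C]_n -> 'rV[C]_m) x (A : 'M[C]_(n, m)) :=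
  forall e, 0 < e -> exists2 d, 0 < d &
    forall h, nr h < d -> nr (G (x + h) - G x - h *m A) <= e * nr h.

Lemma mulmx_bounded n m (A : 'M[C]_(n, m)) :
  exists2 K, 0 < K & forall h : 'rV_n, nr (h *m A) <= K * nr h.
Proof.
pose K := \sum_i nr (row i A).
have K0 : 0 <= K by apply: sumr_ge0 => i _; exact: nr_ge0.
exists (K + 1); first by lra.
move=> h; apply: le_trans (_ : K * nr h <= _); last first.
  by rewrite ler_wpM2r ?nr_ge0 //; lra.
rewrite mulmx_sum_row.
have big_nr (F : 'I_n -> 'rV[C]_m) : nr (\sum_i F i) <= \sum_i nr (F i).
  elim/big_ind2: _ => [|x1 y1 x2 y2 h1 h2|//]; first by rewrite nr0.
  by apply: le_trans (nrD _ _) _; apply: lerD.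
apply: le_trans (big_nr _) _; rewrite /K mulr_suml; apply: ler_sum => i _.
by rewrite nrZ mulrC ler_wpM2l ?nr_ge0 // nr_coord.
Qed.

Lemma gder_vcont n m (G : 'rV[C]_n -> 'rV[C]_m) x A : gder G x A -> vcont G x.
Proof.
move=> dG e e0; have [K K0 HK] := mulmx_bounded A.
have [d d0 Hd] := dG 1 ltr01.
exists (Num.min d (e / (K + 1))).
  by rewrite lt_min d0 divr_gt0 //; lra.
move=> y; rewrite lt_min ltr_pdivlMr; last by lra.
move=> /andP[/Hd h1 h2]; move: h1; rewrite (_ : x + (y - x) = y) ?mul1r => [h1|]; last by rewrite addrC subrK.
have -> : G y - G x = (G y - G x - (y - x) *m A) + (y - x) *m A by rewrite subrK.
by apply: le_lt_trans (nrD _ _) _; have := HK (y - x); lra.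
Qed.

(** Differentiability at [x] along every complex line through [x]. All arguments restrict to lines,
    and this notion passes to sums and products without estimates in several variables. *)
Definition lholo n (f : 'rV[C]_n -> C) x := forall v, cdiff (fun s : C => f (x + s *: v)) 0.

Lemma lholo_ext n (f g : 'rV[C]_n -> C) x : f =1 g -> lholo f x -> lholo g x.
Proof. by move=> fg df v; apply: cdiff_ext (df v) => s; exact: fg. Qed.

Lemma lholo_line n (f : 'rV[C]_n -> C) x v s0 : lholo f (x + s0 *: v) ->
  cdiff (fun s => f (x + s *: v)) s0.
Proof.
move=> /(_ v) dv; have := @cdiff_affine R (fun s : C => f (x + s0 *: v + s *: v)) (- s0) 1 s0.
rewrite mul1r addNr => /(_ dv); apply: cdiff_ext => s.
by rewrite -addrA -scalerDl; congr (f (x + _ *: v)); ring.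
Qed.

Lemma lholo_cst n (c : C) (x : 'rV[C]_n) : lholo (fun=> c) x.
Proof. by move=> v; exact: cdiff_cst. Qed.

Lemma lholoD n (f g : 'rV[C]_n -> C) x : lholo f x -> lholo g x ->
  lholo (fun y => f y + g y) x.
Proof. by move=> df dg v; apply: cdiffD; [exact: df|exact: dg]. Qed.

Lemma lholoB n (f g : 'rV[C]_n -> C) x : lholo f x -> lholo g x ->
  lholo (fun y => f y - g y) x.
Proof. by move=> df dg v; apply: cdiffB; [exact: df|exact: dg]. Qed.

Lemma lholoM n (f g : 'rV[C]_n -> C) x : lholo f x -> lholo g x ->
  lholo (fun y => f y * g y) x.
Proof. by move=> df dg v; apply: cdiffM; [exact: df|exact: dg]. Qed.

Lemma lholo_affine n (f : 'rV[C]_n -> C) p (t : C) x : lholo f (p + t *: x) ->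
  lholo (fun y => f (p + t *: y)) x.
Proof.
move=> df v; have := df (t *: v); apply: cdiff_ext => s.
by rewrite -addrA scalerDr !scalerA [s * t]mulrC.
Qed.

Lemma cdiff_sum (I : finType) (f : I -> C -> C) (z : C) :
  (forall i, cdiff (f i) z) -> cdiff (fun w => \sum_i f i w) z.
Proof.
move=> df; suff : cdiff (fun w => \sum_(i <- enum I) f i w) z.
  by apply: cdiff_ext => w; rewrite big_enum.
elim: (enum I) => [|i l IH].
  by apply: (@cdiff_ext R (fun=> 0)) (cdiff_cst _ _) => w; rewrite big_nil.
by apply: (@cdiff_ext R (fun w => f i w + \sum_(j <- l) f j w)) (cdiffD (df i) IH) => w;
   rewrite big_cons.
Qed.

Lemma lholo_sum n (I : finType) (f : I -> 'rV[C]_n -> C) (x : 'rV[C]_n) :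
  (forall i, lholo (f i) x) -> lholo (fun y => \sum_i f i y) x.
Proof.
move=> df; suff : lholo (fun y => \sum_(i <- enum I) f i y) x.
  by apply: lholo_ext => y; rewrite big_enum.
elim: (enum I) => [|i l IH].
  by apply: (@lholo_ext _ (fun=> 0)) (lholo_cst _ _) => y; rewrite big_nil.
by apply: (@lholo_ext _ (fun y => f i y + \sum_(j <- l) f j y)) (lholoD (df i) IH) => y;
   rewrite big_cons.
Qed.

Lemma lholo_linear n (f : 'rV[C]_n -> C) x :
  (forall a u v, f (a *: u + v) = a * f u + f v) -> lholo f x.
Proof.
move=> lf v; exists (fun=> f v) => [|s]; first exact: ccont_cst.
rewrite !subr0 scale0r addr0 [x + _]addrC lf; ring.
Qed.

Lemma gder_coord n m (G : 'rV[C]_n -> 'rV[C]_m) x A j : gder G x A ->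
  lholo (fun y => G y 0 j) x.
Proof.
move=> dG v.
exists (fun s => if s == 0 then (v *m A) 0 j else (G (x + s *: v) 0 j - G x 0 j) / s).
  move=> e e0; have nv := nr_ge0 v.
  have e1 : 0 < e / (nr v + 1) by rewrite divr_gt0 //; lra.
  have [d d0 Hd] := dG _ e1.
  exists (d / (nr v + 1)); first by rewrite divr_gt0 //; lra.
  move=> s; rewrite subr0 eqxx ltr_pdivlMr; last by lra.
  move=> hs; case: eqP => [_|/eqP s0]; first by rewrite subrr nc0.
  have ns0 : 0 < nc s by rewrite nc_gt0.
  have := Hd (s *: v); rewrite nrZ => /(_ ltac:(by nra)) h.
  have -> : (G (x + s *: v) 0 j - G x 0 j) / s - (v *m A) 0 j =
      (G (x + s *: v) - G x - s *: v *m A) 0 j / s.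
    by rewrite -scalemxAl !mxE; field.
  rewrite ncM ncV ltr_pdivrMr //.
  apply: le_lt_trans (nr_coord _ _) _; apply: le_lt_trans h _.
  have -> : e / (nr v + 1) * (nc s * nr v) = e * nc s * nr v / (nr v + 1) by ring.
  rewrite ltr_pdivrMr; last by lra.
  have : 0 < e * nc s by rewrite mulr_gt0.
  lra.
move=> s; rewrite subr0 scale0r addr0; case: eqP => [->|/eqP s0].
  by rewrite scale0r !mulr0 !addr0.
by rewrite divfK //; ring.
Qed.

(* On the right side [s = 1 + i y] of the unit square the point [a + (1 - s / 2) u] is at
   distance at most [3 / 4] of that of [a + u] from [a]: this gives the growth factor [4 / 3]. *)
Lemma line_zero n (f : 'rV[C]_n -> C) x v :
  (forall a b, -1 <= a <= 1 -> -1 <= b <= 1 -> lholo f (x + pt a b *: v)) ->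
  (forall b, -1 <= b <= 1 -> f (x + pt 1 b *: v) = 0) -> f x = 0.
Proof.
move=> df f0; have := @one_side_zero R (fun s => f (x + s *: v)).
rewrite scale0r addr0; apply => // a b ha hb.
by apply: lholo_line; exact: df.
Qed.

(** [N1] is a cone, later a linear subspace or the whole space. Each step enlarges the radius of
    vanishing by [4 / 3]; it stops at [ra / 2] because the square around [a + u] reaches out to
    distance at most [2 * nr u] from [a]. *)
Lemma identity_growth n (N1 : 'rV[C]_n -> Prop) (f : 'rV[C]_n -> C) a (ra e : R) :
  (forall (c : C) u, N1 u -> N1 (c *: u)) ->
  (forall x, nr (x - a) < ra -> lholo f x) -> 0 < e ->
  (forall u, N1 u -> nr u < e -> f (a + u) = 0) ->
  forall u, N1 u -> nr u < ra / 2 -> f (a + u) = 0.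
Proof.
move=> NZ df e0 f0.
have main k u : N1 u -> nr u < Num.min ((4 / 3) ^+ k * e) (ra / 2) -> f (a + u) = 0.
  elim: k u => [|k IH] u Nu; rewrite lt_min => /andP[h1 h2].
    by apply: f0 => //; move: h1; rewrite expr0 mul1r.
  apply: (@line_zero _ _ _ (- (2^-1 : C) *: u)) => [x y hx hy|y hy].
    apply: df.
    have -> : a + u + pt x y *: (- (2^-1 : C) *: u) - a = (1 - pt x y / 2) *: u.
      rewrite scalerA scalerBl scale1r; rewrite -!addrA addrC -!addrA addNr addr0.
      by congr (_ + _); rewrite -scaleNr; congr (_ *: _); ring.
    rewrite nrZ; have n1 : nc (pt x y) <= 2.
      by have := @nc_pt_le R x y 1; rewrite mulr1; apply; rewrite ler_norml.
    have : nc (1 - pt x y / 2) <= 2.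
      apply: le_trans (ncB _ _) _; rewrite nc1 ncM ncV.
      have -> : (2 : C) = (2 : R)%:C%C by rewrite rmorph_nat.
      by rewrite nc_real ger0_norm //; lra.
    by have := nr_ge0 u; nra.
  have -> : a + u + pt 1 y *: (- (2^-1 : C) *: u) = a + (1 - pt 1 y / 2) *: u.
    by rewrite -addrA; congr (_ + _); rewrite scalerA scalerBl scale1r -scaleNr;
       congr (_ + _ *: _); ring.
  apply: IH; first exact: NZ.
  have n34 : nc (1 - pt 1 y / 2) <= 3 / 4.
    rewrite -(ler_pXn2r (n:=2)) ?nnegrE ?nc_ge0 ?divr_ge0 //.
    rewrite nc_sqr.
    have -> : 1 - pt 1 y / 2 = pt (1 / 2) (- y / 2).
      by rewrite !ptE !rmorphM rmorphN fmorphV rmorph_nat rmorph1 /=; field.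
    by rewrite /=; nra.
  have nu := nr_ge0 u.
  rewrite nrZ lt_min; move: h1; rewrite exprS; move: ((4 / 3) ^+ k) => q h1.
  have : nc (1 - pt 1 y / 2) * nr u <= 3 / 4 * nr u by rewrite ler_wpM2r.
  by move=> h3; apply/andP; split; lra.
move=> u Nu hu; case: (eqVneq (nr u) 0) => [u0|un].
  by apply: f0 => //; rewrite u0.
have nu : 0 < nr u by rewrite lt_neqAle eq_sym un nr_ge0.
have [k hk] : exists k, nr u < (4 / 3) ^+ k * e.
  apply: contrapT => H.
  have : 4 / 3 <= 1 :> R; last by lra.
  apply: (@powers_le R _ _ (nr u / e)); [lra|lra|] => k.
  rewrite expr1n mulr1 ler_pdivlMr // leNgt; apply/negP => ?; apply: H; exists k.
  by [].
by apply: (main k) => //; rewrite lt_min hk.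
Qed.

(** Since [g t / t] tends to [D], a bound on these quotients passes to the limit. With [B = 0] this
    differentiates an identity along a ray. *)
Lemma ray_derivative_bound (g : R -> C) (D : C) (B t1 : R) :
  (forall e, 0 < e -> exists2 d, 0 < d &
     forall t, 0 < t < d -> nc (g t - t%:C%C * D) <= e * t) ->
  0 < t1 -> (forall t, 0 < t < t1 -> nc (g t) <= B * t) -> nc D <= B.
Proof.
move=> H t10 gB; rewrite leNgt; apply/negP => lt.
have [d d0 Hd] := H ((nc D - B) / 2) ltac:(lra).
pose t := Num.min t1 d / 2.
have m0 : 0 < Num.min t1 d by rewrite lt_min t10.
have [m1 m2] : Num.min t1 d <= t1 /\ Num.min t1 d <= d by split; rewrite ge_min lexx ?orbT.
have t0 : 0 < t by rewrite /t; lra.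
have h1 := Hd t ltac:(rewrite /t in t0 *; lra).
have h2 := gB t ltac:(rewrite /t in t0 *; lra).
have : nc (t%:C%C * D) = t * nc D by rewrite ncM nc_real gtr0_norm.
have := nc_sub_ge (t%:C%C * D) (g t); rewrite nc_distC => h3 h4.
have : 0 < t * (nc D - B) by rewrite mulr_gt0 //; lra.
by nra.
Qed.

Lemma gder_ray n m (G : 'rV[C]_n -> 'rV[C]_m) x A v j : gder G x A ->
  forall e, 0 < e -> exists2 d, 0 < d & forall t, 0 < t < d ->
  nc (G (x + t%:C%C *: v) 0 j - G x 0 j - t%:C%C * (v *m A) 0 j) <= e * t.
Proof.
move=> dG e e0; have nv := nr_ge0 v.
have e1 : 0 < e / (nr v + 1) by rewrite divr_gt0 //; lra.
have [d d0 Hd] := dG _ e1.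
exists (d / (nr v + 1)); first by rewrite divr_gt0 //; lra.
move=> t /andP[t0]; rewrite ltr_pdivlMr; last by lra.
move=> td.
have nt : nr (t%:C%C *: v) = t * nr v by rewrite nrZ nc_real gtr0_norm.
have := Hd (t%:C%C *: v); rewrite nt => /(_ ltac:(lra)) h.
move: h; rewrite -scalemxAl; move: (v *m A) => w h.
have := le_trans (nr_coord _ j) h; rewrite !mxE => h'; apply: (le_trans h').
have -> : e / (nr v + 1) * (t * nr v) = e * t * (nr v / (nr v + 1)) by ring.
apply: ler_piMr; first by rewrite mulr_ge0 // ltW.
by rewrite ler_pdivrMr; lra.
Qed.

(** * Continuity of the derivative *)

Section DerivativeContinuity.
Variables (n m : nat) (G : 'rV[C]_n -> 'rV[C]_m) (A : 'rV[C]_n -> 'M[C]_(n, m)).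
Variables (p : 'rV[C]_n) (r : R).
Hypothesis r0 : 0 < r.
Hypothesis dG : forall x, nr (x - p) < r -> gder G x (A x).

Lemma gder_line_bound j x v M : (forall a b, -1 <= a <= 1 -> -1 <= b <= 1 ->
    nr (x + pt a b *: v - p) < r /\ nc (G (x + pt a b *: v) 0 j - G x 0 j) <= M) ->
  forall t, 0 <= t <= 1 -> nc (G (x + t%:C%C *: v) 0 j - G x 0 j) <= M * t.
Proof.
move=> H t ht.
have := @schwarz R (fun s => G (x + s *: v) 0 j - G x 0 j) M.
rewrite scale0r addr0 subrr => Hs.
have := Hs _ (erefl _) t 0 ltac:(lra) ltac:(lra).
rewrite pt0 nc_real ger0_norm; last by lra.
apply=> a b ha hb; have [h1 h2] := H a b ha hb; split=> //.
apply: cdiffB; last exact: cdiff_cst.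
by apply: (@lholo_line _ (fun y => G y 0 j)); apply: gder_coord; exact: dG.
Qed.

(** Schwarz's lemma as a Cauchy estimate: continuity at [p] bounds the increments of [G] by 2 on
    squares of size comparable to [q], and the segment from [x] to [y] is the fraction
    [nr (y - x) / (q / 4)] of such a square. *)
Lemma gder_lipschitz j : exists L d, [/\ 0 <= L, 0 < d, d <= r & forall x y,
  nr (x - p) < d -> nr (y - p) < d -> nc (G y 0 j - G x 0 j) <= L * nr (y - x)].
Proof.
have pp : nr (p - p) < r by rewrite subrr nr0.
have [d d0 Hd] := gder_vcont (dG pp) ltr01.
pose q := Num.min r d.
have q0 : 0 < q by rewrite lt_min r0.
have [qr qd] : q <= r /\ q <= d by rewrite /q; split; rewrite ge_min lexx ?orbT.
exists (8 / q), (q / 8); split; [by rewrite divr_ge0 // ltW|by lra|by lra|].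
move=> x y hx hy.
case: (eqVneq (nr (y - x)) 0) => [yx|yx].
  by have /eqP := nr_eq0 yx; rewrite subr_eq0 => /eqP ->; rewrite !subrr nc0 nr0 mulr0.
have yx0 : 0 < nr (y - x) by rewrite lt_neqAle eq_sym yx nr_ge0.
have yxq : nr (y - x) < q / 4.
  by have := nr_triangle y p x; rewrite (nr_distC p); lra.
pose k := q / 4 / nr (y - x).
have k0 : 0 < k by rewrite !divr_gt0.
suff P : forall a b, -1 <= a <= 1 -> -1 <= b <= 1 ->
    nr (x + pt a b *: (k%:C%C *: (y - x)) - p) < r /\
    nc (G (x + pt a b *: (k%:C%C *: (y - x))) 0 j - G x 0 j) <= 2.
  have := gder_line_bound P (t := nr (y - x) / (q / 4)).
  rewrite [_%:C%C *: (_%:C%C *: _)]scalerA -[_%:C%C * _%:C%C]rmorphM /=.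
  have -> : nr (y - x) / (q / 4) * k = 1 by rewrite /k; field; rewrite yx gt_eqF.
  rewrite rmorph1 scale1r [x + (y - x)]addrC subrK.
  have -> : 2 * (nr (y - x) / (q / 4)) = 8 / q * nr (y - x).
    by field; rewrite gt_eqF.
  by apply; rewrite divr_ge0 ?ler_pdivrMr ?mul1r; lra.
move=> a b ha hb.
have nk : nr (pt a b *: (k%:C%C *: (y - x))) <= q / 2.
  rewrite !nrZ nc_real gtr0_norm // /k divfK ?gt_eqF //.
  have := @nc_pt_le R a b 1; rewrite mulr1 !ler_norml => /(_ ltac:(lra) ltac:(lra)).
  by have := nc_ge0 (pt a b); nra.
have np : nr (x + pt a b *: (k%:C%C *: (y - x)) - p) < q.
  by have := nrD (x - p) (pt a b *: (k%:C%C *: (y - x))); rewrite addrAC; lra.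
split; first by lra.
have h1 : nr (x - p) < d by lra.
have h2 : nr (x + pt a b *: (k%:C%C *: (y - x)) - p) < d by lra.
have := Hd _ h1; have := Hd _ h2.
set z := x + _ => g1 g2.
have := nr_coord (G z - G x) j; rewrite !mxE; have := nr_triangle (G z) (G p) (G x).
by rewrite (nr_distC (G p)); lra.
Qed.

(** The second difference [g] of [G] vanishes at 0 and is at most [2 * L * nr (x - p)] by the
    Lipschitz bound. Schwarz's lemma then bounds its derivative at 0, which is [k] times the
    increment of [v *m A]. This continuity makes transversality an open condition. *)
Lemma gder_cont v : vcont (fun x => v *m A x) p.
Proof.
have coord j : exists L d, [/\ 0 <= L, 0 < d & forall x, nr (x - p) < d ->
    nc ((v *m A x) 0 j - (v *m A p) 0 j) <= L * nr (x - p)].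
  have [L [d [L0 d0 dr HL]]] := gder_lipschitz j.
  have nv := nr_ge0 v.
  pose k := d / (4 * (nr v + 1)).
  have k0 : 0 < k by rewrite divr_gt0 //; lra.
  have kv : k * nr v <= d / 4.
    rewrite /k mulrAC ler_pdivrMr; last by lra.
    by nra.
  exists (2 * L / k), (d / 4); split; [by apply: divr_ge0; [apply: mulr_ge0|apply: ltW]|by lra|].
  move=> x hx.
  have nx := nr_ge0 (x - p).
  pose g (s : C) := (G (x + s *: (k%:C%C *: v)) 0 j - G (p + s *: (k%:C%C *: v)) 0 j)
      - (G x 0 j - G p 0 j).
  have nkv a b : -1 <= a <= 1 -> -1 <= b <= 1 ->
      nr (x + pt a b *: (k%:C%C *: v) - p) < d /\ nr (p + pt a b *: (k%:C%C *: v) - p) < d.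
    move=> ha hb; have nk : nr (pt a b *: (k%:C%C *: v)) <= d / 2.
      rewrite !nrZ nc_real gtr0_norm //.
      have := @nc_pt_le R a b 1; rewrite mulr1 !ler_norml => /(_ ltac:(lra) ltac:(lra)).
      by have := nc_ge0 (pt a b); nra.
    by have := nrD (x - p) (pt a b *: (k%:C%C *: v)); rewrite !(addrAC _ _ (- p)) subrr add0r; lra.
  have px : nr (p - p) < d by rewrite subrr nr0.
  have xd : nr (x - p) < d by lra.
  have hs : forall t, 0 <= t <= 1 -> nc (g t%:C%C) <= 2 * L * nr (x - p) * t.
    move=> t ht; have := @schwarz R g (2 * L * nr (x - p)).
    have -> : g 0 = 0 by rewrite /g !scale0r !addr0 subrr.
    move=> Hs; have := Hs _ (erefl _) t 0 ltac:(lra) ltac:(lra).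
    rewrite pt0 nc_real ger0_norm; last by lra.
    apply=> a b ha hb; have [h1 h2] := nkv a b ha hb; split.
      apply: cdiffB; last exact: cdiff_cst.
      apply: cdiffB; apply: (@lholo_line _ (fun y => G y 0 j)); apply: gder_coord; apply: dG; lra.
    apply: le_trans (ncB _ _) _.
    have l1 := HL _ _ h2 h1; have l2 := HL _ _ px xd.
    move: l1; rewrite opprD addrACA subrr addr0 => l1.
    by rewrite -mulrA mulrDl !mul1r; lra.
  have gx := dG (lt_le_trans xd dr); have gp := dG (lt_le_trans px dr).
  have : nc (k%:C%C * ((v *m A x) 0 j - (v *m A p) 0 j)) <= 2 * L * nr (x - p).
    apply: (@ray_derivative_bound (fun t => g t%:C%C) _ _ 1) => // [e e0|t /andP[t0 t1]];
      last by apply: hs; apply/andP; split; apply: ltW.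
    have e2 : 0 < e / 2 by lra.
    have [d1 d10 H1] := gder_ray (k%:C%C *: v) j gx e2.
    have [d2 d20 H2] := gder_ray (k%:C%C *: v) j gp e2.
    exists (Num.min d1 d2); first by rewrite lt_min d10.
    move=> t; rewrite lt_min => /andP[t0 /andP[t1 t2]].
    have {H1}h1 := H1 t ltac:(by rewrite t0); have {H2}h2 := H2 t ltac:(by rewrite t0).
    have E y : (k%:C%C *: v *m A y) 0 j = k%:C%C * (v *m A y) 0 j.
      by rewrite -scalemxAl; move: (v *m A y) => w; rewrite mxE.
    move: h1 h2; rewrite !E.
    have -> : g t%:C%C - t%:C%C * (k%:C%C * ((v *m A x) 0 j - (v *m A p) 0 j)) =
        (G (x + t%:C%C *: (k%:C%C *: v)) 0 j - G x 0 j - t%:C%C * (k%:C%C * (v *m A x) 0 j))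
        - (G (p + t%:C%C *: (k%:C%C *: v)) 0 j - G p 0 j - t%:C%C * (k%:C%C * (v *m A p) 0 j)).
      by rewrite /g; ring.
    by move=> h1 h2; apply: le_trans (ncB _ _) _; rewrite (splitr e) mulrDl lerD.
  rewrite ncM nc_real gtr0_norm // mulrC -ler_pdivlMr // => h.
  by apply: le_trans h _; rewrite mulrAC.
move=> e e0.
have e1 : 0 < e / (2 * (m%:R + 1)).
  by rewrite divr_gt0 //; have : 0 <= m%:R :> R by []; lra.
have [d d0 Hd] : exists2 d, 0 < d & forall x, nr (x - p) < d -> forall j,
    nc ((v *m A x) 0 j - (v *m A p) 0 j) <= e / (2 * (m%:R + 1)).
  have sm (s : seq 'I_m) : exists2 d, 0 < d & forall x, nr (x - p) < d -> forall j, j \in s ->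
      nc ((v *m A x) 0 j - (v *m A p) 0 j) <= e / (2 * (m%:R + 1)).
    elim: s => [|i s [d1 d10 H1]]; first by exists 1.
    have [L [d2 [L0 d20 H2]]] := coord i.
    exists (Num.min d1 (Num.min d2 (e / (2 * (m%:R + 1)) / (L + 1)))).
      by rewrite !lt_min d10 d20 divr_gt0 //; lra.
    move=> x; rewrite !lt_min => /and3P[/H1 h1 /H2 h2 h3] j.
    rewrite inE => /predU1P[->|]; last exact: h1.
    apply: le_trans h2 _; move: h3; rewrite ltr_pdivlMr; last by lra.
    by have := nr_ge0 (x - p); nra.
  have [d d0 H] := sm (enum 'I_m); exists d => // x hx j.
  by apply: H => //; rewrite mem_enum.
exists d => // x /Hd hx.
apply: le_lt_trans (nr_le_coord (M := e / (2 * (m%:R + 1))) _) _.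
  by move=> j; have := hx j; rewrite !mxE.
rewrite mulrA ltr_pdivrMr; last by have : 0 <= m%:R :> R by []; lra.
by have : 0 <= m%:R :> R by []; nra.
Qed.

End DerivativeContinuity.
End RowNorm.

(** * Indefinite Hermitian forms *)

Section HForm.
Variables (R : realType) (r s t : nat).
Local Notation C := R[i].
Local Notation V := ('rV[C]_(r + s + t)).
Local Notation H := (@hform R r s t).
Implicit Types (u v w x y z : V) (a b c : C).

Lemma cRe0 : complex.Re (0 : C) = 0. Proof. by []. Qed.

Lemma conjE (a : C) : (a^*)%R = (a^*)%C. Proof. by []. Qed.

Lemma nc_conjC (a : C) : nc (a^*)%R = nc a. Proof. by rewrite conjE nc_conj. Qed.

Lemma sgn_coef_conj j : (sgn_coef R r s j)^* = sgn_coef R r s j.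
Proof. by rewrite /sgn_coef; case: ifP => _; [|case: ifP => _]; rewrite ?rmorphN ?rmorph1 ?rmorph0. Qed.

Lemma hformDl u v w : H (u + v) w = H u w + H v w.
Proof. by rewrite /hform -big_split; apply: eq_bigr => j _; rewrite mxE /=; ring. Qed.

Lemma hformZl a u w : H (a *: u) w = a * H u w.
Proof. by rewrite /hform mulr_sumr; apply: eq_bigr => j _; rewrite mxE /=; ring. Qed.

Lemma hformC u v : H v u = (H u v)^*.
Proof.
rewrite /hform rmorph_sum; apply: eq_bigr => j _ /=.
by rewrite !rmorphM /= sgn_coef_conj conjCK; ring.
Qed.

Lemma hformDr u v w : H w (u + v) = H w u + H w v.
Proof. by rewrite hformC hformDl rmorphD /= -!hformC. Qed.

Lemma hformZr a u w : H w (a *: u) = a^* * H w u.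
Proof. by rewrite hformC hformZl rmorphM /= -!hformC. Qed.

Lemma hform0l w : H 0 w = 0.
Proof. by rewrite -(scale0r 0) hformZl mul0r. Qed.

Lemma hform0r w : H w 0 = 0.
Proof. by rewrite -(scale0r 0) hformZr rmorph0 mul0r. Qed.

Lemma hformNl u w : H (- u) w = - H u w.
Proof. by rewrite -scaleN1r hformZl mulN1r. Qed.

Lemma hformNr u w : H w (- u) = - H w u.
Proof. by rewrite -scaleN1r hformZr rmorphN rmorph1 mulN1r. Qed.

Lemma hformBl u v w : H (u - v) w = H u w - H v w.
Proof. by rewrite hformDl hformNl. Qed.

Lemma hformBr u v w : H w (u - v) = H w u - H w v.
Proof. by rewrite hformDr hformNr. Qed.

Lemma hform_suml (I : finType) (P : pred I) (f : I -> V) w :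
  H (\sum_(i | P i) f i) w = \sum_(i | P i) H (f i) w.
Proof.
by elim/big_rec2: _ => [|i a u _ <-]; rewrite ?hform0l ?hformDl.
Qed.

Lemma hform_sumr (I : finType) (P : pred I) (f : I -> V) w :
  H w (\sum_(i | P i) f i) = \sum_(i | P i) H w (f i).
Proof.
by elim/big_rec2: _ => [|i a u _ <-]; rewrite ?hform0r ?hformDr.
Qed.

Lemma hform_eq0C u v : H u v = 0 -> H v u = 0.
Proof. by rewrite [H v u]hformC => ->; rewrite rmorph0. Qed.

Lemma hform_neq0C u v : H u v != 0 -> H v u != 0.
Proof. by rewrite [H v u]hformC fmorph_eq0. Qed.

Definition hq u : R := complex.Re (H u u).

Lemma hqE u : H u u = (hq u)%:C%C.
Proof.
have := hformC u u; rewrite conjE /hq; case: (H u u) => a b [] /eqP.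
by rewrite -subr_eq0 opprK -mulr2n mulrn_eq0 /= => /eqP ->.
Qed.

Lemma hform_gt0 u : (0 < H u u) = (0 < hq u).
Proof. by rewrite hqE ltcR. Qed.

Lemma hqD u v : hq (u + v) = hq u + hq v + 2 * complex.Re (H u v).
Proof.
rewrite /hq hformDl !hformDr (hformC u v) conjE.
by rewrite !raddfD /=; case: (H u v) => a b /=; ring.
Qed.

Lemma hqZ a u : hq (a *: u) = nc a ^+ 2 * hq u.
Proof.
rewrite /hq hformZl hformZr hqE conjE nc_sqr; case: a => p q /=; ring.
Qed.

Lemma hqN u : hq (- u) = hq u.
Proof. by rewrite -scaleN1r hqZ ncN nc1 expr1n mul1r. Qed.

Lemma nc_sgn_coef j : nc (sgn_coef R r s j) <= 1.
Proof.
rewrite /sgn_coef; case: ifP => _; first by rewrite nc1.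
by case: ifP => _; rewrite ?ncN ?nc1 ?nc0.
Qed.

Lemma hform_le u v : nc (H u v) <= nr u * nr v.
Proof.
have big_nc (I : finType) (F : I -> C) : nc (\sum_i F i) <= \sum_i nc (F i).
  elim/big_ind2: _ => [|x1 y1 x2 y2 h1 h2|//]; first by rewrite nc0.
  by apply: le_trans (ncD _ _) _; apply: lerD.
apply: le_trans (big_nc _ _) _.
rewrite /nr mulr_suml; apply: ler_sum => j _; rewrite !ncM nc_conjC.
have := nc_sgn_coef j; have := nc_ge0 (sgn_coef R r s j).
have := nr_coord v j; rewrite -/(nr v).
have := nc_ge0 (u 0 j); have := nc_ge0 (v 0 j) => v0 u0 hv s0 s1.
apply: ler_pM => //; first by rewrite mulr_ge0.
by rewrite ler_piMl.
Qed.

Lemma gder_hform n (G : 'rV[C]_n -> V) (x : 'rV[C]_n) A y : gder G x A -> lholo (fun z : 'rV[C]_n => H (G z) y) x.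
Proof.
move=> dG; apply: lholo_sum => j; apply: lholoM; last exact: lholo_cst.
by apply: lholoM; [exact: lholo_cst|exact: gder_coord dG].
Qed.

Lemma hform_lholo y x : lholo (fun z => H z y) x.
Proof. by apply: lholo_linear => a u v; rewrite hformDl hformZl. Qed.

(** With the positive coordinates gone the form is minus a sum of squares, so a null vector of this
    kind has only radical coordinates left. *)
Lemma hform_negative u : (forall j : 'I_(r + s + t), (j < r)%N -> u 0 j = 0) ->
  hq u <= 0 /\ (hq u = 0 -> forall y, H u y = 0).
Proof.
move=> u0.
have E : hq u = - \sum_(j : 'I_(r + s + t) | (r <= j < r + s)%N) nc (u 0 j) ^+ 2.
  rewrite /hq /hform raddf_sum /= (bigID (fun j : 'I_(r + s + t) => (r <= j < r + s)%N)) /=.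
  rewrite [X in _ + X]big1 ?addr0 -?sumrN; last first.
    move=> j; rewrite negb_and -ltnNge -leqNgt => /orP[/u0 ->|h]; first by rewrite mulr0 mul0r.
    by rewrite /sgn_coef !ltnNge (leq_trans _ h) ?leq_addr //= h /= !mul0r.
  apply: eq_bigr => j /andP[h1 h2].
  rewrite /sgn_coef ltnNge h1 /= h2 conjE nc_sqr; case: (u 0 j) => a b /=; ring.
have S0 : 0 <= \sum_(j : 'I_(r + s + t) | (r <= j < r + s)%N) nc (u 0 j) ^+ 2.
  by apply: sumr_ge0 => j _; rewrite exprn_ge0 ?nc_ge0.
split; first by rewrite E oppr_le0.
move=> /eqP; rewrite E oppr_eq0 psumr_eq0; last by move=> j _; rewrite exprn_ge0 ?nc_ge0.
move=> /allP h y; rewrite /hform big1 // => j _.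
case: (ltnP j r) => jr; first by rewrite u0 // mulr0 mul0r.
case: (ltnP j (r + s)) => js.
  have := h j (mem_index_enum _); rewrite jr js /= expf_eq0 /= nc_eq0 => /eqP ->.
  by rewrite mulr0 mul0r.
by rewrite /sgn_coef !ltnNge jr js /= !mul0r.
Qed.

(** More than [r] vectors have a nontrivial combination whose first [r] coordinates vanish. Both
    index bounds below follow from it. *)
Lemma index_combination (I : finType) (f : I -> V) : (r < #|I|)%N ->
  exists c : I -> C, (exists i, c i != 0) /\
    (hq (\sum_i c i *: f i) <= 0 /\
     (hq (\sum_i c i *: f i) = 0 -> forall y, H (\sum_i c i *: f i) y = 0)).
Proof.
move=> rI.
pose wd (j : 'I_r) : 'I_(r + s + t) := lshift t (lshift s j).
pose M : 'M[C]_(#|I|, r) := \matrix_(i, j) f (enum_val i) 0 (wd j).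
have : kermx M != 0.
  rewrite kermx_eq0 /row_free neq_ltn (leq_ltn_trans _ rI) //.
  exact: rank_leq_col.
case/rowV0Pn => x /sub_kermxP xM x0.
have [i0 xi0] : exists i, x 0 i != 0 by apply/rV0Pn.
exists (fun i => x 0 (enum_rank i)); split; first by exists (enum_val i0); rewrite enum_valK.
apply: hform_negative => j jr.
have -> : j = wd (Ordinal jr) by apply: val_inj.
rewrite summxE; have := congr1 (fun m : 'rV_r => m 0 (Ordinal jr)) xM.
rewrite !mxE => {2}<-.
rewrite [RHS](reindex (@enum_rank I)) /=; last by apply: onW_bij; exact: enum_rank_bij.
rewrite (eq_bigr (fun k => x 0 (enum_rank k) * M (enum_rank k) (Ordinal jr))) // => i _.
by rewrite !mxE enum_rankK.
Qed.

(** The combination is null because the family spans an isotropic subspace, hence it lies in the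
    radical. In the target this turns the bound on [r'] into linear relations between values of
    [G]. *)
Lemma null_index (I : finType) (f : I -> V) : (forall i j, H (f i) (f j) = 0) ->
  (r < #|I|)%N -> exists c : I -> C, (exists i, c i != 0) /\
    forall y, \sum_i c i * H (f i) y = 0.
Proof.
move=> f0 /(index_combination f)[c [c0 [_ h]]]; exists c; split=> // y.
rewrite (eq_bigr (fun i => H (c i *: f i) y)); last by move=> i _; rewrite hformZl.
rewrite -hform_suml; apply: h.
rewrite /hq hform_suml big1 // => i _; rewrite hform_sumr big1 // => j _.
by rewrite hformZl hformZr f0 !mulr0.
Qed.

(** Orthogonal positive vectors span a positive definite subspace, where a nontrivial combination
    cannot have [hq <= 0]. *)
Lemma positive_index (I : finType) (f : I -> V) : (forall i j, i != j -> H (f i) (f j) = 0) ->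
  (forall i, 0 < hq (f i)) -> (#|I| <= r)%N.
Proof.
move=> f0 fp; rewrite leqNgt; apply/negP => /(index_combination f)[c [[i0 c0] [h _]]].
have : 0 < hq (\sum_i c i *: f i); last by lra.
have -> : hq (\sum_i c i *: f i) = \sum_i nc (c i) ^+ 2 * hq (f i).
  rewrite /hq hform_suml raddf_sum; apply: eq_bigr => i _ /=.
  rewrite hform_sumr (bigD1 i) //= big1 ?addr0 => [|j ji].
    by rewrite -/(hq (f i)) -hqZ /hq.
  by rewrite hformZl hformZr f0 ?mulr0 // eq_sym.
rewrite (bigD1 i0) //= ltr_pwDl //.
  by rewrite mulr_gt0 ?exprn_gt0 ?nc_gt0.
by apply: sumr_ge0 => i _; rewrite mulr_ge0 ?exprn_ge0 ?nc_ge0 // ltW.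
Qed.

Lemma kernel_vector (m k : nat) (M : 'M[C]_(m, k)) : (k < m)%N ->
  exists2 x : 'rV_m, x != 0 & x *m M = 0.
Proof.
move=> km; have : kermx M != 0.
  by rewrite kermx_eq0 /row_free neq_ltn (leq_ltn_trans _ km) // rank_leq_col.
by case/rowV0Pn => x /sub_kermxP xM x0; exists x.
Qed.

Lemma hform_split z w : H z w =
  \sum_(j < r) z 0 (lshift t (lshift s j)) * (w 0 (lshift t (lshift s j)))^*
  - \sum_(j < s) z 0 (lshift t (rshift r j)) * (w 0 (lshift t (rshift r j)))^*.
Proof.
rewrite /hform big_split_ord /= [X in _ + X]big1 ?addr0; last first.
  by move=> j _; rewrite /sgn_coef /= !ltnNge leq_addr -!addnA leq_addr /= !mul0r.
rewrite big_split_ord /= -sumrN; congr (_ + _); apply: eq_bigr => j _.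
  by rewrite /sgn_coef /= ltn_ord mul1r.
by rewrite /sgn_coef /= ltnNge leq_addr /= ltn_add2l ltn_ord; ring.
Qed.

Lemma mulJ_nc (a : C) : complex.Re (a * a^*) = nc a ^+ 2.
Proof. by rewrite conjE nc_sqr; case: a => p q /=; ring. Qed.

Lemma sum_nc2_gt0 m (x : 'rV[C]_m) : x != 0 -> 0 < \sum_j nc (x 0 j) ^+ 2.
Proof.
case/rV0Pn => j xj; rewrite (bigD1 j) //= ltr_pwDl ?exprn_gt0 ?nc_gt0 //.
by apply: sumr_ge0 => i _; rewrite exprn_ge0 ?nc_ge0.
Qed.

Lemma positive_orthogonal (k : nat) (f : 'I_k -> V) : (k < r)%N ->
  exists2 x, 0 < hq x & forall i, H x (f i) = 0.
Proof.
move=> kr.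
pose M : 'M[C]_(r, k) := \matrix_(j, i) (f i 0 (lshift t (lshift s j)))^*.
have [y y0 yM] := kernel_vector M kr.
pose x : V := row_mx (row_mx y 0) 0.
have xl j : x 0 (lshift t (lshift s j)) = y 0 j by rewrite !row_mxEl.
have xr j : x 0 (lshift t (rshift r j)) = 0 by rewrite row_mxEl row_mxEr mxE.
exists x => [|i]; rewrite ?/hq hform_split.
  rewrite [X in _ - X]big1 ?subr0; last by move=> j _; rewrite xr mul0r.
  rewrite raddf_sum /= (eq_bigr (fun j => nc (y 0 j) ^+ 2)) ?sum_nc2_gt0 // => j _.
  by rewrite xl mulJ_nc.
rewrite [X in _ - X]big1 ?subr0; last by move=> j _; rewrite xr mul0r.
have := congr1 (fun m : 'rV_k => m 0 i) yM; rewrite !mxE => {2}<-.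
by apply: eq_bigr => j _; rewrite xl !mxE.
Qed.

Lemma negative_orthogonal (k : nat) (f : 'I_k -> V) : (k < s)%N ->
  exists2 x, hq x < 0 & forall i, H x (f i) = 0.
Proof.
move=> kr.
pose M : 'M[C]_(s, k) := \matrix_(j, i) (f i 0 (lshift t (rshift r j)))^*.
have [y y0 yM] := kernel_vector M kr.
pose x : V := row_mx (row_mx 0 y) 0.
have xl j : x 0 (lshift t (lshift s j)) = 0 by rewrite !row_mxEl mxE.
have xr j : x 0 (lshift t (rshift r j)) = y 0 j by rewrite row_mxEl row_mxEr.
exists x => [|i]; rewrite ?/hq hform_split.
  rewrite [X in X - _]big1 ?sub0r; last by move=> j _; rewrite xl mul0r.
  rewrite raddfN raddf_sum /= oppr_lt0 (eq_bigr (fun j => nc (y 0 j) ^+ 2)) ?sum_nc2_gt0 // => j _.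
  by rewrite xr mulJ_nc.
rewrite [X in X - _]big1 ?sub0r; last by move=> j _; rewrite xl mul0r.
have := congr1 (fun m : 'rV_k => m 0 i) yM; rewrite !mxE => E.
apply/eqP; rewrite oppr_eq0; apply/eqP; rewrite -{2}E.
by apply: eq_bigr => j _; rewrite xr !mxE.
Qed.

End HForm.

(** * Hyperbolic frames *)

Section Frames.
Variables (R : realType) (r s : nat).
Local Notation C := R[i].
Local Notation V := ('rV[C]_(r + s + 0)).
Local Notation H := (@hform R r s 0).
Implicit Types (p u v w x y z : V) (a b c : C) (e f : nat -> V).

Lemma hform_nondeg x : x != 0 -> exists y, H y x = 1.
Proof.
case/rV0Pn => j xj.
have E : H (delta_mx 0 j) x = sgn_coef R r s j * (x 0 j)^*.
  rewrite /hform (bigD1 j) //= big1 ?addr0 => [|i ij]; first by rewrite mxE !eqxx mulr1.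
  by rewrite mxE (negPf ij) andbF mulr0 mul0r.
have n0 : H (delta_mx 0 j) x != 0.
  rewrite E mulf_neq0 ?fmorph_eq0 // /sgn_coef; case: ifP => _; first exact: oner_neq0.
  have jr : (j < r + s)%N by apply: leq_trans (ltn_ord j) _; rewrite addn0.
  by rewrite jr oppr_eq0 oner_neq0.
by exists ((H (delta_mx 0 j) x)^-1 *: delta_mx 0 j); rewrite hformZl mulVf.
Qed.

Lemma hform_inj x y : (forall z, H z x = H z y) -> x = y.
Proof.
move=> E; apply/eqP; rewrite -subr_eq0; apply/negPn/negP => /hform_nondeg[z].
by rewrite hformBr E subrr => /eqP; rewrite eq_sym oner_eq0.
Qed.

Lemma nullify y p : hq p = 0 -> H y p = 1 -> exists a, hq (y + a *: p) = 0.
Proof.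
move=> p0 yp; exists (- hq y / 2)%:C%C.
rewrite hqD hqZ p0 hformZr yp conjE; rewrite /= oppr0 !mulr1; lra.
Qed.

Lemma null_dual p : p != 0 -> hq p = 0 -> exists d : V, hq d = 0 /\ H d p = 1.
Proof.
move=> /hform_nondeg[y yp] p0; have [a ha] := nullify p0 yp.
by exists (y + a *: p); rewrite hformDl hformZl yp hqE p0 mulr0 addr0.
Qed.

(** If every vector orthogonal to [w] were orthogonal to [p], nondegeneracy would make [p] a
    multiple of [w]. Moving in the resulting direction [d] preserves orthogonality to [w] and is
    transversal to the null cone at [p]. *)
Lemma null_dual2 p w : p != 0 -> w != 0 -> (forall c, p != c *: w) -> hq p = 0 -> hq w = 0 ->
  H p w = 0 -> exists d : V, [/\ hq d = 0, H d w = 0 & H d p = 1].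
Proof.
move=> pn wn indep p0 w0 pw.
have [y [yw yp]] : exists y, H y w = 0 /\ H y p != 0.
  apply: contrapT => nex.
  have [y0 y0w] := hform_nondeg wn.
  have /eqP := indep ((H y0 p)^*); apply; apply: hform_inj => z.
  rewrite hformZr conjCK.
  have : H (z - H z w *: y0) p = 0.
    apply/eqP/negPn/negP => zp; apply: nex; exists (z - H z w *: y0); split=> //.
    by rewrite hformBl hformZl y0w mulr1 subrr.
  by rewrite hformBl hformZl => /eqP; rewrite subr_eq0 mulrC => /eqP.
have yp1 : H ((H y p)^-1 *: y) p = 1 by rewrite hformZl mulVf.
have [a ha] := nullify p0 yp1.
exists ((H y p)^-1 *: y + a *: p); split=> //.
  by rewrite hformDl !hformZl yw pw !mulr0 addr0.
by rewrite hformDl yp1 hformZl hqE p0 mulr0 addr0.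
Qed.

(** The null pairs [e i], [f i] span mutually orthogonal hyperbolic planes. Sequences over [nat] let
    a frame be extended without a change of type. *)
Definition frame k e f := forall i j, (i < k)%N -> (j < k)%N ->
  [/\ H (e i) (e j) = 0, H (f i) (f j) = 0 & H (e i) (f j) = (i == j)%:R].

Lemma frameC k e f i j : frame k e f -> (i < k)%N -> (j < k)%N -> H (f i) (e j) = (i == j)%:R.
Proof. by move=> F ik jk; have [_ _ h] := F j i jk ik; rewrite hformC h rmorph_nat eq_sym. Qed.

(** In each plane [e + f / 2] and [e - f / 2] have squares 1 and -1; these are [U] and [W]. A
    positive vector orthogonal to the [k < r] vectors [U] is projected off the [W], which can only
    raise its square; dually for a negative vector, using [k < s]. Their normalizations [m], [l]
    give the null pair [m + l], [(m - l) / 2]. *)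
Lemma frame_extend k e f : frame k e f -> (k < r)%N -> (k < s)%N ->
  exists u v, [/\ hq u = 0, hq v = 0, H u v = 1 &
    forall i, (i < k)%N -> [/\ H u (e i) = 0, H u (f i) = 0, H v (e i) = 0 & H v (f i) = 0]].
Proof.
move=> F kr ks.
have h2 : (2^-1 : C)^* = 2^-1 by rewrite fmorphV rmorph_nat.
have hh : (2^-1 : C) + 2^-1 = 1 by field.
pose U (i : 'I_k) : V := e i + 2^-1 *: f i.
pose W (i : 'I_k) : V := e i - 2^-1 *: f i.
have UU i j : H (U i) (U j) = (i == j)%:R.
  have [h1 h3 h4] := F i j (ltn_ord i) (ltn_ord j).
  rewrite /U !(hformDl, hformDr, hformZl, hformZr) h1 h3 h4 (frameC F) // h2.
  by rewrite !mulr0 !add0r addr0 -mulrDl hh mul1r.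
have WW i j : H (W i) (W j) = - (i == j)%:R.
  have [h1 h3 h4] := F i j (ltn_ord i) (ltn_ord j).
  rewrite /W !(hformBl, hformBr, hformZl, hformZr) h1 h3 h4 (frameC F) // h2.
  by rewrite !mulr0 !sub0r oppr0 addr0 -opprD -mulrDl hh mul1r.
have UW i j : H (U i) (W j) = 0.
  have [h1 h3 h4] := F i j (ltn_ord i) (ltn_ord j).
  rewrite /W /U !(hformDl, hformBr, hformZl, hformZr) h1 h3 h4 (frameC F) // h2.
  by rewrite !mulr0 !sub0r subr0 addNr.
have WU i j : H (W i) (U j) = 0 by exact: hform_eq0C.
have delta (F0 : 'I_k -> C) j : \sum_i F0 i * (i == j)%:R = F0 j.
  by rewrite (bigD1 j) //= big1 ?addr0 => [|i /negPf ->]; rewrite ?eqxx ?mulr1 ?mulr0.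
have [x x0 xU] := positive_orthogonal U kr.
pose y : V := x + \sum_i H x (W i) *: W i.
have yU j : H y (U j) = 0.
  rewrite /y hformDl xU add0r hform_suml big1 // => i _.
  by rewrite hformZl WU mulr0.
have yW j : H y (W j) = 0.
  rewrite /y hformDl hform_suml (eq_bigr (fun i => - (H x (W i) * (i == j)%:R))).
    by rewrite sumrN delta subrr.
  by move=> i _; rewrite hformZl WW mulrN.
have mulJ (a : C) : a * a^* = (nc a ^+ 2)%:C%C.
  by rewrite conjE nc_sqr; case: a => p q; apply/eqP; rewrite eq_complex /=;
     apply/andP; split; apply/eqP; ring.
have y0 : 0 < hq y.
  have E : H y y = (hq x + \sum_i nc (H x (W i)) ^+ 2)%:C%C.
    rewrite {2}/y hformDr hform_sumr big1 => [|i _]; last by rewrite hformZr yW mulr0.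
    rewrite addr0 /y hformDl hform_suml rmorphD rmorph_sum /= hqE; congr (_ + _).
    by apply: eq_bigr => i _; rewrite hformZl [H (W i) x]hformC mulJ.
  rewrite /hq E /= ltr_pwDl //; apply: sumr_ge0 => i _.
  by rewrite exprn_ge0 ?nc_ge0.
have [x' x'0 x'W] := negative_orthogonal W ks.
have Hy0 : H y y != 0 by rewrite hqE eq_complex /= gt_eqF.
pose y' : V := x' - \sum_i H x' (U i) *: U i - (H x' y / H y y) *: y.
have y'U j : H y' (U j) = 0.
  rewrite /y' !hformBl hformZl yU mulr0 subr0 hform_suml.
  rewrite (eq_bigr (fun i => H x' (U i) * (i == j)%:R)) ?delta ?subrr //.
  by move=> i _; rewrite hformZl UU.
have y'W j : H y' (W j) = 0.
  rewrite /y' !hformBl hformZl yW mulr0 subr0 hform_suml x'W big1 ?subrr // => i _.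
  by rewrite hformZl UW mulr0.
have y'y : H y' y = 0.
  rewrite /y' !hformBl hformZl hform_suml big1 => [|i _]; last first.
    by rewrite hformZl (hform_eq0C (yU i)) mulr0.
  by rewrite subr0 divfK // subrr.
have y'0 : hq y' < 0.
  have E : H y' y' = (hq x' - \sum_i nc (H x' (U i)) ^+ 2
      - nc (H x' y) ^+ 2 / hq y)%:C%C.
    rewrite {2}/y' !hformBr hformZr y'y mulr0 subr0 hform_sumr big1 => [|i _]; last first.
      by rewrite hformZr y'U mulr0.
    rewrite subr0 /y' !hformBl hform_suml hformZl !rmorphB rmorph_sum /= hqE.
    congr (_ - _ - _).
      by apply: eq_bigr => i _; rewrite hformZl [H (U i) x']hformC mulJ.
    by rewrite rmorphM fmorphV /= -mulJ hqE (hformC x' y); ring.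
  have S0 : 0 <= \sum_i nc (H x' (U i)) ^+ 2.
    by apply: sumr_ge0 => i _; rewrite exprn_ge0 ?nc_ge0.
  have T0 : 0 <= nc (H x' y) ^+ 2 / hq y by rewrite divr_ge0 ?exprn_ge0 ?nc_ge0 // ltW.
  by rewrite /hq E /=; lra.
pose m : V := (Num.sqrt (hq y))^-1%:C%C *: y.
pose l : V := (Num.sqrt (- hq y'))^-1%:C%C *: y'.
have qm : hq m = 1.
  rewrite hqZ nc_real ger0_norm ?invr_ge0 ?sqrtr_ge0 // exprVn sqr_sqrtr ?ltW //.
  by rewrite mulVf // gt_eqF.
have ql : hq l = -1.
  have : 0 < - hq y' by rewrite oppr_gt0.
  move=> h; rewrite hqZ nc_real ger0_norm ?invr_ge0 ?sqrtr_ge0 // exprVn sqr_sqrtr ?ltW //.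
  by field; rewrite lt_eqF.
have lm : H l m = 0 by rewrite hformZl hformZr y'y !mulr0.
have ml : H m l = 0 by exact: hform_eq0C.
have mU j : H m (U j) = 0 by rewrite hformZl yU mulr0.
have mW j : H m (W j) = 0 by rewrite hformZl yW mulr0.
have lU j : H l (U j) = 0 by rewrite hformZl y'U mulr0.
have lW j : H l (W j) = 0 by rewrite hformZl y'W mulr0.
exists (m + l), (2^-1 *: (m - l)).
have Em i (ik : (i < k)%N) z : H z (U (Ordinal ik)) = 0 -> H z (W (Ordinal ik)) = 0 ->
    H z (e i) = 0 /\ H z (f i) = 0.
  rewrite /U /W /= hformDr hformBr !hformZr h2 => h3 h4.
  have he : H z (e i) = 0.
    have -> : H z (e i) = 2^-1 * ((H z (e i) + 2^-1 * H z (f i)) + (H z (e i) - 2^-1 * H z (f i))).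
      by field.
    by rewrite h3 h4 addr0 mulr0.
  split=> //; move: h3; rewrite he add0r => /eqP; rewrite mulf_eq0 invr_eq0 pnatr_eq0 /=.
  by move/eqP.
split.
- by rewrite hqD qm ql ml raddf0 mulr0 addr0 subrr.
- by rewrite hqZ hqD hqN hformNr qm ql ml oppr0 raddf0 mulr0 addr0 subrr mulr0.
- rewrite hformZr h2 hformDl !hformBr lm ml subr0 sub0r !hqE qm ql rmorphN rmorph1 opprK.
  by rewrite mulrDr mulr1 hh.
move=> i ik; have [a1 a2] := Em i ik (m + l)
  ltac:(by rewrite hformDl mU lU addr0) ltac:(by rewrite hformDl mW lW addr0).
have [a3 a4] := Em i ik (2^-1 *: (m - l))
  ltac:(by rewrite hformZl hformBl mU lU subr0 mulr0)
  ltac:(by rewrite hformZl hformBl mW lW subr0 mulr0).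
by [].
Qed.

Lemma frame_snoc k e f u v : frame k e f -> hq u = 0 -> hq v = 0 -> H u v = 1 ->
  (forall i, (i < k)%N -> [/\ H u (e i) = 0, H u (f i) = 0, H v (e i) = 0 & H v (f i) = 0]) ->
  frame k.+1 (fun i => if (i < k)%N then e i else u) (fun i => if (i < k)%N then f i else v).
Proof.
move=> F u0 v0 uv O i j; rewrite !ltnS => ik jk.
case: ltnP => ik'; case: ltnP => jk'.
- exact: F.
- have [h1 h2 h3 h4] := O i ik'.
  by rewrite ltn_eqF ?(leq_trans ik' jk') //; split; apply: hform_eq0C.
- have [h1 h2 h3 h4] := O j jk'.
  by rewrite gtn_eqF ?(leq_trans jk' ik') //; split.
- have -> : i = k by apply/eqP; rewrite eqn_leq ik ik'.
  have -> : j = k by apply/eqP; rewrite eqn_leq jk jk'.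
  by rewrite eqxx !hqE u0 v0.
Qed.

Lemma frame_complete k e f : frame k e f -> (k <= r)%N -> (r <= s)%N ->
  exists e' f', frame r e' f' /\ forall i, (i < k)%N -> e' i = e i /\ f' i = f i.
Proof.
move=> F kr rs.
suff G d : (k + d <= r)%N -> exists e' f', frame (k + d) e' f' /\
    forall i, (i < k)%N -> e' i = e i /\ f' i = f i.
  by have := G (r - k)%N; rewrite subnKC // => /(_ (leqnn _)).
elim: d => [|d IH]; first by rewrite addn0 => _; exists e, f.
rewrite addnS => kd; have [e' [f' [F' E]]] := IH (ltnW kd).
have [u [v [u0 v0 uv O]]] := frame_extend F' kd (leq_trans kd rs).
eexists; eexists; split; first exact: (frame_snoc F' u0 v0 uv O).
by move=> i ik /=; rewrite (leq_trans ik (leq_addr d k)); exact: E.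
Qed.

Lemma frame_partner k e f p : frame k e f -> p != 0 -> hq p = 0 ->
  (forall i, (i < k)%N -> H p (e i) = 0 /\ H p (f i) = 0) ->
  exists q, [/\ hq q = 0, H p q = 1 & forall i, (i < k)%N -> H q (e i) = 0 /\ H q (f i) = 0].
Proof.
move=> F pn p0 O; have [y0 y0p] := hform_nondeg pn.
pose y : V := y0 - \sum_(i < k) (H y0 (f i) *: e i + H y0 (e i) *: f i).
have yp : H y p = 1.
  rewrite /y hformBl y0p hform_suml big1 ?subr0 // => i _.
  have [h1 h2] := O i (ltn_ord i).
  by rewrite hformDl !hformZl (hform_eq0C h1) (hform_eq0C h2) !mulr0 addr0.
have delta (F0 : 'I_k -> C) j : \sum_i F0 i * (i == j)%:R = F0 j.
  by rewrite (bigD1 j) //= big1 ?addr0 => [|i /negPf ->]; rewrite ?eqxx ?mulr1 ?mulr0.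
have ye j : (j < k)%N -> H y (e j) = 0 /\ H y (f j) = 0.
  move=> jk; split; rewrite /y hformBl hform_suml.
    rewrite (eq_bigr (fun i : 'I_k => H y0 (e i) * (i == Ordinal jk)%:R)).
      by rewrite delta subrr.
    move=> i _; have [h1 _ _] := F i j (ltn_ord i) jk.
    by rewrite hformDl !hformZl h1 (frameC F) // mulr0 add0r.
  rewrite (eq_bigr (fun i : 'I_k => H y0 (f i) * (i == Ordinal jk)%:R)).
    by rewrite delta subrr.
  move=> i _; have [_ h1 h2] := F i j (ltn_ord i) jk.
  by rewrite hformDl !hformZl h1 h2 mulr0 addr0.
clearbody y.
have [a ha] := nullify p0 yp.
exists (y + a *: p); split=> //.
  by rewrite hformC hformDl hformZl hqE p0 mulr0 addr0 yp rmorph1.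
move=> i ik; have [h1 h2] := O i ik; have [h3 h4] := ye i ik.
by rewrite !hformDl !hformZl h1 h2 h3 h4 !mulr0 addr0.
Qed.

Lemma frame_at p : p != 0 -> hq p = 0 -> (0 < r)%N -> (r <= s)%N ->
  exists e f, frame r e f /\ e 0%N = p.
Proof.
move=> pn p0 r0 rs.
have [q [q0 pq _]] := @frame_partner 0 (fun=> 0) (fun=> 0) p ltac:(by []) pn p0 ltac:(by []).
have F : frame 1 (fun=> p) (fun=> q).
  by move=> [|//] [|//] _ _; rewrite !hqE p0 q0 pq.
have [e' [f' [F' E]]] := frame_complete F r0 rs.
by exists e', f'; split=> //; have [] := E 0%N.
Qed.

Lemma frame_at3 p z w : p != 0 -> hq p = 0 -> hq z = 0 -> hq w = 0 -> H p z = 0 ->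
  H p w = 0 -> H z w = 1 -> (1 < r)%N -> (r <= s)%N ->
  exists e f, [/\ frame r e f, e 0%N = p, e 1%N = z & f 1%N = w].
Proof.
move=> pn p0 z0 w0 pz pw zw r1 rs.
have F1 : frame 1 (fun=> z) (fun=> w).
  by move=> [|//] [|//] _ _; rewrite !hqE z0 w0 zw.
have [q [q0 pq O]] := @frame_partner 1 _ _ p F1 pn p0 ltac:(by []).
have [qz qw] := O 0%N (ltn0Sn 0).
have F : frame 2 (fun i => if i == 0%N then p else z) (fun i => if i == 0%N then q else w).
  move=> [|[|//]] [|[|//]] _ _ /=; rewrite ?hqE ?p0 ?q0 ?z0 ?w0 ?pq ?zw ?pz ?pw ?qz ?qw;
    rewrite ?(hform_eq0C pz) ?(hform_eq0C qz) ?(hform_eq0C qw) //.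
have [e' [f' [F' E]]] := frame_complete F r1 rs.
exists e', f'; split=> //; first by have [] := E 0%N.
  by have [] := E 1%N.
by have [] := E 1%N.
Qed.

End Frames.

(** * The form pulled back by a local lift *)

Section NullLines.
Variables (R : realType) (r s : nat).
Local Notation C := R[i].
Local Notation I' := ('i%C : C).
Local Notation V := ('rV[C]_(r + s + 0)).
Local Notation H := (@hform R r s 0).
Implicit Types (p u v w x y z e : V) (a b : R).

(** Normalized so that, for null [e] with [H e z != 0], the form at [z + (s * null_shift z e) *: e]
    is [hq z * (1 - Re s)]: the null points are those with [Re s = 1], which contains a side of the
    unit square. *)
Definition null_shift z e : C := - (hq z)%:C%C / (2 * H e z).

(* The complex line through [z] in a null direction [e] meets the null cone in a real line. *)
Lemma null_shift_null z e b : hq e = 0 -> H e z != 0 ->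
  hq (z + pt 1 b *: (null_shift z e *: e)) = 0.
Proof.
move=> e0 ez; rewrite scalerA hqD hqZ e0 mulr0 addr0 hformZr.
have ez' : H z e != 0 by exact: hform_neq0C.
have -> : (pt 1 b * null_shift z e)^* * H z e = (hq z)%:C%C * (- 2^-1) * (pt 1 b)^*.
  rewrite /null_shift !rmorphM rmorphN fmorphV rmorphM rmorph_nat /= [H z e](hformC e z).
  have -> : ((hq z)%:C%C)^* = (hq z)%:C%C :> C by rewrite conjE conjc_real.
  by field; rewrite fmorph_eq0.
have -> : (2^-1 : C) = (2^-1 : R)%:C%C by rewrite fmorphV rmorph_nat.
by rewrite conjE -rmorphN -rmorphM /=; field.
Qed.

Lemma null_shift_le z e a b : -1 <= a <= 1 -> -1 <= b <= 1 ->
  nr (pt a b *: (null_shift z e *: e)) <= `|hq z| / nc (H e z) * nr e.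
Proof.
move=> ha hb; rewrite !nrZ mulrA ler_wpM2r ?nr_ge0 //.
rewrite /null_shift ncM ncN nc_real ncV ncM.
have -> : nc (2 : C) = 2.
  have -> : (2 : C) = (2 : R)%:C%C by rewrite rmorph_nat.
  by rewrite nc_real ger0_norm.
rewrite invfM mulrCA; apply: ler_wpM2l; first by rewrite normr_ge0.
rewrite mulrA ler_piMl ?invr_ge0 ?nc_ge0 //.
by rewrite ler_pdivrMr // mul1r; have := @nc_pt_le R a b 1; rewrite mulr1; apply; rewrite ler_norml.
Qed.

End NullLines.

Section LocalMap.
Variables (R : realType) (r s r' s' t' : nat).
Local Notation C := R[i].
Local Notation I' := ('i%C : C).
Local Notation V := ('rV[C]_(r + s + 0)).
Local Notation V' := ('rV[C]_(r' + s' + t')).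
Local Notation H := (@hform R r s 0).
Local Notation H' := (@hform R r' s' t').
Implicit Types (p u v w x z : V) (a b t d : R).
Variables (G : V -> V') (A : V -> 'M[C]_(r + s + 0, r' + s' + t')) (c0 : V) (rho : R).
Hypothesis rho0 : 0 < rho.
Hypothesis dG : forall x, nr (x - c0) < rho -> gder G x (A x).
Hypothesis Gnull : forall x, nr (x - c0) < rho -> hq x = 0 -> hq (G x) = 0.

Definition pulled_form z w : C := H' (G z) (G w).
Local Notation K := pulled_form.

Lemma KC z w : K w z = (K z w)^*.
Proof. exact: hformC. Qed.

Lemma K_eq0C z w : K z w = 0 -> K w z = 0.
Proof. exact: hform_eq0C. Qed.

Lemma K_lholo z w : nr (z - c0) < rho -> lholo (fun x => K x w) z.
Proof. by move=> /dG hz; exact: gder_hform hz. Qed.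

Lemma ray_K x u (y : V') : nr (x - c0) < rho -> forall e, 0 < e -> exists2 d, 0 < d &
  forall t, 0 < t < d ->
    nc (H' (G (x + t%:C%C *: u)) y - H' (G x) y - t%:C%C * H' (u *m A x) y) <= e * t.
Proof.
move=> hx e e0; have nu := nr_ge0 u; have ny := nr_ge0 y.
have nuy : 0 <= nr u * nr y by rewrite mulr_ge0.
have e1 : 0 < e / (nr u * nr y + 1) by rewrite divr_gt0 //; lra.
have [d d0 Hd] := dG hx e1.
exists (d / (nr u + 1)); first by rewrite divr_gt0 //; lra.
move=> t /andP[t0]; rewrite ltr_pdivlMr; last by lra.
move=> td.
have nt : nr (t%:C%C *: u) = t * nr u by rewrite nrZ nc_real gtr0_norm.
have := Hd (t%:C%C *: u); rewrite nt => /(_ ltac:(lra)) h.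
rewrite -hformZl -!hformBl; apply: le_trans (hform_le _ _) _.
rewrite scalemxAl; apply: le_trans (ler_wpM2r ny h) _.
have -> : e / (nr u * nr y + 1) * (t * nr u) * nr y =
   e * t * (nr u * nr y / (nr u * nr y + 1)) by ring.
apply: ler_piMr; first by rewrite mulr_ge0 // ltW.
by rewrite ler_pdivrMr; lra.
Qed.

(* Polarization along the null line through [z] and [w]: [w - conj s v] is the mirror image of
   [z + s v] in the perpendicular bisector [Re s = 1]. *)
Lemma K_null_orth z w : nr (z - c0) < rho / 4 -> nr (w - c0) < rho / 4 ->
  hq z = 0 -> hq w = 0 -> H z w = 0 -> K z w = 0.
Proof.
have rp := rho0.
move=> hz hw z0 w0 zw.
have [v Ev] : exists v : V, v = (2^-1 : C) *: (w - z) by eexists.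
have nv : 2 * nr v < rho / 2.
  rewrite Ev nrZ ncV.
  have -> : nc (2 : C) = 2.
    have -> : (2 : C) = (2 : R)%:C%C by rewrite rmorph_nat.
    by rewrite nc_real ger0_norm.
  have : nr (w - z) < rho / 2 by apply: (ball_dist hw hz); lra.
  by rewrite mulrA mulfV ?mul1r // pnatr_eq0.
have np a b : -1 <= a <= 1 -> -1 <= b <= 1 -> nr (pt a b *: v) < rho / 2.
  move=> ha hb; rewrite nrZ; apply: le_lt_trans nv; rewrite ler_wpM2r ?nr_ge0 //.
  by have := @nc_pt_le R a b 1; rewrite mulr1; apply; rewrite ler_norml.
have inz a b : -1 <= a <= 1 -> -1 <= b <= 1 -> nr (z + pt a b *: v - c0) < rho.
  by move=> ha hb; apply: (ball_shift hz (ltW (np a b ha hb))); lra.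
have inw a b : -1 <= a <= 1 -> -1 <= b <= 1 -> nr (w + - pt a b *: v - c0) < rho.
  move=> ha hb; have h : nr (- pt a b *: v) < rho / 2 by rewrite scaleNr nrN; exact: np.
  by apply: (ball_shift hw (ltW h)); lra.
have cj (b : C) : (b^*)%C = (b^*)%R by [].
have := @one_side_zero R (fun s => H' (G (z + s *: v)) (G (w + - (s^*)%C *: v))).
rewrite scale0r (conjc0 R) oppr0 scale0r !addr0; apply.
  move=> a b ha hb; apply: cdiff_sum => j; apply: cdiffM.
    apply: cdiffM; first exact: cdiff_cst.
    apply: (@lholo_line _ _ (fun y => G y 0 j)); apply: gder_coord; exact: dG (inz a b ha hb).
  apply: (@cdiff_conj R (fun s : C => G (w + - s *: v) 0 j)).
  have -> : (fun s : C => G (w + - s *: v) 0 j) = (fun s : C => G (w + s *: (- v)) 0 j).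
    by apply/funext => c; rewrite scaleNr scalerN.
  apply: (@lholo_line _ _ (fun y => G y 0 j)); apply: gder_coord.
  have -> : ((pt a b)^*)%C = pt a (- b) by [].
  by rewrite scalerN -scaleNr; apply: dG; apply: inw => //; lra.
move=> b hb.
have v0 : hq v = 0.
  by rewrite Ev hqZ hqD hqN hformNr (hform_eq0C zw) z0 w0 oppr0 cRe0 mulr0 !addr0 mulr0.
have zv : H z v = 0 by rewrite Ev hformZr hformBr zw hqE z0 subrr mulr0.
have -> : w + - ((pt 1 b)^*)%C *: v = z + pt 1 b *: v.
  have -> : w = z + 2 *: v by rewrite Ev scalerA mulfV ?scale1r ?pnatr_eq0 // addrC subrK.
  rewrite -addrA -scalerDl; congr (_ + _ *: _).
  by apply/eqP; rewrite eq_complex /=; apply/andP; split; apply/eqP; ring.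
rewrite hqE Gnull //; first by apply: inz => //; lra.
by rewrite hqD hqZ v0 hformZr zv z0 !mulr0 !addr0.
Qed.

(** The point [z = p + t u] need not be null, but a null direction [e], orthogonal to [w] and
    transversal to the cone at [p], leads from it back to the cone within the hyperplane orthogonal
    to [w]. Polarization on one side of a square and [line_zero] give [K z w = 0] for all small
    [t > 0], hence the derivative vanishes. *)
Lemma dK_orth p w u : nr (p - c0) < rho / 8 -> nr (w - c0) < rho / 4 ->
  hq p = 0 -> hq w = 0 -> H p w = 0 -> p != 0 -> w != 0 -> (forall c, p != c *: w) ->
  H u w = 0 -> H' (u *m A p) (G w) = 0.
Proof.
have rp := rho0.
move=> hp hw p0 w0 pw pn wn indep uw.
have [e [e0 ew ep]] := null_dual2 pn wn indep p0 w0 pw.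
apply/eqP; rewrite -nc_eq0 eq_le nc_ge0 andbT.
have Kp : K p w = 0 by apply: K_null_orth => //; lra.
have [B EB] : exists B, B = 1 + nr u + nr e + `|hq u| + nc (H p u) + nc (H e u) by eexists.
have [? ? ? ? ?] : [/\ 0 <= nr u, 0 <= nr e, 0 <= `|hq u|, 0 <= nc (H p u) & 0 <= nc (H e u)].
  by split; rewrite ?nr_ge0 ?nc_ge0.
have B1 : 1 <= B by rewrite EB; lra.
have [Bu Be Bq Bp Beu] : [/\ nr u <= B, nr e <= B, `|hq u| <= B, nc (H p u) <= B & nc (H e u) <= B].
  by rewrite EB; split; lra.
clear EB.
(* The first bound on [t] keeps [nc (H e z)] above [1 / 2], so the null shift moves by at most
   [6 * t * B ^ 2]; the second keeps the whole square in the ball where polarization applies. *)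
have [d1 Ed1] : exists d1, d1 = Num.min (1 / (2 * B)) (rho / (64 * B ^+ 2)) by eexists.
have B20 : 0 < B ^+ 2 by rewrite exprn_gt0 //; lra.
have d10 : 0 < d1 by rewrite Ed1 lt_min !divr_gt0 //; lra.
apply: (@ray_derivative_bound R (fun t => K (p + t%:C%C *: u) w) _ 0 d1) => //.
  move=> ee ee0; have [d d0 Hd] := @ray_K p u (G w) ltac:(lra) ee ee0.
  by exists d => // t /Hd; rewrite -/(K p w) Kp subr0.
move=> t /andP[t0]; rewrite Ed1 lt_min ltr_pdivlMr; last by lra.
rewrite ltr_pdivlMr; last by lra.
move=> /andP[t1 t2]; clear d1 Ed1 d10.
have tt2 : t * B * (64 * B) < rho by rewrite expr2 in t2; lra.
have tB : 0 <= t * B by rewrite mulr_ge0 ?(ltW t0) // (le_trans ler01).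
have tuB : t * nr u <= t * B by rewrite ler_wpM2l // ltW.
have tB2 : t * B <= t * B * B by rewrite ler_peMr.
rewrite mul0r (_ : K _ w = 0) ?nc0 //.
have [z Ez] : exists z, z = p + t%:C%C *: u by eexists.
rewrite -Ez.
have zw : H z w = 0 by rewrite Ez hformDl hformZl pw uw mulr0 addr0.
have ntu : nr (t%:C%C *: u) = t * nr u by rewrite nrZ nc_real gtr0_norm.
have hz : nr (z - c0) < rho / 8 + t * B.
  by rewrite Ez; apply: (ball_shift hp (b := t * B)); rewrite ?ntu.
have ez : 2^-1 < nc (H e z).
  have E : nc ((t%:C%C)^* * H e u) = t * nc (H e u).
    by rewrite ncM nc_conjC nc_real gtr0_norm.
  rewrite Ez hformDr ep hformZr; have := nc_sub_ge 1 (- ((t%:C%C)^* * H e u)).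
  rewrite opprK ncN E nc1.
  have : t * nc (H e u) <= t * B by rewrite ler_wpM2l // ltW.
  lra.
have ez0 : H e z != 0 by rewrite -nc_gt0; apply: lt_trans ez; rewrite invr_gt0.
have qz : `|hq z| <= 3 * (t * B).
  have h1 : `|complex.Re (H p (t%:C%C *: u))| <= t * B.
    apply: le_trans (nc_ge_Re _) _; rewrite hformZr ncM nc_conjC nc_real gtr0_norm //.
    by rewrite ler_wpM2l // ltW.
  have h2 : t ^+ 2 * `|hq u| <= t * B.
    rewrite expr2 -mulrA ler_wpM2l ?(ltW t0) //.
    apply: (le_trans (ler_wpM2l (ltW t0) Bq)); lra.
  have h3 : `|t ^+ 2 * hq u| <= t * B.
    by rewrite normrM [`|t ^+ 2|]ger0_norm ?exprn_ge0 ?(ltW t0).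
  have E : hq z = t ^+ 2 * hq u + 2 * complex.Re (H p (t%:C%C *: u)).
    by rewrite Ez hqD p0 add0r hqZ nc_real gtr0_norm.
  move: h1 h3; rewrite E; move: (complex.Re _) (t ^+ 2 * hq u) (t * B) => x1 x2 x3.
  by rewrite !ler_norml; lra.
have ns : `|hq z| / nc (H e z) * nr e <= 6 * (t * B * B).
  have h1 : `|hq z| / nc (H e z) <= 6 * (t * B).
    rewrite ler_pdivrMr ?nc_gt0 //.
    apply: le_trans qz _.
    have -> : 3 * (t * B) = 6 * (t * B) * 2^-1 by field.
    by apply: ler_wpM2l; [exact: mulr_ge0|exact: ltW].
  have -> : 6 * (t * B * B) = 6 * (t * B) * B by ring.
  by apply: ler_pM; rewrite ?divr_ge0 ?nc_ge0.
clear B1 Bu Be Bq Bp Beu B20 t1 t2 tuB qz ez hp.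
have inb a b : -1 <= a <= 1 -> -1 <= b <= 1 ->
    nr (z + pt a b *: (null_shift z e *: e) - c0) < rho / 4.
  move=> ha hb; apply: (ball_shift hz (b := 6 * (t * B * B))); last by lra.
  exact: le_trans (null_shift_le z e ha hb) ns.
apply: (@line_zero _ _ (fun x => K x w) z (null_shift z e *: e)).
  by move=> a b ha hb; apply: K_lholo; have := inb a b ha hb; lra.
move=> b hb; apply: K_null_orth => //.
- by apply: inb => //; apply/andP; split; [lra|].
- exact: null_shift_null.
- by rewrite hformDl !hformZl zw ew !mulr0 addr0.
Qed.

End LocalMap.

(** * A null point where the lift is transversal to the null cone *)

Section Planes.
Variables (R : realType) (r s : nat).
Local Notation C := R[i].
Local Notation I' := ('i%C : C).
Local Notation V := ('rV[C]_(r + s + 0)).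
Local Notation H := (@hform R r s 0).
Implicit Types (a b d y : R).

(** The square centered at [t] with half side [Re t] has a side on the imaginary axis. Its points
    have modulus at most [3 |t|], which the radius [4 * d] accommodates. *)
Lemma plane_zero n (f : 'rV[C]_n -> C) (p q : 'rV[C]_n) d :
  (forall t : C, nc t < 4 * d -> lholo f (p + t *: q)) ->
  (forall y, `|y| < 4 * d -> f (p + (I' * y%:C%C) *: q) = 0) ->
  forall t : C, nc t < d -> f (p + t *: q) = 0.
Proof.
move=> df f0 t td; have nt := nc_ge0 t.
have Rt := nc_ge_Re t; have It := nc_ge_Im t.
have E (c : C) : p + t *: q + c *: (- (complex.Re t)%:C%C *: q) =
    p + (t - c * (complex.Re t)%:C%C) *: q.
  by rewrite -addrA; congr (_ + _); rewrite scalerA -scalerDl; congr (_ *: _); ring.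
apply: (@line_zero _ _ f _ (- (complex.Re t)%:C%C *: q)) => [a b ha hb|b hb]; rewrite E.
  apply: df; apply: le_lt_trans (ncB _ _) _; rewrite ncM nc_real.
  have : nc (pt a b) <= 2 by have := @nc_pt_le R a b 1; rewrite mulr1; apply; rewrite ler_norml.
  move=> h2; have : nc (pt a b) * `|complex.Re t| <= 2 * nc t.
    by apply: ler_pM => //; exact: nc_ge0.
  lra.
have -> : t - pt 1 b * (complex.Re t)%:C%C = I' * (complex.Im t - b * complex.Re t)%:C%C.
  by rewrite ptE; case: t {td nt Rt It E} => x y; apply/eqP; rewrite eq_complex /=;
     apply/andP; split; apply/eqP; ring.
apply: f0; have : `|b * complex.Re t| <= nc t.
  rewrite normrM; apply: le_trans (_ : 1 * `|complex.Re t| <= _); last by rewrite mul1r.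
  by rewrite ler_wpM2r // ler_norml.
by move=> h; apply: le_lt_trans (ler_normB _ _) _; lra.
Qed.

Variables (e f : nat -> V).
Hypothesis F : frame r e f.
Hypothesis r0 : (0 < r)%N.
Variable ep : R.
Hypothesis ep0 : ep != 0.

(** The points [e 0 + ep e i] tend to [e 0] with [ep], so that all [r] planes come close to the same
    null point. [plane_dir] is the dual family, whence the factor [ep^-1] and the correction in
    index 0. *)
Definition plane_pt (i : nat) : V := if i == 0%N then e 0%N else e 0%N + ep%:C%C *: e i.
Definition plane_dir (i : nat) : V := if i == 0%N then
  f 0%N - ep^-1%:C%C *: \sum_(j < r | val j != 0%N) f j else ep^-1%:C%C *: f i.

Lemma realJ (x : R) : (x%:C%C)^* = x%:C%C :> C.
Proof. by rewrite conjE conjc_real. Qed.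

Lemma plane_pp i j : (i < r)%N -> (j < r)%N -> H (plane_pt i) (plane_pt j) = 0.
Proof.
move=> ir jr; have h := F; rewrite /plane_pt.
have [h1 _ _] := F r0 r0; have [h2 _ _] := F r0 jr; have [h3 _ _] := F ir r0.
have [h4 _ _] := F ir jr.
by case: eqP => _; case: eqP => _; rewrite ?(hformDl, hformDr, hformZl, hformZr) ?h1 ?h2 ?h3 ?h4
  ?mulr0 ?addr0 ?mulr0.
Qed.

Lemma plane_qq i j : (i < r)%N -> (j < r)%N -> H (plane_dir i) (plane_dir j) = 0.
Proof.
have ff k l : (k < r)%N -> (l < r)%N -> H (f k) (f l) = 0 by move=> kr lr; have [] := F kr lr.
have E k0 : (k0 < r)%N -> exists c : 'I_r -> C, plane_dir k0 = \sum_k c k *: f k.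
  move=> kr; rewrite /plane_dir; case: eqP => [_|_].
    exists (fun k => if val k == 0%N then 1 else - ep^-1%:C%C).
    rewrite [RHS](bigID (fun k : 'I_r => val k == 0%N)) /=; congr (_ + _).
      rewrite (big_pred1 (Ordinal r0)) /= ?scale1r //.
    rewrite scaler_sumr -sumrN; apply: eq_bigr => k /negPf ->.
    by rewrite scaleNr.
  exists (fun k => if val k == k0 then ep^-1%:C%C else 0).
  rewrite (bigD1 (Ordinal kr)) //= eqxx big1 ?addr0 // => k ki.
  by rewrite (_ : (val k == k0) = false) ?scale0r //; apply/negP => /eqP h; move/eqP: ki; apply;
     apply: val_inj.
move=> ir jr; have [c ->] := E i ir; have [c' ->] := E j jr.
rewrite hform_suml big1 // => k _; rewrite hform_sumr big1 // => l _.
by rewrite hformZl hformZr ff // !mulr0.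
Qed.

Lemma plane_pq i j : (i < r)%N -> (j < r)%N -> H (plane_pt i) (plane_dir j) = (i == j)%:R.
Proof.
move=> ir jr.
have ef k l : (k < r)%N -> (l < r)%N -> H (e k) (f l) = (k == l)%:R.
  by move=> kr lr; have [] := F kr lr.
have epC : ep%:C%C != 0 :> C by rewrite eq_complex /= (negPf ep0).
have es k : (k < r)%N -> H (e k) (\sum_(l < r | val l != 0%N) f l) = (k != 0%N)%:R.
  move=> kr; rewrite hform_sumr.
  rewrite (eq_bigr (fun l : 'I_r => (k == val l)%:R)); last by move=> l _; rewrite ef.
  case: (eqVneq k 0%N) => [->|k0].
    by rewrite big1 // => l /negPf; rewrite eq_sym => ->.
  rewrite (bigD1 (Ordinal kr)) //= eqxx big1 ?addr0 // => l /andP[_ lk].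
  by rewrite (_ : (k == val l) = false) //; apply/negP => /eqP h; move/eqP: lk; apply; apply: val_inj.
rewrite /plane_pt /plane_dir.
case: (eqVneq i 0%N) => [i0|i0]; case: (eqVneq j 0%N) => [j0|j0].
- by rewrite i0 j0 hformBr hformZr es // ef // mulr0 subr0.
- rewrite hformZr ef // i0 eq_sym (negPf j0) mulr0 //.
- rewrite j0 (negPf i0) hformDl !hformBr !hformZl !hformZr !es // !ef // eqxx (negPf i0) realJ fmorphV /=.
  by field.
- rewrite hformDl hformZl !hformZr !ef // [0%N == j]eq_sym (negPf j0) mulr0 add0r realJ.
  by rewrite mulrA -rmorphM /= mulfV // rmorph1 mul1r.
Qed.

(** Lines with different indices are orthogonal point by point. On a single line the form at
    parameter [a] is [2 Re a]: the imaginary axis is null and the right half plane positive, the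
    setting of Hopf's lemma. *)
Lemma plane_hform i j (a b : C) : (i < r)%N -> (j < r)%N ->
  H (plane_pt i + a *: plane_dir i) (plane_pt j + b *: plane_dir j) =
  (i == j)%:R * (b^* + a).
Proof.
move=> ir jr.
rewrite !(hformDl, hformDr, hformZl, hformZr) plane_pp // plane_qq // plane_pq //.
rewrite [H (plane_dir i) _]hformC plane_pq // rmorph_nat [j == i]eq_sym.
by ring.
Qed.

End Planes.

Section Transversal.
Variables (R : realType) (r s r' s' t' : nat).
Local Notation C := R[i].
Local Notation I' := ('i%C : C).
Local Notation V := ('rV[C]_(r + s + 0)).
Local Notation V' := ('rV[C]_(r' + s' + t')).
Local Notation H := (@hform R r s 0).
Local Notation H' := (@hform R r' s' t').


(* Without two orthogonal positive vectors the target behaves like Lorentzian space. *)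
Lemma lorentz_ratio (Sp : V' -> Prop) (y n0 n1 : V') :
  (forall (c : C) a b, Sp a -> Sp b -> Sp (c *: a + b)) ->
  ~ (exists a b, [/\ Sp a, Sp b, H' a b = 0 & 0 < hq a /\ 0 < hq b]) ->
  Sp y -> Sp n0 -> Sp n1 -> hq n0 = 0 -> hq n1 = 0 -> H' n0 n1 != 0 -> 0 < hq y ->
  0 < complex.Re (H' y n0 / (H' y n1 * (H' n0 n1)^*)).
Proof.
move=> SL nex Sy S0 S1 q0 q1; set k := H' n0 n1 => k0 y0.
set al := H' y n1; set be := H' y n0.
have k0' : k^* != 0 by rewrite fmorph_eq0.
have n10 : H' n1 n0 = k^* by rewrite hformC.
have Z0 : Sp 0 by have := SL (-1) _ _ Sy Sy; rewrite scaleN1r addNr.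
have SZ (c : C) v : Sp v -> Sp (c *: v) by move=> Sv; rewrite -[_ *: _]addr0; exact: SL.
(* [w] is [y] projected off the hyperbolic plane of [n0] and [n1], which contains the positive
   vector [m]. If the real part were nonpositive, [hq w >= hq y] would make [w] a positive vector
   orthogonal to [m]. *)
pose w : V' := y - (al / k) *: n0 - (be / k^*) *: n1.
have Sw : Sp w.
  by rewrite /w -!scaleNr addrC; apply: (SL) => //; rewrite addrC; apply: (SL).
have wn0 : H' w n0 = 0.
  by rewrite /w !hformBl !hformZl hqE q0 n10 mulr0 subr0 divfK // subrr.
have wn1 : H' w n1 = 0.
  by rewrite /w !hformBl !hformZl hqE q1 -/k mulr0 subr0 divfK // subrr.
have wq : hq w = hq y - 2 * complex.Re (be * al^* / k^*).
  have -> : hq w = complex.Re (H' w y).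
    by rewrite /hq {2}/w !hformBr !hformZr wn0 wn1 !mulr0 !subr0.
  rewrite /w !hformBl !hformZl (hformC y n0) (hformC y n1) -/al -/be hqE !raddfB /=.
  have -> : al / k * be^* = (be * al^* / k^*)^*.
    by rewrite !rmorphM fmorphV /= !conjCK; ring.
  have -> : be / k^* * al^* = be * al^* / k^* by ring.
  by rewrite conjE; case: (be * al^* / k^*) => a b /=; lra.
pose m : V' := k *: n1 + n0.
have Sm : Sp m by exact: SL.
have mq : hq m = 2 * nc k ^+ 2.
  rewrite hqD hqZ q1 q0 hformZl n10 mulJ_nc; ring.
have m0 : 0 < hq m by rewrite mq mulr_gt0 ?exprn_gt0 ?nc_gt0.
have wm : H' w m = 0 by rewrite /m hformDr hformZr wn0 wn1 mulr0 addr0.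
have pos : 0 < complex.Re (be * al^* / k^*).
  rewrite ltNge; apply/negP => le0; apply: nex; exists w, m; split=> //; split=> //.
  by rewrite wq; lra.
have al0 : al != 0.
  by apply/eqP => E; move: pos; rewrite E rmorph0 mulr0 mul0r ltxx.
have -> : be / (al * k^*) = (nc al ^+ 2)^-1%:C%C * (be * al^* / k^*).
  have E : al * al^* = (nc al ^+ 2)%:C%C.
    by rewrite conjE nc_sqr; case: (al) => p q; apply/eqP; rewrite eq_complex /=;
       apply/andP; split; apply/eqP; ring.
  rewrite fmorphV /= -E; field; rewrite al0 k0' fmorph_eq0 al0 //.
move: pos; case: (be * al^* / k^*) => p q /= pos.
by rewrite mul0r subr0 mulr_gt0 // invr_gt0 exprn_gt0 // nc_gt0.
Qed.

Lemma hopf_ratio (num den : C -> C) (d : R) : 0 < d ->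
  (forall t : C, nc t < d -> cdiff num t /\ cdiff den t) -> den 0 != 0 ->
  (forall t : C, nc t < d -> 0 < complex.Re t -> 0 < complex.Re (num t / den t)) ->
  exists c e, [/\ 0 < c, 0 < e & forall x, 0 < x < e -> c * x <= nc (num x%:C%C)].
Proof.
move=> d0 df k0 pos.
have nk : 0 < nc (den 0) by rewrite nc_gt0.
have cden : ccont den 0 by apply: cdiff_ccont; apply: (df _ _).2; rewrite nc0.
have [d1 d10 Hd1] := cden (nc (den 0) / 2) ltac:(lra).
have den_big (t : C) : nc t < d1 -> nc (den 0) / 2 < nc (den t).
  move=> ht; have := Hd1 t; rewrite subr0 => /(_ ht) h.
  by have := nc_sub_ge (den 0) (den t); rewrite nc_distC; lra.
have [d2 [d20 d2d d2d1]] : exists d2, [/\ 0 < d2, d2 <= d & d2 <= d1].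
  by exists (Num.min d d1); rewrite lt_min d0 d10 !ge_min !lexx orbT.
have den0 (t : C) : nc t < d2 -> den t != 0.
  by move=> ht; rewrite -nc_gt0; have := den_big t; lra.
have [e1 [d3 [e10 d30 Hq]]] := @hopf R (fun t => num t / den t) d2 d20
  ltac:(move=> t ht; have [|h1 h2] := df t; [lra|]; apply: cdiffM => //; apply: cdiffV => //; exact: den0)
  ltac:(move=> t ht tp; apply: pos => //; lra).
exists (e1 * (nc (den 0) / 2)), (Num.min d2 d3); split.
- by rewrite mulr_gt0 //; lra.
- by rewrite lt_min d20.
move=> x; rewrite lt_min => /andP[x0 /andP[xd2 xd3]].
have h2 := Hq x ltac:(by rewrite x0).
have nx : nc (x%:C%C : C) = x by rewrite nc_real gtr0_norm.
have -> : num x%:C%C = num x%:C%C / den x%:C%C * den x%:C%C.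
  by rewrite divfK // den0 // nx.
have h5 := le_trans (le_trans h2 (ler_norm _)) (nc_ge_Re _).
rewrite ncM mulrAC; apply: ler_pM => //.
- by rewrite mulr_ge0 // ltW.
- by lra.
- by apply: ltW; apply: den_big; rewrite nx; lra.
Qed.

Variables (G : V -> V') (A : V -> 'M[C]_(r + s + 0, r' + s' + t')) (c0 : V) (rho : R).
Hypothesis rho0 : 0 < rho.
Hypothesis dG : forall x, nr (x - c0) < rho -> gder G x (A x).
Hypothesis Gnull : forall x, nr (x - c0) < rho -> hq x = 0 -> hq (G x) = 0.
Hypothesis Gpos : forall x, nr (x - c0) < rho -> 0 < hq x -> 0 < hq (G x).
Local Notation K := (pulled_form G).

(** The double orthogonal of the image of a disc, standing in for its linear span: it is a subspace,
    and two of them are orthogonal as soon as the images are. *)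
Definition plane_span (p q : V) (d : R) (y : V') := forall x,
  (forall t : C, nc t < 4 * d -> H' (G (p + t *: q)) x = 0) -> H' y x = 0.

(** If the derivative paired to zero at the null point [z0], then [H' (G (z0 + x *: q)) (G z0)]
    would be [o(x)]. But by [lorentz_ratio] its quotient by a function nonzero at [x = 0] has
    positive real part on the right half plane, and Hopf's lemma makes it grow at least linearly. *)
Lemma transversal_in_plane (p q : V) (d : R) : 0 < d ->
  (forall t : C, nc t < 4 * d -> nr (p + t *: q - c0) < rho) ->
  (forall t : C, nc t < 4 * d -> hq (p + t *: q) = 2 * complex.Re t) ->
  ~ (exists a b, [/\ plane_span p q d a, plane_span p q d b, H' a b = 0 &
       0 < hq a /\ 0 < hq b]) ->
  exists y, `|y| < 4 * d /\
    H' (q *m A (p + (I' * y%:C%C) *: q)) (G (p + (I' * y%:C%C) *: q)) != 0.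
Proof.
move=> d0 inb qz nex.
have nI (y : R) : nc (I' * y%:C%C) = `|y| by rewrite ncM nc_i mul1r nc_real.
have ReI (y : R) : complex.Re (I' * y%:C%C) = 0 by rewrite /=; ring.
have ReID (y : R) (t : C) : complex.Re (I' * y%:C%C + t) = complex.Re t.
  by case: t => t1 t2 /=; ring.
have d04 : 0 < 4 * d by lra.
have sm4 (y : R) : `|y| < d -> `|y| < 4 * d by lra.
have small (y : R) (t : C) : `|y| < d -> nc t < d -> nc (I' * y%:C%C + t) < 4 * d.
  by move=> hy ht; apply: le_lt_trans (ncD _ _) _; rewrite nI; lra.
have dd8 : `|d / 8| < 4 * d by rewrite ger0_norm; lra.
have dd84 : `|d / 8| < d / 4 by rewrite ger0_norm; lra.
have d2p : 0 < 2 * (d / 8) by lra.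
have d4l (x : R) : x < 4 * (d / 4) -> x < d by lra.
have d4l4 (x : R) : x < 4 * (d / 4) -> x < 4 * d by lra.
pose Sp := plane_span p q d.
pose z (t : C) := p + t *: q.
have SG t : nc t < 4 * d -> Sp (G (z t)) by move=> ht x; apply.
have SL (c : C) a b : Sp a -> Sp b -> Sp (c *: a + b).
  by move=> Sa Sb x Hx; rewrite hformDl hformZl (Sa x Hx) (Sb x Hx) mulr0 addr0.
have [y0 [y1 [h0 h1 k0]]] : exists y0 y1 : R, [/\ `|y0| < d, `|y1| < d &
    K (z (I' * y0%:C%C)) (z (I' * y1%:C%C)) != 0].
  (* If [K] vanished on all pairs of null points of the line, [plane_zero] in each variable would
     give [K z z = 0] at the positive point of parameter [d / 8]. *)
  apply: contrapT => nK.
  have KI (y y' : R) : `|y| < 4 * (d / 4) -> `|y'| < 4 * (d / 4) ->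
      K (z (I' * y%:C%C)) (z (I' * y'%:C%C)) = 0.
    move=> hy hy'; apply/eqP/negPn/negP => hk; apply: nK; exists y, y'.
    by split=> //; exact: d4l.
  have d4 t : nc t < 4 * (d / 4) -> nr (z t - c0) < rho by move=> ht; apply: inb; exact: d4l4.
  have K1 (y' : R) t : `|y'| < 4 * (d / 4) -> nc t < d / 4 -> K (z t) (z (I' * y'%:C%C)) = 0.
    move=> hy'; apply: (@plane_zero _ _ (fun x => K x (z (I' * y'%:C%C))) p q (d / 4)).
      by move=> t2 /d4 ht2; exact: (K_lholo dG).
    by move=> y hy; exact: KI.
  have K2 t t1 : nc t < d / 4 -> nc t1 < d / 4 -> K (z t1) (z t) = 0.
    move=> ht; apply: (@plane_zero _ _ (fun x => K x (z t)) p q (d / 4)).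
      by move=> t2 /d4 ht2; exact: (K_lholo dG).
    by move=> y hy; apply: K_eq0C; exact: K1.
  have nd : nc ((d / 8)%:C%C : C) < d / 4 by rewrite nc_real.
  have nd' : nc ((d / 8)%:C%C : C) < 4 * d by rewrite nc_real.
  have : 0 < hq (G (z (d / 8)%:C%C)) by apply: Gpos; [exact: inb|rewrite qz].
  by have := K2 _ _ nd nd; rewrite /pulled_form hqE => /(congr1 (@complex.Re R)) /= ->; rewrite ltxx.
exists y0; split; first exact: sm4.
apply/negP => /eqP D0.
have nz0 : nc (I' * y0%:C%C) < 4 * d by rewrite nI; exact: sm4.
have nz1 : nc (I' * y1%:C%C) < 4 * d by rewrite nI; exact: sm4.
set z0 := p + (I' * y0%:C%C) *: q in D0; set n0 := G z0 in D0.
set n1 := G (z (I' * y1%:C%C)) in k0; set k := H' n0 n1.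
have z0b : nr (z0 - c0) < rho by exact: inb.
have q0 : hq n0 = 0 by apply: Gnull => //; rewrite /z0 qz ?ReI ?mulr0.
have q1 : hq n1 = 0 by apply: Gnull; [exact: inb|rewrite qz ?ReI ?mulr0].
have zE t : z0 + t *: q = z (I' * y0%:C%C + t) by rewrite /z0 /z -addrA scalerDl.
have Hd (t : C) : nc t < d -> cdiff (fun t : C => H' (G (z0 + t *: q)) n0) t /\
    cdiff (fun t : C => H' (G (z0 + t *: q)) n1 * k^*) t.
  move=> ht; have hG : gder G (z0 + t *: q) (A (z0 + t *: q)).
    by apply: dG; rewrite zE; apply: inb; exact: small.
  split; first by apply: (@lholo_line _ _ (fun x => H' (G x) n0)); apply: gder_hform hG.
  apply: cdiffM; last exact: cdiff_cst.
  by apply: (@lholo_line _ _ (fun x => H' (G x) n1)); apply: gder_hform hG.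
have Hp (t : C) : nc t < d -> 0 < complex.Re t ->
    0 < complex.Re (H' (G (z0 + t *: q)) n0 / (H' (G (z0 + t *: q)) n1 * k^*)).
  move=> ht tp; rewrite zE; apply: (@lorentz_ratio Sp _ _ _ SL nex _ _ _ q0 q1 k0).
  - by apply: SG; exact: small.
  - exact: SG.
  - exact: SG.
  - by apply: Gpos; [apply: inb; exact: small|rewrite qz ?ReID ?mulr_gt0 // small].
have Hn : H' (G (z0 + 0 *: q)) n1 * k^* != 0.
  by rewrite scale0r addr0 mulf_neq0 // fmorph_eq0.
have [c [e [cp ep He]]] := hopf_ratio d0 Hd Hn Hp.
have c2 : 0 < c / 2 by rewrite divr_gt0.
have [e1 e10 Hr] := ray_K dG q n0 z0b c2.
have m0 : 0 < Num.min e e1 / 2 by rewrite divr_gt0 // lt_min ep.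
have [me me1] : Num.min e e1 / 2 < e /\ Num.min e e1 / 2 < e1.
  have h2 : Num.min e e1 / 2 < Num.min e e1 by rewrite gtr_pMr ?invf_lt1 ?ltr1n // lt_min ep.
  by split; apply: lt_le_trans h2 _; rewrite ge_min lexx ?orbT.
have He1 : 0 < Num.min e e1 / 2 < e by rewrite m0 me.
have He2 : 0 < Num.min e e1 / 2 < e1 by rewrite m0 me1.
have := He _ He1; have := Hr _ He2.
have n00 : H' (G z0) n0 = 0 by have h := hqE n0; rewrite q0 in h; exact: h.
rewrite D0 mulr0 subr0 n00 subr0 => h3 h4.
have := le_trans h4 h3; rewrite ler_pM2r // leNgt gtr_pMr ?invf_lt1 ?ltr1n //.
Qed.

(** If each of the [r] spans contained two orthogonal positive vectors, their mutual orthogonality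
    would produce [2 r] orthogonal positive vectors, more than [r']. *)
Lemma transversal_null_point delta : (0 < r)%N -> (r <= s)%N -> (r' < 2 * r)%N ->
  c0 != 0 -> hq c0 = 0 -> 0 < delta ->
  exists p v, [/\ nr (p - c0) < delta, hq p = 0 & H' (v *m A p) (G p) != 0].
Proof.
move=> r0 rs r'2 cn cq dl0; have rp := rho0.
have [e [f [F ec]]] := frame_at cn cq r0 rs.
pose E : R := 1 + \sum_(i < r) nr (e i).
have E0 i : (i < r)%N -> nr (e i) <= E.
  move=> ir; rewrite /E (bigD1 (Ordinal ir)) //=.
  have : 0 <= \sum_(j < r | j != Ordinal ir) nr (e j) by apply: sumr_ge0 => j _; exact: nr_ge0.
  by lra.
have E1 : 1 <= E by rewrite /E lerDl; apply: sumr_ge0 => j _; exact: nr_ge0.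
clearbody E.
pose eta := Num.min delta (rho / 4) / 2.
have [eta0 eta1 eta2] : [/\ 0 < eta, eta <= delta / 2 & eta <= rho / 8].
  have m0 : 0 < Num.min delta (rho / 4) by rewrite lt_min dl0 /=; lra.
  have [m1 m2] : Num.min delta (rho / 4) <= delta /\ Num.min delta (rho / 4) <= rho / 4.
    by rewrite !ge_min !lexx orbT.
  by rewrite /eta; split; lra.
clearbody eta.
pose ep := eta / (2 * E).
have ep0 : 0 < ep by rewrite divr_gt0 //; lra.
have epE : ep * E = eta / 2 by rewrite /ep; field; rewrite gt_eqF //; lra.
have epn : ep != 0 by rewrite gt_eqF.
clearbody ep.
pose p := plane_pt e ep; pose q := plane_dir f ep.
pose Q : R := 1 + \sum_(i < r) nr (q i).
have Q0 i : (i < r)%N -> nr (q i) <= Q.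
  move=> ir; rewrite /Q (bigD1 (Ordinal ir)) //=.
  have : 0 <= \sum_(j < r | j != Ordinal ir) nr (q j) by apply: sumr_ge0 => j _; exact: nr_ge0.
  by lra.
have Q1 : 1 <= Q by rewrite /Q lerDl; apply: sumr_ge0 => j _; exact: nr_ge0.
have pE i : (i < r)%N -> nr (p i - c0) < eta.
  move=> ir; rewrite /p /plane_pt ec; case: eqP => _; first by rewrite subrr nr0.
  rewrite addrC addKr nrZ nc_real gtr0_norm //.
  have : ep * nr (e i) <= ep * E by rewrite ler_wpM2l ?(ltW ep0) ?E0.
  lra.
have Hpq i j (a b : C) : (i < r)%N -> (j < r)%N ->
    H (p i + a *: q i) (p j + b *: q j) = (i == j)%:R * (b^* + a).
  exact: (plane_hform F r0 epn).
clearbody Q p q.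
(* [plane_span] looks at radius [4 * d] and [plane_zero] loses a factor 4, so null points are needed
   up to [16 * d]; then [16 * (d * Q) = eta] keeps them within [2 * eta <= rho / 4] of [c0]. *)
pose d := eta / (16 * Q).
have d0 : 0 < d by rewrite divr_gt0 //; lra.
have dQ : 16 * (d * Q) = eta by rewrite /d; field; rewrite gt_eqF //; lra.
clearbody d.
have ball16 i (t : C) : (i < r)%N -> nc t < 16 * d -> nr (p i + t *: q i - c0) < 2 * eta.
  move=> ir ht; apply: (ball_shift (pE i ir) (b := eta)); last by lra.
  rewrite nrZ -dQ mulrA; apply: ler_pM; rewrite ?nc_ge0 ?nr_ge0 ?Q0 //; exact: ltW.
have qz i (t : C) : (i < r)%N -> hq (p i + t *: q i) = 2 * complex.Re t.
  move=> ir; rewrite /hq Hpq // eqxx mul1r conjE; case: t => a b /=; ring.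
have Kz i j (a b : C) : (i < r)%N -> (j < r)%N -> i != j -> nc a < 4 * d -> nc b < 4 * d ->
    K (p i + a *: q i) (p j + b *: q j) = 0.
  have nI (y : R) : nc (I' * y%:C%C) = `|y| by rewrite ncM nc_i mul1r nc_real.
  have ReI (y : R) : complex.Re (I' * y%:C%C) = 0 by rewrite /=; ring.
  have KI k l (y y' : R) : (k < r)%N -> (l < r)%N -> k != l -> `|y| < 16 * d -> `|y'| < 16 * d ->
     K (p k + (I' * y%:C%C) *: q k) (p l + (I' * y'%:C%C) *: q l) = 0.
    move=> kr lr kl hy hy'; apply: (K_null_orth rho0 dG Gnull).
    - by have := ball16 k (I' * y%:C%C) kr; rewrite nI => /(_ hy); lra.
    - by have := ball16 l (I' * y'%:C%C) lr; rewrite nI => /(_ hy'); lra.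
    - by rewrite qz // ReI mulr0.
    - by rewrite qz // ReI mulr0.
    - by rewrite Hpq // (negPf kl) mul0r.
  have inb k (t : C) : (k < r)%N -> nc t < 4 * (4 * d) -> nr (p k + t *: q k - c0) < rho.
    by move=> kr ht; have := ball16 k t kr; lra.
  have K1 k l (t : C) (y : R) : (k < r)%N -> (l < r)%N -> k != l -> nc t < 4 * d -> `|y| < 16 * d ->
     K (p k + t *: q k) (p l + (I' * y%:C%C) *: q l) = 0.
    move=> kr lr kl ht hy.
    apply: (@plane_zero _ _ (fun x => K x (p l + (I' * y%:C%C) *: q l)) _ _ (4 * d)) => //.
      by move=> t1 ht1; apply: (K_lholo dG); exact: inb.
    by move=> y1 hy1; apply: KI => //; lra.
  move=> ir jr ij ha hb.
  apply: (@plane_zero _ _ (fun x => K x (p j + b *: q j)) _ _ (4 * d)) => //.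
    by move=> t1 ht1; apply: (K_lholo dG); exact: inb.
  by move=> y1 hy1; apply: K_eq0C; apply: K1 => //; [rewrite eq_sym|lra].
pose Sp i := plane_span (p i) (q i) d.
have SpO i j y y' : (i < r)%N -> (j < r)%N -> i != j -> Sp i y -> Sp j y' -> H' y y' = 0.
  move=> ir jr ij Sy Sy'; apply: Sy => t ht; apply: hform_eq0C; apply: Sy' => t1 ht1.
  by apply: Kz => //; rewrite eq_sym.
have [i [ir nex]] : exists i, (i < r)%N /\ ~ (exists a b, [/\ Sp i a, Sp i b, H' a b = 0 &
    0 < hq a /\ 0 < hq b]).
  apply: contrapT => nex.
  have ex (i : 'I_r) : exists ab : V' * V', [/\ Sp i ab.1, Sp i ab.2, H' ab.1 ab.2 = 0 &
      0 < hq ab.1 /\ 0 < hq ab.2].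
    apply: contrapT => nx; apply: nex; exists i; split; first exact: ltn_ord.
    by move=> [a [b Hab]]; apply: nx; exists (a, b).
  have [ab Hab] := choice ex.
  pose fam (k : 'I_r * bool) := if k.2 then (ab k.1).1 else (ab k.1).2.
  have Sfam (k : 'I_r * bool) : Sp k.1 (fam k).
    by have [h1 h2 _ _] := Hab k.1; rewrite /fam; case: k.2.
  have : (#|{: 'I_r * bool}| <= r')%N.
    apply: (@positive_index R r' s' t' _ fam).
      move=> [i1 b1] [i2 b2] ne; have [i12|i12] := eqVneq i1 i2.
        subst i2; have [_ _ h3 _] := Hab i1; rewrite /fam /=.
        by case: b1 b2 ne => -[] //=; rewrite ?eqxx // => _; exact: hform_eq0C.
      by apply: (SpO i1 i2); rewrite ?ltn_ord //; [exact: (Sfam (i1, b1))|exact: (Sfam (i2, b2))].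
    by move=> [i1 b1]; have [_ _ _ [h4 h5]] := Hab i1; rewrite /fam /=; case: b1.
  by rewrite card_prod card_ord card_bool mulnC leqNgt r'2.
have [y [hy Hy]] := @transversal_in_plane (p i) (q i) d d0
  ltac:(move=> t ht; have := ball16 i t ir; lra) ltac:(by move=> t _; exact: qz) nex.
exists (p i + (I' * y%:C%C) *: q i), (q i); split=> //.
  have nI : nc (I' * y%:C%C) = `|y| by rewrite ncM nc_i mul1r nc_real.
  by have := ball16 i (I' * y%:C%C) ir; rewrite nI; lra.
by rewrite qz //=; ring.
Qed.

End Transversal.

(** * Minors of the pulled back form on pencils of null lines *)

Section JointContinuity.
Variable (R : realType).
Local Notation C := R[i].

Definition jcont n m (D : 'rV[C]_n -> 'rV[C]_m -> C) x y := forall e, 0 < e ->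
  exists2 d, 0 < d & forall x1 y1, nr (x1 - x) < d -> nr (y1 - y) < d ->
    nc (D x1 y1 - D x y) < e.

Lemma jcontB n m (D E : 'rV[C]_n -> 'rV[C]_m -> C) x y :
  jcont D x y -> jcont E x y -> jcont (fun u v => D u v - E u v) x y.
Proof.
move=> cD cE e e0; have e2 : 0 < e / 2 by lra.
have [d1 d10 H1] := cD _ e2; have [d2 d20 H2] := cE _ e2.
exists (Num.min d1 d2); first by rewrite lt_min d10.
move=> x1 y1; rewrite !lt_min => /andP[x1d1 x1d2] /andP[y1d1 y1d2].
have h1 := H1 _ _ x1d1 y1d1; have h2 := H2 _ _ x1d2 y1d2.
have -> : D x1 y1 - E x1 y1 - (D x y - E x y) = (D x1 y1 - D x y) - (E x1 y1 - E x y) by ring.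
by apply: le_lt_trans (ncB _ _) _; lra.
Qed.

Lemma jcontM n m (D E : 'rV[C]_n -> 'rV[C]_m -> C) x y :
  jcont D x y -> jcont E x y -> jcont (fun u v => D u v * E u v) x y.
Proof.
move=> cD cE e e0.
have Dz0 := nc_ge0 (D x y); have Ez0 := nc_ge0 (E x y).
set a := nc (D x y) in Dz0; set b := nc (E x y) in Ez0.
have e1 : 0 < Num.min 1 (e / (2 * (b + 1))) by rewrite lt_min ltr01 divr_gt0 //; lra.
have e2 : 0 < e / (2 * (a + 1)) by rewrite divr_gt0 //; lra.
have [d1 d10 H1] := cD _ e1; have [d2 d20 H2] := cE _ e2.
exists (Num.min d1 d2); first by rewrite lt_min d10.
move=> x1 y1; rewrite !lt_min => /andP[x1d1 x1d2] /andP[y1d1 y1d2].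
have := H1 _ _ x1d1 y1d1; rewrite lt_min => /andP[h0 h1].
have h2 := H2 _ _ x1d2 y1d2.
have -> : D x1 y1 * E x1 y1 - D x y * E x y =
   D x1 y1 * (E x1 y1 - E x y) + (D x1 y1 - D x y) * E x y by ring.
apply: le_lt_trans (ncD _ _) _; rewrite !ncM -/b.
have Dn : nc (D x1 y1) <= a + 1 by have := nc_sub_ge (D x1 y1) (D x y); rewrite -/a; lra.
move: h1 h2; rewrite !ltr_pdivlMr; try lra; move=> h1 h2.
have p1 : nc (D x1 y1) * nc (E x1 y1 - E x y) <= (a + 1) * nc (E x1 y1 - E x y).
  by rewrite ler_wpM2r ?nc_ge0.
have p2 : nc (D x1 y1 - D x y) * b <= nc (D x1 y1 - D x y) * (b + 1).
  by rewrite ler_wpM2l ?nc_ge0 //; lra.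
lra.
Qed.

Lemma jcont_neq0 n m (D : 'rV[C]_n -> 'rV[C]_m -> C) x y : jcont D x y -> D x y != 0 ->
  exists2 d, 0 < d & forall x1 y1, nr (x1 - x) < d -> nr (y1 - y) < d -> D x1 y1 != 0.
Proof.
move=> cD D0; have n0 : 0 < nc (D x y) by rewrite nc_gt0.
have [d d0 Hd] := cD _ n0; exists d => // x1 y1 h1 h2.
have := Hd _ _ h1 h2; apply: contraTneq => ->.
by rewrite sub0r ncN ltxx.
Qed.

Lemma jcont_hform n m r s t (f : 'rV[C]_n -> 'rV[C]_(r + s + t)) (g : 'rV[C]_m -> 'rV[C]_(r + s + t)) x y :
  vcont f x -> vcont g y -> jcont (fun u v => hform (f u) (g v)) x y.
Proof.
move=> cf cg e e0.
have a0 := nr_ge0 (f x); have b0 := nr_ge0 (g y).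
set a := nr (f x) in a0; set b := nr (g y) in b0.
have e1 : 0 < e / (2 * (b + 1)) by rewrite divr_gt0 //; lra.
have e2 : 0 < Num.min 1 (e / (2 * (a + 1))) by rewrite lt_min ltr01 divr_gt0 //; lra.
have [e3 [e30 e3b e3a e31]] : exists e3, [/\ 0 < e3, e3 * (b + 1) <= e / 4, e3 * (a + 1) <= e / 4 & e3 <= 1].
  exists (Num.min 1 (e / (4 * (a + b + 1)))).
  have q0 : 0 < e / (4 * (a + b + 1)) by rewrite divr_gt0 //; lra.
  have q1 : Num.min 1 (e / (4 * (a + b + 1))) <= e / (4 * (a + b + 1)) by rewrite ge_min lexx orbT.
  have q2 : e / (4 * (a + b + 1)) * (a + b + 1) = e / 4 by field; rewrite gt_eqF //; lra.
  have m0 : 0 < Num.min 1 (e / (4 * (a + b + 1))) by rewrite lt_min ltr01.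
  split=> //; last by rewrite ge_min lexx.
    rewrite -q2; apply: ler_pM => //; [exact: ltW|lra|lra].
  by rewrite -q2; apply: ler_pM => //; [exact: ltW|lra|lra].
have [d1 d10 H1] := cf _ e30; have [d2 d20 H2] := cg _ e30.
exists (Num.min d1 d2); first by rewrite lt_min d10.
move=> x1 y1; rewrite !lt_min => /andP[/H1 h1 _] /andP[_ /H2 h2].
have -> : hform (f x1) (g y1) - hform (f x) (g y) =
   hform (f x1 - f x) (g y1) + hform (f x) (g y1 - g y).
  by rewrite hformBl hformBr; ring.
apply: le_lt_trans (ncD _ _) _.
have n1 := hform_le (f x1 - f x) (g y1); have n2 := hform_le (f x) (g y1 - g y).
have g1 : nr (g y1) <= b + 1.
  by have := nrD (g y1 - g y) (g y); rewrite subrK -/b; lra.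
have p1 : nr (f x1 - f x) * nr (g y1) <= e3 * (b + 1).
  by apply: ler_pM; rewrite ?nr_ge0 // ltW.
have p2 : nr (f x) * nr (g y1 - g y) <= (a + 1) * e3.
  by apply: ler_pM; rewrite ?nr_ge0 ?(ltW h2) // -/a; lra.
lra.
Qed.

End JointContinuity.

Section Radii.
Variable (R : realFieldType).

Lemma small_radius (B d1 rad d2 m : R) : 0 < B -> 0 < d1 -> 0 < rad -> 0 < d2 -> 0 < m ->
  exists d, [/\ 0 < d, d <= d1, d <= rad / 2, d * B < d2 & d * B < m].
Proof.
move=> B0 d10 r0 d20 m0.
have q1 : 0 < d2 / (2 * B) by rewrite divr_gt0 //; lra.
have q2 : 0 < m / (2 * B) by rewrite divr_gt0 //; lra.
have e1 : d2 / (2 * B) * B = d2 / 2 by field; rewrite gt_eqF.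
have e2 : m / (2 * B) * B = m / 2 by field; rewrite gt_eqF.
exists (Num.min (Num.min d1 (rad / 2)) (Num.min (d2 / (2 * B)) (m / (2 * B)))).
split.
- by rewrite !lt_min d10 q1 q2 divr_gt0.
- by rewrite !ge_min lexx.
- by rewrite !ge_min lexx orbT.
- apply: (@le_lt_trans _ _ (d2 / (2 * B) * B)); last by rewrite e1; lra.
  by rewrite ler_pM2r // !ge_min lexx !orbT.
- apply: (@le_lt_trans _ _ (m / (2 * B) * B)); last by rewrite e2; lra.
  by rewrite ler_pM2r // !ge_min lexx !orbT.
Qed.

Lemma quot_bound (k a q n S T h d : R) : 0 < h -> 0 < d -> 0 <= a -> 0 <= n -> 0 <= k ->
  k <= d * a -> h / 2 < q -> a < S -> n < T -> k / q * n < d * (2 * S * T / h).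
Proof.
move=> h0 d0 a0 n0 k0 ka hq aS nT.
have h2 : 0 < h / 2 by lra.
have q0 : 0 < q by lra.
have e1 : k / q <= d * a / (h / 2).
  by apply: ler_pM => //; [rewrite invr_ge0 ltW|rewrite lef_pV2 ?posrE // ltW].
have -> : d * (2 * S * T / h) = d * S / (h / 2) * T by field; rewrite gt_eqF.
apply: (@le_lt_trans _ _ (d * a / (h / 2) * n)); first by rewrite ler_wpM2r.
apply: ltr_pM => //.
  by apply: divr_ge0; [apply: mulr_ge0|]; rewrite // ltW.
by rewrite ltr_pM2r ?invr_gt0 // ltr_pM2l.
Qed.

End Radii.

(** * Dual systems with nonvanishing diagonal values *)

Section DualFrame.
Variables (R : realType) (r s : nat).
Local Notation C := R[i].
Local Notation V := ('rV[C]_(r + s + 0)).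
Local Notation H := (@hform R r s 0).
Variables (D : V -> V -> C) (rad : R).
Hypothesis rad0 : 0 < rad.
Hypothesis D_lholol : forall x y, nr x < 8 * rad -> nr y < 8 * rad -> lholo (fun u => D u y) x.
Hypothesis D_lholor : forall x y, nr x < 8 * rad -> nr y < 8 * rad -> lholo (fun v => (D x v)^*) y.
Hypothesis D_cont : forall x y, nr x < 8 * rad -> nr y < 8 * rad -> jcont D x y.

(** The identity theorem is used on [N1] with [y] kept near [v], then on [N2] for the conjugate,
    which is holomorphic in the second argument. *)
Lemma dual_vanish (N1 N2 : V -> Prop) u v d :
  (forall (c : C) x y, N1 x -> N1 y -> N1 (c *: x + y)) ->
  (forall (c : C) x y, N2 x -> N2 y -> N2 (c *: x + y)) ->
  N1 u -> N2 v -> nr u < rad -> nr v < rad -> 0 < d ->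
  (forall x y, N1 x -> N2 y -> nr (x - u) < d -> nr (y - v) < d -> D x y = 0) ->
  forall x y, N1 x -> N2 y -> nr x < rad -> nr y < rad -> D x y = 0.
Proof.
move=> L1 L2 Nu Nv hu hv d0 Duv x y Nx Ny hx hy; have rp := rad0.
have Z1 (c : C) a : N1 a -> N1 (c *: a).
  move=> Na; have N0 : N1 0 by have := L1 (-1) a a Na Na; rewrite scaleN1r addNr.
  by rewrite -[_ *: _]addr0; exact: L1.
have Z2 (c : C) a : N2 a -> N2 (c *: a).
  move=> Na; have N0 : N2 0 by have := L2 (-1) a a Na Na; rewrite scaleN1r addNr.
  by rewrite -[_ *: _]addr0; exact: L2.
have B1 a b : N1 a -> N1 b -> N1 (a - b).
  by move=> Na Nb; rewrite addrC -scaleN1r; exact: L1.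
have B2 a b : N2 a -> N2 b -> N2 (a - b).
  by move=> Na Nb; rewrite addrC -scaleN1r; exact: L2.
have A1' a b : N1 a -> N1 b -> N1 (a + b) by move=> Na Nb; rewrite -[a]scale1r; exact: L1.
have A2' a b : N2 a -> N2 b -> N2 (a + b) by move=> Na Nb; rewrite -[a]scale1r; exact: L2.
have sm (a b c : V) : nr (a - b) < 7 * rad -> nr b < rad -> nr a < 8 * rad.
  by move=> h1 h2; have := nrD (a - b) b; rewrite subrK; lra.
have step1 y1 : N2 y1 -> nr (y1 - v) < d -> nr y1 < rad -> D x y1 = 0.
  move=> Ny1 hy1 hy1'.
  have -> : x = u + (x - u) by rewrite addrC subrK.
  apply: (@identity_growth _ _ N1 (fun a => D a y1) u (7 * rad) d Z1) => //.
  - move=> a ha; apply: D_lholol; [exact: (sm a u u)|lra].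
  - move=> a Na ha; apply: Duv => //; [exact: A1'|by rewrite addrC addKr].
  - exact: B1.
  - by apply: le_lt_trans (nrB _ _) _; lra.
have -> : D x y = ((D x (v + (y - v)))^*)^* by rewrite conjCK addrC subrK.
rewrite (_ : (D x (v + (y - v)))^* = 0) ?rmorph0 //.
have [d' [d'0 d'd d'r]] : exists d', [/\ 0 < d', d' <= d & d' <= rad - nr v].
  by exists (Num.min d (rad - nr v)); rewrite lt_min d0 !ge_min !lexx orbT; split=> //=; lra.
apply: (@identity_growth _ _ N2 (fun a => (D x a)^*) v (7 * rad) d' Z2) => //.
- move=> a ha; apply: D_lholor; [lra|exact: (sm a v v)].
- move=> a Na ha; rewrite step1 ?rmorph0 //; first exact: A2'.
    by rewrite addrC addKr; lra.
  by apply: le_lt_trans (nrD _ _) _; lra.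
- exact: B2.
- by apply: le_lt_trans (nrB _ _) _; lra.
Qed.

(** Pairs are split off one at a time, each costing at most one in the rank of the Gram matrix. The
    obstacle is that [D] might vanish on the complements of the chosen pair. If this happened for
    every pair, take [(u, v)] in the complements of [(x0, y0)] with [H u v] nonzero: every [(x, y)]
    near [(u, v)] lies in the complements of a slightly corrected [(x0, y0)], so [D] vanishes near
    [(u, v)] and hence everywhere, against [D x0 y0 != 0]. *)
Lemma dual_frame k : forall (N1 N2 : V -> Prop),
  (forall (c : C) x y, N1 x -> N1 y -> N1 (c *: x + y)) ->
  (forall (c : C) x y, N2 x -> N2 y -> N2 (c *: x + y)) ->
  (forall x y, N1 x -> N2 y -> nr x < rad -> nr y < rad -> H x y = 0 -> D x y = 0) ->
  (exists m (U W : 'I_m -> V), [/\ forall i, N1 (U i), forall i, N2 (W i) &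
     (k <= \rank (\matrix_(i, j) H (U i) (W j)))%N]) ->
  (exists x y, [/\ N1 x, N2 y, nr x < rad, nr y < rad & D x y != 0]) ->
  exists X Y : nat -> V, (forall i, (i < k)%N ->
     [/\ N1 (X i), N2 (Y i), nr (X i) < rad, nr (Y i) < rad & D (X i) (Y i) != 0]) /\
   (forall i j, (i < k)%N -> (j < k)%N -> i != j -> H (X i) (Y j) = 0).
Proof.
have rp := rad0.
elim: k => [|k IH] N1 N2 L1 L2 D0 [m [U [W [NU NW rk]]]] [x0 [y0 [Nx0 Ny0 hx0 hy0 Dxy]]].
  by exists (fun=> 0), (fun=> 0).
have Z1 (c : C) a : N1 a -> N1 (c *: a).
  move=> Na; have N0 : N1 0 by have := L1 (-1) a a Na Na; rewrite scaleN1r addNr.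
  by rewrite -[_ *: _]addr0; exact: L1.
have Z2 (c : C) a : N2 a -> N2 (c *: a).
  move=> Na; have N0 : N2 0 by have := L2 (-1) a a Na Na; rewrite scaleN1r addNr.
  by rewrite -[_ *: _]addr0; exact: L2.
have B1 (c : C) a b : N1 a -> N1 b -> N1 (a - c *: b).
  by move=> Na Nb; rewrite addrC -scaleNr; exact: L1.
have B2 (c : C) a b : N2 a -> N2 b -> N2 (a - c *: b).
  by move=> Na Nb; rewrite addrC -scaleNr; exact: L2.
(* the orthogonal complements of [y1] and [x1] still have a Gram matrix of rank [k] *)
have reduce x1 y1 : N1 x1 -> N2 y1 -> H x1 y1 != 0 -> exists U' W' : 'I_m -> V,
    [/\ forall i, N1 (U' i) /\ H (U' i) y1 = 0, forall i, N2 (W' i) /\ H x1 (W' i) = 0 &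
     (k <= \rank (\matrix_(i, j) H (U' i) (W' j)))%N].
  move=> Nx1 Ny1 h1.
  exists (fun i => U i - (H (U i) y1 / H x1 y1) *: x1).
  exists (fun j => W j - (H x1 (W j) / H x1 y1)^* *: y1).
  split=> [i|i|].
  - by split; [exact: B1|rewrite hformBl hformZl divfK ?subrr].
  - by split; [exact: B2|rewrite hformBr hformZr conjCK divfK ?subrr].
  set Gr' := (X in \rank X).
  pose col : 'cV[C]_m := \col_i H (U i) y1.
  pose rw : 'rV[C]_m := \row_j (H x1 (W j) / H x1 y1).
  have E : \matrix_(i, j) H (U i) (W j) = Gr' + col *m rw.
    apply/matrixP => i j; rewrite !mxE big_ord1 !mxE.
    by rewrite !(hformBl, hformBr, hformZl, hformZr) conjCK; field.
  have := leq_trans rk (eq_leq (congr1 mxrank E)).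
  have h2 := mxrank_add Gr' (col *m rw); have h3 := mulmx_max_rank col rw.
  move=> h4; have := leq_trans h4 (leq_trans h2 (leq_add (leqnn _) h3)).
  by rewrite addn1 ltnS.
have Hne x1 y1 : N1 x1 -> N2 y1 -> nr x1 < rad -> nr y1 < rad -> D x1 y1 != 0 -> H x1 y1 != 0.
  by move=> a b c d; apply: contraNneq => h; apply/eqP; exact: D0.
have [k0|kp] := posnP k.
  exists (fun=> x0), (fun=> y0); split=> [i _|i j] //.
  by rewrite k0 !ltnS !leqn0 => /eqP -> /eqP ->.
have [x1 [y1 [[Nx1 Ny1 hx1 hy1 Dxy1] [x2 [y2 [[Nx2 x2y1] [Ny2 x1y2] hx2 hy2 Dxy2]]]]]] :
  exists x1 y1, [/\ N1 x1, N2 y1, nr x1 < rad, nr y1 < rad & D x1 y1 != 0] /\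
    exists x2 y2, [/\ N1 x2 /\ H x2 y1 = 0, N2 y2 /\ H x1 y2 = 0, nr x2 < rad, nr y2 < rad &
      D x2 y2 != 0].
  apply: contrapT => nex.
  have xy0 := Hne _ _ Nx0 Ny0 hx0 hy0 Dxy.
  have [U' [W' [NU' NW' rk']]] := reduce _ _ Nx0 Ny0 xy0.
  have : \matrix_(i, j) H (U' i) (W' j) != 0 :> 'M[C]_(m, m).
    by rewrite -mxrank_eq0 -lt0n; apply: leq_trans rk'.
  case/matrix0Pn => i [j]; rewrite mxE => uv0.
  have [Nu uy0] := NU' i; have [Nv xv0] := NW' j.
  have shrink (a : V) : exists2 c : R, 0 < c & nr (c%:C%C *: a) < rad / 2.
    have na := nr_ge0 a.
    exists (rad / (2 * (nr a + 1))); first by rewrite divr_gt0 //; lra.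
    have q0 : 0 < rad / (2 * (nr a + 1)) by rewrite divr_gt0 //; lra.
    rewrite nrZ nc_real gtr0_norm // mulrAC ltr_pdivrMr; last by lra.
    by nra.
  have [cu cu0 hu] := shrink (U' i); have [cv cv0 hv] := shrink (W' j).
  have realn0 (c : R) : 0 < c -> c%:C%C != 0 :> C by move=> c0; rewrite eq_complex /= gt_eqF.
  have [u Eu] : exists u, u = cu%:C%C *: U' i by eexists.
  have [v Ev] : exists v, v = cv%:C%C *: W' j by eexists.
  rewrite -Eu in hu; rewrite -Ev in hv.
  have Nu' : N1 u by rewrite Eu; exact: Z1.
  have Nv' : N2 v by rewrite Ev; exact: Z2.
  have uy : H u y0 = 0 by rewrite Eu hformZl uy0 mulr0.
  have xv : H x0 v = 0 by rewrite Ev hformZr xv0 mulr0.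
  have uv : H u v != 0.
    by rewrite Eu Ev hformZl hformZr; apply: mulf_neq0; [|apply: mulf_neq0]; rewrite ?realn0 // conjC_eq0 realn0.
  clear Eu Ev.
  have [nx0 ny0 nu nv] : [/\ 0 <= nr x0, 0 <= nr y0, 0 <= nr u & 0 <= nr v].
    by split; exact: nr_ge0.
  have [d1 d10 Hd1] : exists2 d, 0 < d & forall x1 y1, nr (x1 - x0) < d -> nr (y1 - y0) < d ->
      D x1 y1 != 0.
    by apply: jcont_neq0 => //; apply: D_cont; clear -hx0 hy0 rp nx0 ny0; lra.
  have [d2 d20 Hd2] : exists2 d, 0 < d & forall x1 y1, nr (x1 - u) < d -> nr (y1 - v) < d ->
      nc (H u v) / 2 < nc (H x1 y1).
    have h0 : 0 < nc (H u v) by rewrite nc_gt0.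
    have ci (w : V) : vcont id w by move=> e e0; exists e.
    have h2 : 0 < nc (H u v) / 2 by lra.
    have [d d0 Hd] := @jcont_hform R _ _ r s 0 id id u v (ci _) (ci _) _ h2.
    exists d => // x1 y1 h1 h3; have := Hd _ _ h1 h3.
    have := nc_sub_ge (H u v) (H x1 y1); rewrite nc_distC => h4 h5; clear -h4 h5; lra.
  have h0 : 0 < nc (H u v) by rewrite nc_gt0.
  have [B EB] : exists B, B = 2 * (nr x0 + nr y0 + 1) * (nr u + nr v + 1) / nc (H u v) by eexists.
  have B0 : 0 < B by rewrite EB divr_gt0 // !mulr_gt0 //; clear -nx0 ny0 nu nv; lra.
  have m0 : 0 < Num.min (rad - nr x0) (rad - nr y0).
    by rewrite lt_min; apply/andP; split; clear -hx0 hy0; lra.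
  have [d [d0 dd2 dr dB1 dB2]] := small_radius B0 d20 rp d10 m0.
  have [dB3 dB4] : d * B < rad - nr x0 /\ d * B < rad - nr y0.
    by move: dB2; rewrite lt_min => /andP.
  have key : forall x y, N1 x -> N2 y -> nr (x - u) < d -> nr (y - v) < d -> D x y = 0.
    move=> x y Nx Ny hx hy; apply/eqP/negPn/negP => Dn0; apply: nex.
    have uyn : nc (H u v) / 2 < nc (H u y).
      by apply: Hd2; [rewrite subrr nr0|apply: lt_le_trans hy dd2].
    have xvn : nc (H u v) / 2 < nc (H x v).
      by apply: Hd2; [apply: lt_le_trans hx dd2|rewrite subrr nr0].
    have uy1 : H u y != 0 by rewrite -nc_gt0; apply: lt_trans uyn; rewrite divr_gt0.
    have xv1 : H x v != 0 by rewrite -nc_gt0; apply: lt_trans xvn; rewrite divr_gt0.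
    have b1 : nr ((H x0 y / H u y) *: u) < d * B.
      rewrite nrZ ncM ncV EB; apply: (@quot_bound _ _ (nr x0)) => //.
      - exact: nc_ge0.
      - have -> : H x0 y = H x0 (y - v) by rewrite hformBr xv subr0.
        by apply: le_trans (hform_le _ _) _; rewrite mulrC; apply: ler_wpM2r => //; exact: ltW.
      - by rewrite -addrA ltrDl ltr_wpDl ?ltr01.
      - by rewrite -addrA ltrDl ltr_wpDl ?ltr01.
    have b2 : nr ((H x y0 / H x v)^* *: v) < d * B.
      rewrite nrZ nc_conjC ncM ncV EB; apply: (@quot_bound _ _ (nr y0)) => //.
      - exact: nc_ge0.
      - have -> : H x y0 = H (x - u) y0 by rewrite hformBl uy subr0.
        by apply: le_trans (hform_le _ _) _; rewrite ler_wpM2r // ltW.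
      - by rewrite [nr x0 + _]addrC -addrA ltrDl ltr_wpDl.
      - by rewrite [nr u + _]addrC -addrA ltrDl ltr_wpDl.
    (* The corrections are small because [H x0 v] and [H u y0] are zero, so [D] stays nonzero at the
       corrected pair. *)
    exists (x0 - (H x0 y / H u y) *: u), (y0 - (H x y0 / H x v)^* *: v); split.
      split; [exact: B1|exact: B2| | |].
      - by apply: le_lt_trans (nrB _ _) _; rewrite -ltrBrDl; apply: lt_trans b1 _.
      - by apply: le_lt_trans (nrB _ _) _; rewrite -ltrBrDl; apply: lt_trans b2 _.
      - by apply: Hd1; rewrite addrC addKr nrN; [exact: lt_trans b1 dB1|exact: lt_trans b2 dB1].
    exists x, y; split=> //.
    - by split=> //; rewrite hformBr hformZr conjCK divfK // subrr.
    - by split=> //; rewrite hformBl hformZl divfK // subrr.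
    - have := nrD (x - u) u; rewrite subrK; clear -hx dr hu; lra.
    - have := nrD (y - v) v; rewrite subrK; clear -hy dr hv; lra.
  move: Dxy; rewrite (dual_vanish L1 L2 Nu' Nv' _ _ d0 key) ?eqxx //; clear -hu hv rp; lra.
have [U' [W' [NU' NW' rk']]] := reduce _ _ Nx1 Ny1 (Hne _ _ Nx1 Ny1 hx1 hy1 Dxy1).
have [|||||X [Y [HX HO]]] := IH (fun x => N1 x /\ H x y1 = 0) (fun y => N2 y /\ H x1 y = 0).
- move=> c x y [Nx xy] [Ny yy]; split; first exact: L1.
  by rewrite hformDl hformZl xy yy mulr0 addr0.
- move=> c x y [Nx xy] [Ny yy]; split; first exact: L2.
  by rewrite hformDr hformZr xy yy mulr0 addr0.
- by move=> x y [Nx _] [Ny _]; exact: D0.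
- by exists m, U', W'.
- by exists x2, y2.
exists (fun i => if i is j.+1 then X j else x1), (fun i => if i is j.+1 then Y j else y1).
split=> [[|i] ik|[|i] [|j] ik jk ij] //.
- by have [[? _] [? _] ? ? ?] := HX i ik.
- by have [_ [_ ?] _ _ _] := HX j jk.
- by have [[_ ?] _ _ _ _] := HX i ik.
- exact: HO.
Qed.

End DualFrame.

Lemma det2_solve (F : idomainType) (a b x11 x12 x21 x22 : F) :
  a * x11 + b * x21 = 0 -> a * x12 + b * x22 = 0 -> x11 * x22 - x12 * x21 != 0 ->
  a = 0 /\ b = 0.
Proof.
move=> h1 h2 dn.
have da : a * (x11 * x22 - x12 * x21) = (a * x11 + b * x21) * x22 - (a * x12 + b * x22) * x21.
  by ring.
have db : b * (x11 * x22 - x12 * x21) = x11 * (a * x12 + b * x22) - x12 * (a * x11 + b * x21).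
  by ring.
move: da db; rewrite h1 h2 !mul0r !mulr0 subrr => /eqP; rewrite mulf_eq0 (negPf dn) orbF.
by move=> /eqP -> /eqP; rewrite mulf_eq0 (negPf dn) orbF => /eqP.
Qed.

(** * Vanishing of the minors *)

Section CollinearMinor.
Variables (R : realType) (r s r' s' t' : nat).
Local Notation C := R[i].
Local Notation V := ('rV[C]_(r + s + 0)).
Local Notation V' := ('rV[C]_(r' + s' + t')).
Local Notation H := (@hform R r s 0).
Local Notation H' := (@hform R r' s' t').
Implicit Types (p u v w x z : V).
Variables (G : V -> V') (A : V -> 'M[C]_(r + s + 0, r' + s' + t')) (c0 : V) (rho : R).
Hypothesis rho0 : 0 < rho.
Hypothesis dG : forall x, nr (x - c0) < rho -> gder G x (A x).
Hypothesis Gnull : forall x, nr (x - c0) < rho -> hq x = 0 -> hq (G x) = 0.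
Hypothesis r1 : (1 < r)%N.
Hypothesis rs : (r <= s)%N.
Hypothesis r'r : (r' <= 2 * r - 2)%N.

Local Notation K := (pulled_form G).

Lemma pencil_in p x (a : C) (d : R) : nr (p - c0) < rho / 32 -> nr x < d -> nc a <= 1 ->
  d + rho / 32 <= rho -> nr (p + a *: x - c0) < rho / 32 + d.
Proof.
move=> hp hx ha hd.
have h : nr (a *: x) <= d.
  by rewrite nrZ; apply: le_trans (ltW hx); rewrite ler_piMl // nr_ge0.
exact: (ball_shift hp h).
Qed.

Lemma vcont_pencil p x (a : C) : nr (p + a *: x - c0) < rho -> nc a <= 1 ->
  vcont (fun u => G (p + a *: u)) x.
Proof.
move=> hp ha e e0; have [d d0 Hd] := gder_vcont (dG hp) e0.
exists d => // y hy; apply: Hd.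
rewrite opprD addrACA subrr add0r -scalerBr nrZ; apply: le_lt_trans hy.
by rewrite ler_piMl // nr_ge0.
Qed.

Lemma pencil_null p x (a : C) : hq p = 0 -> hq x = 0 -> H p x = 0 -> hq (p + a *: x) = 0.
Proof. by move=> p0 x0 px; rewrite hqD hqZ hformZr p0 x0 px !mulr0 !addr0. Qed.

Lemma pencil_hform p x y (a b : C) : hq p = 0 -> H p x = 0 -> H p y = 0 ->
  H (p + a *: x) (p + b *: y) = a * b^* * H x y.
Proof.
move=> p0 px py; rewrite hformDl !hformDr !hformZl !hformZr hqE p0 py (hform_eq0C px).
by rewrite !mulr0 !add0r mulrA.
Qed.

(** Otherwise [dual_frame] yields [r - 1] pairs [X j], [Y j] with nonzero minors, orthogonal for
    distinct indices. The vectors [G p], [G (p + X j)], [G (p + t1 X j)] are null and pairwise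
    orthogonal, so a nontrivial combination lies in the radical. Pairing it with [G (p + Y j)] and
    [G (p + t2 Y j)] kills the two coefficients of index [j], and the last one vanishes because
    [G p] is outside the radical. *)
Lemma collinear_minor p z w (t1 t2 : C) :
  nr (p - c0) < rho / 32 -> nr (z - c0) < rho / 32 -> nr (w - c0) < rho / 32 ->
  hq p = 0 -> hq z = 0 -> hq w = 0 -> H p z = 0 -> H p w = 0 -> p != 0 ->
  (exists y, H' (G p) y != 0) -> nc t1 <= 1 -> nc t2 <= 1 ->
  K z w * K (p + t1 *: (z - p)) (p + t2 *: (w - p)) =
  K z (p + t2 *: (w - p)) * K (p + t1 *: (z - p)) w.
Proof.
move=> hp hz hw p0 z0 w0 pz pw pn [yp Gp] ht1 ht2.
have rp := rho0; have r1' := r1.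
have [x1 Ex1] : exists x1, x1 = z - p by eexists.
have [y1 Ey1] : exists y1, y1 = w - p by eexists.
rewrite -Ex1 -Ey1.
have hx1 : nr x1 < rho / 16 by rewrite Ex1; apply: (ball_dist hz hp); lra.
have hy1 : nr y1 < rho / 16 by rewrite Ey1; apply: (ball_dist hw hp); lra.
have x10 : hq x1 = 0 by rewrite Ex1 hqD hqN hformNr (hform_eq0C pz) z0 p0 oppr0 raddf0 mulr0 !addr0.
have y10 : hq y1 = 0 by rewrite Ey1 hqD hqN hformNr (hform_eq0C pw) w0 p0 oppr0 raddf0 mulr0 !addr0.
have px1 : H p x1 = 0 by rewrite Ex1 hformBr pz hqE p0 subrr.
have py1 : H p y1 = 0 by rewrite Ey1 hformBr pw hqE p0 subrr.
have Ez : z = p + 1 *: x1 by rewrite scale1r Ex1 addrC subrK.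
have Ew : w = p + 1 *: y1 by rewrite scale1r Ey1 addrC subrK.
rewrite Ez Ew; clear Ex1 Ey1 Ez Ew hz hw z0 w0 pz pw z w.
pose kk a b x y := K (p + a *: x) (p + b *: y).
pose D x y := kk 1 1 x y * kk t1 t2 x y - kk 1 t2 x y * kk t1 1 x y.
suff : D x1 y1 = 0 by move/eqP; rewrite subr_eq0 => /eqP.
have n11 : nc (1 : C) <= 1 by rewrite nc1.
have kk0 a b x y : nc a <= 1 -> nc b <= 1 -> nr x < rho / 16 -> nr y < rho / 16 ->
    hq x = 0 -> hq y = 0 -> H p x = 0 -> H p y = 0 -> H x y = 0 -> kk a b x y = 0.
  move=> ha hb hx hy x0 y0 px py xy; apply: (K_null_orth rho0 dG Gnull).
  - by apply: lt_trans (pencil_in hp hx ha _) _; lra.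
  - by apply: lt_trans (pencil_in hp hy hb _) _; lra.
  - exact: pencil_null.
  - exact: pencil_null.
  - by rewrite pencil_hform // xy mulr0.
have D0 x y : nr x < rho / 16 -> nr y < rho / 16 ->
    hq x = 0 -> hq y = 0 -> H p x = 0 -> H p y = 0 -> H x y = 0 -> D x y = 0.
  by move=> *; rewrite /D !kk0 // !mul0r subrr.
apply: contrapT => /eqP Dxy.
have xy0 : H x1 y1 != 0 by apply: contraNneq Dxy => h; apply/eqP; exact: D0.
have [e [f [F e0 e1 f1]]] := @frame_at3 R r s p x1 (((H x1 y1)^-1)^* *: y1) pn p0 x10
  ltac:(by rewrite hqZ y10 mulr0) px1 ltac:(by rewrite hformZr py1 mulr0)
  ltac:(by rewrite hformZr conjCK mulVf) r1 rs.
have lt1 (i : 'I_r.-1) : (i.+1 < r)%N by have := ltn_ord i; case: (r) i.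
(* Only indices from 1 on enter, so both isotropic spaces are orthogonal to [p = e 0]. *)
pose N1 x := exists c : 'I_r.-1 -> C, x = \sum_i c i *: e i.+1.
pose N2 x := exists c : 'I_r.-1 -> C, x = \sum_i c i *: f i.+1.
have L1 (c : C) x y : N1 x -> N1 y -> N1 (c *: x + y).
  move=> [a ->] [b ->]; exists (fun i => c * a i + b i); rewrite scaler_sumr -big_split /=.
  by apply: eq_bigr => i _; rewrite scalerDl scalerA.
have L2 (c : C) x y : N2 x -> N2 y -> N2 (c *: x + y).
  move=> [a ->] [b ->]; exists (fun i => c * a i + b i); rewrite scaler_sumr -big_split /=.
  by apply: eq_bigr => i _; rewrite scalerDl scalerA.
have N1e (i : 'I_r.-1) : N1 (e i.+1).
  exists (fun j => (j == i)%:R); rewrite (bigD1 i) //= big1 ?addr0 => [|j /negPf ->].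
    by rewrite eqxx scale1r.
  by rewrite scale0r.
have N2f (i : 'I_r.-1) : N2 (f i.+1).
  exists (fun j => (j == i)%:R); rewrite (bigD1 i) //= big1 ?addr0 => [|j /negPf ->].
    by rewrite eqxx scale1r.
  by rewrite scale0r.
have N11 x y : N1 x -> N1 y -> H x y = 0.
  move=> [a ->] [b ->]; rewrite hform_suml big1 // => i _; rewrite hformZl hform_sumr big1 ?mulr0 // => j _.
  by have [h _ _] := F _ _ (lt1 i) (lt1 j); rewrite hformZr h mulr0.
have N22 x y : N2 x -> N2 y -> H x y = 0.
  move=> [a ->] [b ->]; rewrite hform_suml big1 // => i _; rewrite hformZl hform_sumr big1 ?mulr0 // => j _.
  by have [_ h _] := F _ _ (lt1 i) (lt1 j); rewrite hformZr h mulr0.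
have r0 : (0 < r)%N by apply: ltnW.
have pN1 x : N1 x -> H p x = 0.
  move=> [a ->]; rewrite hform_sumr big1 // => j _.
  by have [h _ _] := F _ _ r0 (lt1 j); rewrite hformZr -e0 h mulr0.
have pN2 x : N2 x -> H p x = 0.
  move=> [a ->]; rewrite hform_sumr big1 // => j _.
  by have [_ _ h] := F _ _ r0 (lt1 j); rewrite hformZr -e0 h mulr0.
have qN1 x : N1 x -> hq x = 0 by move=> Nx; rewrite /hq N11.
have qN2 x : N2 x -> hq x = 0 by move=> Nx; rewrite /hq N22.
have r10 : (0 < r.-1)%N by case: (r) r1' => [|[|]].
have inb x (a : C) : nr x < 8 * (rho / 16) -> nc a <= 1 -> nr (p + a *: x - c0) < rho.
  by move=> hx ha; apply: lt_trans (pencil_in hp hx ha _) _; lra.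
have kl a b x y : nc a <= 1 -> nr x < 8 * (rho / 16) -> lholo (fun u => kk a b u y) x.
  move=> ha hx; apply: (@lholo_affine _ _ (fun u => K u (p + b *: y)) p a).
  exact: K_lholo dG _ _ (inb _ _ hx ha).
have kj a b x y : nc a <= 1 -> nc b <= 1 -> nr x < 8 * (rho / 16) -> nr y < 8 * (rho / 16) ->
    jcont (kk a b) x y.
  move=> ha hb hx hy.
  by apply: (jcont_hform (f := fun u => G (p + a *: u)) (g := fun u => G (p + b *: u)));
     apply: vcont_pencil => //; exact: inb.
have [|||||||X [Y [HX HO]]] := @dual_frame R r s D (rho / 16) _ _ _ _ r.-1 N1 N2 L1 L2.
- lra.
- move=> x y hx hy; apply: (lholoB (f := fun u => kk 1 1 u y * kk t1 t2 u y)
    (g := fun u => kk 1 t2 u y * kk t1 1 u y)); apply: lholoM; exact: kl.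
- move=> x y hx hy.
  have E a b v : (kk a b x v)^* = kk b a v x by rewrite /kk -KC.
  apply: (@lholo_ext _ _ (fun v => kk 1 1 v x * kk t2 t1 v x - kk t2 1 v x * kk 1 t1 v x)).
    by move=> v; rewrite -!E -!rmorphM -rmorphB.
  by apply: lholoB; apply: lholoM; exact: kl.
- by move=> x y hx hy; apply: jcontB; apply: jcontM; exact: kj.
- by move=> x y Nx Ny hx hy xy; apply: D0; auto.
- exists r.-1, (fun i => e i.+1), (fun i => f i.+1); split=> //.
  have -> : \matrix_(i < r.-1, j < r.-1) H (e i.+1) (f j.+1) = 1%:M.
    apply/matrixP => i j; rewrite !mxE; have [_ _ ->] := F _ _ (lt1 i) (lt1 j).
    by rewrite eqSS.
  by rewrite mxrank1.
- exists x1, y1; split=> //; first by rewrite -e1; exact: (N1e (Ordinal r10)).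
  have -> : y1 = ((H x1 y1)^*) *: f 1%N + 0.
    by rewrite addr0 f1 scalerA fmorphV divff ?scale1r // conjC_eq0.
  apply: (L2); first exact: (N2f (Ordinal r10)).
  by exists (fun=> 0); rewrite big1 // => i _; rewrite scale0r.
pose row (i : option ('I_r.-1 * bool)) : V' :=
  if i is Some (j, b) then G (p + (if b then t1 else 1) *: X j) else G p.
have Gp0 x (a : C) : nc a <= 1 -> nr x < rho / 16 -> hq x = 0 -> H p x = 0 ->
    H' (G p) (G (p + a *: x)) = 0.
  move=> ha hx x0 px.
  have := @kk0 a a 0 x ha ha ltac:(by rewrite nr0 divr_gt0) hx ltac:(by rewrite /hq hform0l) x0
    ltac:(by rewrite hform0r) px ltac:(by rewrite hform0l).
  by rewrite /kk scaler0 addr0.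
have tb (b : bool) : nc (if b then t1 else 1) <= 1 by case: b.
have tb2 (b : bool) : nc (if b then t2 else 1) <= 1 by case: b.
have [||c [[i0 ci0] hc]] := @null_index R r' s' t' _ row.
- move=> [[i a]|] [[j b]|] /=.
  + have [? _ ? _ _] := HX i (ltn_ord i); have [? _ ? _ _] := HX j (ltn_ord j).
    by apply: (kk0); auto.
  + have [? _ ? _ _] := HX i (ltn_ord i).
    by apply: hform_eq0C; apply: Gp0; auto.
  + have [? _ ? _ _] := HX j (ltn_ord j).
    by apply: Gp0; auto.
  + by rewrite hqE Gnull //; apply: lt_trans hp _; lra.
(* The family has [2 (r - 1) + 1] members, one more than [2 r - 2]. *)
- rewrite card_option card_prod card_bool card_ord.
  by move: r'r r1'; clear; case: (r) => [|[|k]] // h _; rewrite ltnS; apply: leq_trans h _; lia.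
have cS j b : c (Some (j, b)) = 0.
  have [Nx Ny hx hy Dj] := HX j (ltn_ord j).
  have eqn (d : bool) : c (Some (j, false)) * kk 1 (if d then t2 else 1) (X j) (Y j) +
      c (Some (j, true)) * kk t1 (if d then t2 else 1) (X j) (Y j) = 0.
    rewrite -[RHS](hc (G (p + (if d then t2 else 1) *: Y j))).
    rewrite (bigD1 (Some (j, false))) //= (bigD1 (Some (j, true))) //=; last first.
      by apply/eqP; case.
    rewrite big1 ?addr0 // => -[[i b']|] /andP[n1 n2] /=; last by rewrite Gp0 ?mulr0; auto.
    have ij : i != j.
      by apply: contraNneq n1 => ij; move: n2; rewrite ij; case: b'; rewrite ?eqxx.
    have [Nxi _ hxi _ _] := HX i (ltn_ord i).
    have xy : H (X i) (Y j) = 0 by apply: HO.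
    have h : kk (if b' then t1 else 1) (if d then t2 else 1) (X i) (Y j) = 0 by apply: (kk0); auto.
    by rewrite -[X in _ * X]/(kk (if b' then t1 else 1) (if d then t2 else 1) (X i) (Y j)) h mulr0.
  have [c1 c2] := det2_solve (eqn false) (eqn true) Dj.
  by case: b.
have := hc yp; rewrite (bigD1 None) //= big1 ?addr0 => [|[[j b]|] // _]; last by rewrite cS mul0r.
move/eqP; rewrite mulf_eq0 (negPf Gp) orbF => /eqP cN.
by move: ci0; case: i0 => [[j b]|]; rewrite ?cS ?cN eqxx.
Qed.

End CollinearMinor.

(** * Identity theorems from open sets and from the null cone *)

Section NullIdentity.
Variables (R : realType) (r s : nat).
Local Notation C := R[i].
Local Notation V := ('rV[C]_(r + s + 0)).
Local Notation H := (@hform R r s 0).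
Implicit Types (p u v w x z : V).
Variables (f : V -> C) (c0 : V) (rho : R).
Hypothesis rho0 : 0 < rho.
Hypothesis hf : forall x, nr (x - c0) < rho -> lholo f x.

Lemma open_identity z0 d : nr (z0 - c0) < rho / 8 -> 0 < d ->
  (forall x, nr (x - z0) < d -> f x = 0) -> forall x, nr (x - c0) < rho / 8 -> f x = 0.
Proof.
move=> hz0 d0 f0 x hx; have rp := rho0.
have -> : x = z0 + (x - z0) by rewrite addrC subrK.
apply: (@identity_growth _ _ (fun=> True) f z0 (rho / 2) d) => //.
- by move=> y hy; apply: hf; apply: le_lt_trans (nr_triangle y z0 c0) _; lra.
- by move=> u _ hu; apply: f0; rewrite addrC addKr.
- by apply: (ball_dist hx hz0); lra.
Qed.

(* [f] is propagated along the lines of a null direction transversal to the null cone at [z0]. *)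
Lemma null_identity z0 d : nr (z0 - c0) < rho / 8 -> 0 < d -> hq z0 = 0 -> z0 != 0 ->
  (forall x, nr (x - z0) < d -> hq x = 0 -> f x = 0) -> forall x, nr (x - c0) < rho / 8 -> f x = 0.
Proof.
move=> hz0 d0 z00 zn f0; have rp := rho0.
have [e [e0 ez]] := null_dual zn z00.
have ne := nr_ge0 e; have nz := nr_ge0 z0.
have [d1 [d10 d1d d1r]] : exists d1, [/\ 0 < d1, d1 <= d & d1 <= rho / 2].
  by exists (Num.min d (rho / 2)); rewrite lt_min d0 !ge_min !lexx orbT; split=> //=; lra.
pose B := 1 + 4 * (nr e + 1) * (nr z0 + 1).
have B0 : 0 < B by rewrite /B; have : 0 <= nr e * nr z0 by [exact: mulr_ge0]; nra.
pose d2 := Num.min 1 (d1 / (4 * B)).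
have q0 : 0 < d1 / (4 * B) by rewrite divr_gt0 //; lra.
have d20 : 0 < d2 by rewrite lt_min ltr01.
have d21 : d2 <= 1 by rewrite ge_min lexx.
have d2B : d2 * B <= d1 / 4.
  have -> : d1 / 4 = d1 / (4 * B) * B by field; rewrite gt_eqF.
  by rewrite ler_pM2r // ge_min lexx orbT.
have EB : B = 1 + 4 * (nr e + 1) * (nr z0 + 1) by [].
clearbody d2 B.
have [d3 [d30 d32 d3e]] : exists d3, [/\ 0 < d3, d3 <= d2 & nr e * d3 <= 2^-1].
  exists (Num.min d2 (2^-1 / (nr e + 1))).
  have q1 : 0 < 2^-1 / (nr e + 1) by rewrite divr_gt0 //; lra.
  split; [by rewrite lt_min d20|by rewrite ge_min lexx|].
  apply: (@le_trans _ _ ((nr e + 1) * (2^-1 / (nr e + 1)))); last by rewrite mulrC divfK // gt_eqF //; lra.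
  apply: ler_pM => //; first by rewrite le_min; apply/andP; split; lra.
    by lra.
  by rewrite ge_min lexx orbT.
apply: (@open_identity z0 d3) => // x hx.
have [u Eu] : exists u, u = x - z0 by eexists.
have Ex : x = z0 + u by rewrite Eu addrC subrK.
rewrite -Eu in hx; have nu := nr_ge0 u.
have hex : 2^-1 <= nc (H e x).
  have h := hform_le e u.
  have h1 : nr e * nr u <= nr e * d3 by rewrite ler_wpM2l // ltW.
  have := nc_sub_ge 1 (- H e u); rewrite opprK ncN nc1 -ez -hformDr -Ex; lra.
have hqx : `|hq x| <= d2 * (1 + 2 * nr z0).
  have -> : hq x = hq u + 2 * complex.Re (H z0 u) by rewrite Ex hqD z00 add0r.
  have h1 : `|hq u| <= nr u * nr u by apply: le_trans (nc_ge_Re _) _; exact: hform_le.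
  have h2 : `|complex.Re (H z0 u)| <= nr z0 * nr u by apply: le_trans (nc_ge_Re _) _; exact: hform_le.
  have u1 : nr u <= 1 by lra.
  have h3 : nr u * nr u <= d2.
    apply: (@le_trans _ _ (nr u)); last by lra.
    by rewrite ler_piMl.
  have h4 : nr z0 * nr u <= nr z0 * d2 by rewrite ler_wpM2l //; lra.
  apply: le_trans (ler_normD _ _) _; rewrite normrM [`|2|]ger0_norm //.
  by rewrite mulrDr mulr1; lra.
have hs : `|hq x| / nc (H e x) * nr e <= d2 * B.
  have h1 : `|hq x| / nc (H e x) <= d2 * (1 + 2 * nr z0) * 2.
    apply: ler_pM => //; first by rewrite invr_ge0 nc_ge0.
    by rewrite -[leRHS]invrK lef_pV2 ?posrE //; lra.
  apply: (@le_trans _ _ (d2 * (1 + 2 * nr z0) * 2 * nr e)); first by rewrite ler_wpM2r.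
  rewrite EB -!mulrA ler_wpM2l ?ltW //.
  have : 0 <= nr e * nr z0 by exact: mulr_ge0.
  nra.
have inb a b : -1 <= a <= 1 -> -1 <= b <= 1 ->
    nr (x + pt a b *: (null_shift x e *: e) - z0) < d1.
  move=> ha hb; rewrite -addrA addrCA -Eu; apply: le_lt_trans (nrD _ _) _.
  have h := null_shift_le x e ha hb.
  by have d2B' : d2 <= d2 * B by [rewrite ler_peMr ?ltW // EB; have : 0 <= nr e * nr z0 by [exact: mulr_ge0]; nra]; lra.
apply: (@line_zero _ _ f x (null_shift x e *: e)).
  move=> a b ha hb; apply: hf; have h := inb a b ha hb.
  by apply: le_lt_trans (nr_triangle _ z0 c0) _; lra.
move=> b hb; apply: f0.
- by apply: lt_le_trans d1d; apply: inb => //; apply/andP; split; [lra|].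
- by apply: null_shift_null => //; rewrite -nc_gt0; lra.
Qed.

End NullIdentity.

(** * The pulled back form is conformal *)

Lemma small_scale (R : realFieldType) (a b n m : R) : 0 < a -> 0 < b -> 0 <= n -> 0 <= m ->
  exists d, [/\ 0 < d, d <= a, n * d <= b & m * d <= b].
Proof.
move=> a0 b0 n0 m0.
have s0 : 0 < n + m + 1 by lra.
have q0 : 0 < b / (n + m + 1) by rewrite divr_gt0.
have [d Ed] : exists d, d = Num.min a (b / (n + m + 1)) by eexists.
have d0 : 0 < d by rewrite Ed lt_min a0.
have da : d <= a by rewrite Ed ge_min lexx.
have db : (n + m + 1) * d <= b by rewrite mulrC -ler_pdivlMr // Ed ge_min lexx orbT.
have nd : 0 <= n * d by rewrite mulr_ge0 // ltW.
have md : 0 <= m * d by rewrite mulr_ge0 // ltW.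
by exists d; split=> //; lra.
Qed.

Section PencilBase.
Variables (R : realType) (r s : nat).
Local Notation C := R[i].
Local Notation V := ('rV[C]_(r + s + 0)).
Local Notation H := (@hform R r s 0).

Lemma line_indep (w w2 : V) (l m : C) : w != 0 -> (forall c, w2 != c *: w) -> l != m ->
  forall c, w + l *: (w2 - w) != c *: (w + m *: (w2 - w)).
Proof.
move=> wn indep lm c; apply/eqP => E.
have E2 : (l - c * m) *: w2 = (c * (1 - m) - (1 - l)) *: w.
  have h : w + l *: (w2 - w) - c *: (w + m *: (w2 - w)) = 0 by rewrite E subrr.
  apply/eqP; rewrite -subr_eq0 -[X in _ == X]h; apply/eqP/rowP => j; rewrite !mxE; ring.
have [E3|n0] := eqVneq (l - c * m) 0.
  move: E2; rewrite E3 scale0r => /esym/eqP; rewrite scaler_eq0 (negPf wn) orbF => /eqP E4.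
  have c1 : c = 1.
    apply/eqP; rewrite -subr_eq0 -[X in _ == X]E4; apply/eqP.
    have -> : c - 1 = c * (1 - m) - (1 - l) - (l - c * m) by ring.
    by rewrite E3 subr0.
  by move/eqP: E3; rewrite c1 mul1r subr_eq0 (negPf lm).
have /eqP := indep ((c * (1 - m) - (1 - l)) / (l - c * m)); apply.
by rewrite mulrC -scalerA -E2 scalerA mulVf // scale1r.
Qed.

(** [z0] is reached from the point [p1] of parameter [2 / 3] in a null direction orthogonal to [p1]
    but not to [w - w2], so the parameter [l] orthogonal to [x] varies continuously near [z0].
    Around [2 / 3] one has [|l - 1| < |l| < 1] with a margin, which keeps [(l - 1) / l] in the unit
    disc in [pencil_ratio]. *)
Lemma pencil_base (w w2 : V) (dl : R) : 0 < dl -> w != 0 -> hq w = 0 -> hq w2 = 0 -> H w w2 = 0 ->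
  (forall c, w2 != c *: w) ->
  exists z0 d, [/\ 0 < d, hq z0 = 0, nr (z0 - w) <= nr (w2 - w) + dl &
  forall x, nr (x - z0) < d -> exists2 l : C, nc (l - (2 / 3)%:C%C) <= 10^-1 &
    H (w + l *: (w2 - w)) x = 0].
Proof.
move=> dl0 wn w0 w20 ww2 indep.
have [k Ek] : exists k : C, k = (2 / 3)%:C%C by eexists.
have nk : nc k = 2 / 3 by rewrite Ek nc_real ger0_norm //; lra.
have k0 : k != 0 by rewrite -nc_gt0; lra.
have [p1 Ep1] : exists p1, p1 = w + k *: (w2 - w) by eexists.
have hp1 : nr (p1 - w) <= nr (w2 - w).
  by rewrite Ep1 addrAC subrr add0r nrZ ler_piMl ?nr_ge0 // nk; lra.
have p1n : p1 != 0.
  apply/eqP => E; have /negP := @line_indep w w2 k 0 wn indep k0 0; apply.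
  by rewrite -Ep1 E scale0r.
have p1w : H p1 w = 0.
  by rewrite Ep1 hformDl hformZl hformBl (hform_eq0C ww2) hqE w0 subrr mulr0 addr0.
have p1w2 : H p1 w2 = 0.
  by rewrite Ep1 hformDl hformZl hformBl ww2 hqE w20 subrr mulr0 addr0.
have p10 : hq p1 = 0.
  by rewrite /hq {2}Ep1 hformDr hformZr hformBr p1w p1w2 subrr mulr0 addr0.
have ind : forall c, w != c *: p1.
  move=> d; rewrite Ep1 -[X in X != _]addr0 -(scale0r (w2 - w)).
  by apply: line_indep => //; rewrite eq_sym.
have [e [e0 ep ew]] := null_dual2 wn p1n ind w0 p10 (hform_eq0C p1w).
have ne := nr_ge0 e; have n1 := nr_ge0 p1; have nd := nr_ge0 (w - w2).
have [ep0 [ep00 _ epe _]] := @small_scale R 1 dl (nr e) 0 ltr01 dl0 ne (lexx 0).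
have [z0 Ez0] : exists z0, z0 = p1 + ep0%:C%C *: e by eexists.
have hz0 : nr (z0 - w) <= nr (w2 - w) + dl.
  have h : nr (ep0%:C%C *: e) <= dl by rewrite nrZ nc_real gtr0_norm // mulrC.
  by rewrite Ez0 addrAC; apply: le_trans (nrD _ _) _; lra.
have z00 : hq z0 = 0 by rewrite Ez0; apply: pencil_null => //; exact: hform_eq0C.
have p1z0 : H p1 z0 = 0 by rewrite Ez0 hformDr hformZr (hform_eq0C ep) hqE p10 mulr0 addr0.
(* As [H e w = 1], orthogonality to [p1] reads [0 = 1 / 3 + 2 / 3 * H e w2]. *)
have ew2 : H e w2 = (- 2^-1)%:C%C.
  have : H e p1 = 0 by [].
  rewrite Ep1 hformDr hformZr hformBr ew Ek => h.
  have k2 : ((2 / 3)%:C%C)^* = (2 / 3)%:C%C :> C by rewrite conjE conjc_real.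
  rewrite k2 in h; have -> : H e w2 = (3 / 2)%:C%C * (1 + (2 / 3)%:C%C * (H e w2 - 1)) - (2^-1)%:C%C.
    by rewrite !(rmorphM, fmorphV, rmorph_nat) /=; field.
  by rewrite h mulr0 sub0r rmorphN.
have dz0 : nc (H (w - w2) z0) = 3 / 2 * ep0.
  rewrite Ez0 hformDr hformBl (hform_eq0C p1w) (hform_eq0C p1w2) subrr add0r hformZr ncM.
  rewrite nc_conjC nc_real gtr0_norm // hformC nc_conjC hformBr ew ew2 mulrC; congr (_ * _).
  have -> : 1 - (- 2^-1)%:C%C = (3 / 2)%:C%C :> C.
    by rewrite -[1 in LHS](rmorph1 (@real_complex R)) -rmorphB; congr (_%:C%C); field.
  by rewrite nc_real ger0_norm //; lra.
have ep3 : 0 < ep0 / 30 by rewrite divr_gt0.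
have [d [d0 _ dp dw]] := @small_scale R 1 (ep0 / 30) (nr p1) (nr (w - w2)) ltr01 ep3 n1 nd.
exists z0, d; split=> // x hx.
have [u Eu] : exists u, u = x - z0 by eexists.
have Ex : x = z0 + u by rewrite Eu addrC subrK.
rewrite -Eu in hx; have nu := nr_ge0 u.
have b1 : nc (H (w - w2) u) <= ep0 / 2.
  apply: le_trans (hform_le _ _) _; apply: (@le_trans _ _ (nr (w - w2) * d)); [rewrite ler_wpM2l //; exact: ltW|lra].
have b2 : 3 * nc (H p1 u) <= ep0 / 10.
  have : nc (H p1 u) <= nr p1 * d.
    by apply: le_trans (hform_le _ _) _; rewrite ler_wpM2l // ltW.
  by lra.
have b3 : ep0 <= nc (H (w - w2) x).
  have := nc_sub_ge (H (w - w2) z0) (- H (w - w2) u).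
  by rewrite ncN opprK -hformDr -Ex dz0; lra.
have wn0 : H (w - w2) x != 0 by rewrite -nc_gt0; lra.
have lx : H (w + (H w x / H (w - w2) x) *: (w2 - w)) x = 0.
  by rewrite hformDl hformZl -[w2 - w]opprB hformNl mulrN divfK // subrr.
exists (H w x / H (w - w2) x) => //.
rewrite -Ek.
have -> : H w x / H (w - w2) x - k = H p1 u / H (w - w2) x.
  have -> : H p1 u = H p1 x by rewrite Ex hformDr p1z0 add0r.
  have -> : H p1 x = H w x - k * H (w - w2) x.
    by rewrite Ep1 hformDl hformZl -[w2 - w]opprB hformNl mulrN.
  by field.
rewrite ncM ncV ler_pdivrMr; last by lra.
lra.
Qed.

End PencilBase.

(** * Ratios of the pulled back form along null lines *)

Section Transversal.
Variables (R : realType) (r s r' s' t' : nat).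
Local Notation C := R[i].
Local Notation I' := ('i%C : C).
Local Notation V := ('rV[C]_(r + s + 0)).
Local Notation V' := ('rV[C]_(r' + s' + t')).
Local Notation H := (@hform R r s 0).
Local Notation H' := (@hform R r' s' t').
Implicit Types (p u v w x z : V).
Variables (G : V -> V') (A : V -> 'M[C]_(r + s + 0, r' + s' + t')) (c0 : V) (rho : R) (v0 : V).
Hypothesis rho0 : 0 < rho.
Hypothesis dG : forall x, nr (x - c0) < rho -> gder G x (A x).
Hypothesis Gnull : forall x, nr (x - c0) < rho -> hq x = 0 -> hq (G x) = 0.
Hypothesis r1 : (1 < r)%N.
Hypothesis rs : (r <= s)%N.
Hypothesis r'r : (r' <= 2 * r - 2)%N.
Hypothesis rhoc : rho <= nr c0.
Hypothesis transv : forall p w, nr (p - c0) < rho -> nr (w - c0) < rho ->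
  H' (v0 *m A p) (G w) != 0.

Local Notation K := (pulled_form G).

Lemma ball_neq0 x : nr (x - c0) < rho -> x != 0.
Proof.
move=> hx; apply/eqP => x0; move: hx; rewrite x0 sub0r nrN => hx.
by have := lt_le_trans hx rhoc; rewrite ltxx.
Qed.

Lemma ray_zero x u (y : V') d : nr (x - c0) < rho -> 0 < d -> H' (G x) y = 0 ->
  (forall t, 0 < t < d -> H' (G (x + t%:C%C *: u)) y = 0) -> H' (u *m A x) y = 0.
Proof.
move=> hx d0 h0 ht; apply/eqP; rewrite -nc_eq0 eq_le nc_ge0 andbT.
apply: (@ray_derivative_bound R (fun t => H' (G (x + t%:C%C *: u)) y) _ 0 d) => //.
  move=> e e0; have [d' d'0 Hd] := @ray_K _ _ _ _ _ _ G A c0 rho dG x u y hx e e0.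
  by exists d' => // t /Hd; rewrite h0 subr0.
by move=> t td; rewrite ht // nc0 mul0r.
Qed.

(** By [dK_orth] the covector [u |-> H' (u *m A p) (G w)] vanishes on the hyperplane orthogonal to
    [w], so it is a multiple of [u |-> H u w]; [a] is the multiplier. *)
Definition etaP p w (a : C) := forall u, H' (u *m A p) (G w) = a * H u w.

(** The multiplier is the value on a vector [y] with [H y w = 1]; transversality in the fixed
    direction [v0] prevents it from vanishing. *)
Lemma eta_exists p w : nr (p - c0) < rho / 8 -> nr (w - c0) < rho / 4 ->
  hq p = 0 -> hq w = 0 -> H p w = 0 -> (forall c, p != c *: w) ->
  exists2 a, a != 0 & etaP p w a.
Proof.
move=> hp hw p0 w0 pw indep; have rp := rho0.
have pn : p != 0 by apply: ball_neq0; lra.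
have wn : w != 0 by apply: ball_neq0; lra.
have [y yw] := hform_nondeg wn.
have E : etaP p w (H' (y *m A p) (G w)).
  move=> u; apply/eqP; rewrite -subr_eq0 mulrC -hformZl -hformBl scalemxAl -mulmxBl.
  apply/eqP; apply: (dK_orth rho0 dG Gnull) => //.
  by rewrite hformBl hformZl yw mulr1 subrr.
exists (H' (y *m A p) (G w)) => //; apply: contraNneq (@transv p w _ _) => [h||]; try lra.
by rewrite E h mul0r.
Qed.

(** Both sides of [collinear_minor] vanish at [t1 = 0], as [K p] is zero on null vectors orthogonal
    to [p]; hence their derivatives in [t1] at 0 agree. *)
Lemma pencil_limit p z w (t2 : C) :
  nr (p - c0) < rho / 32 -> nr (z - c0) < rho / 32 -> nr (w - c0) < rho / 32 ->
  nr (p + t2 *: (w - p) - c0) < rho / 32 ->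
  hq p = 0 -> hq z = 0 -> hq w = 0 -> H p z = 0 -> H p w = 0 -> nc t2 <= 1 ->
  K z w * H' ((z - p) *m A p) (G (p + t2 *: (w - p))) =
  K z (p + t2 *: (w - p)) * H' ((z - p) *m A p) (G w).
Proof.
move=> hp hz hw hw2 p0 z0 w0 pz pw ht2; have rp := rho0.
have [w2 Ew2] : exists w2, w2 = p + t2 *: (w - p) by eexists.
rewrite -Ew2 in hw2 *.
have w20 : hq w2 = 0.
  rewrite Ew2; apply: pencil_null => //; last by rewrite hformBr pw hqE p0 subrr.
  by rewrite hqD hqN hformNr (hform_eq0C pw) w0 p0 oppr0 raddf0 mulr0 !addr0.
have pw2 : H p w2 = 0 by rewrite Ew2 hformDr hformZr hformBr pw hqE p0 subrr mulr0 addr0.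
have hp1 : nr (p - c0) < rho by lra.
have hpp := transv hp1 hp1.
have Gp : exists y, H' (G p) y != 0.
  by exists (v0 *m A p); rewrite hform_neq0C.
have pn : p != 0 by apply: ball_neq0.
have [y Ey] : exists y, y = (K z w)^* *: G w2 - (K z w2)^* *: G w by eexists.
have Hy (x : V') : H' x y = K z w * H' x (G w2) - K z w2 * H' x (G w).
  by rewrite Ey hformBr !hformZr !conjCK.
have K0 x : nr (x - c0) < rho / 32 -> hq x = 0 -> H p x = 0 -> K p x = 0.
  by move=> hx x0 px; apply: (K_null_orth rho0 dG Gnull) => //; lra.
suff : H' ((z - p) *m A p) y = 0 by rewrite Hy => /eqP; rewrite subr_eq0 => /eqP.
apply: (@ray_zero p (z - p) y 1) => //.
  by rewrite Hy -/(K p w) -/(K p w2) !K0 // !mulr0 subrr.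
move=> t /andP[t0 tl]; rewrite Hy -/(K _ w) -/(K _ w2) Ew2.
have ht1 : nc (t%:C%C : C) <= 1 by rewrite nc_real ger0_norm ltW.
rewrite (@collinear_minor _ _ _ _ _ _ G A c0 rho rho0 dG Gnull r1 rs r'r p z w t%:C%C t2) //.
by rewrite subrr.
Qed.

Lemma pencil_limit_eta p z w (t2 a a2 : C) :
  nr (p - c0) < rho / 32 -> nr (z - c0) < rho / 32 -> nr (w - c0) < rho / 32 ->
  nr (p + t2 *: (w - p) - c0) < rho / 32 ->
  hq p = 0 -> hq z = 0 -> hq w = 0 -> H p z = 0 -> H p w = 0 -> nc t2 <= 1 ->
  etaP p w a -> etaP p (p + t2 *: (w - p)) a2 ->
  K z w * (a2 * H z (p + t2 *: (w - p))) = K z (p + t2 *: (w - p)) * (a * H z w).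
Proof.
move=> hp hz hw hw2 p0 z0 w0 pz pw ht2 ea ea2.
have := pencil_limit hp hz hw hw2 p0 z0 w0 pz pw ht2; rewrite ea ea2.
rewrite !hformBl pw (_ : H p (p + _) = 0) ?subr0 //.
by rewrite hformDr hformZr hformBr pw hqE p0 subrr mulr0 addr0.
Qed.

(** The identity based at [p] holds along the null points [zt t] leaving [p1]. At [p1] itself both
    members vanish, and their derivatives involve the multipliers based at [p1]. So the ratio of
    multipliers is the same for all base points of the line. *)
Lemma eta_ratio p p1 w (b t2 a a2 a1 a12 : C) :
  nr (p - c0) < rho / 32 -> nr (p1 - c0) < rho / 32 -> nr (w - c0) < rho / 32 ->
  nr (p + t2 *: (w - p) - c0) < rho / 32 ->
  hq p = 0 -> hq p1 = 0 -> H p p1 = 0 -> (forall c, p1 != c *: p) ->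
  w = p + b *: (p1 - p) -> b != 0 -> t2 != 0 -> nc t2 <= 1 ->
  etaP p w a -> etaP p (p + t2 *: (w - p)) a2 ->
  etaP p1 w a1 -> etaP p1 (p + t2 *: (w - p)) a12 -> a1 * a2 = a12 * a.
Proof.
move=> hp hp1 hw hw2 p0 p10 pp1 indep Ew bn tn ht2 ea ea2 ea1 ea12.
have rp := rho0.
have q32 : rho / 32 < rho / 4 by lra.
have pn : p != 0 by apply: ball_neq0; lra.
have p1n : p1 != 0 by apply: ball_neq0; lra.
have pw : H p w = 0 by rewrite Ew hformDr hformZr hformBr pp1 hqE p0 subrr mulr0 addr0.
have d0 : hq (p1 - p) = 0 by rewrite hqD hqN hformNr (hform_eq0C pp1) p0 p10 oppr0 raddf0 mulr0 !addr0.
have w0 : hq w = 0 by rewrite Ew; apply: pencil_null => //; rewrite hformBr pp1 hqE p0 subrr.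
have [w2 Ew2] : exists w2, w2 = p + t2 *: (w - p) by eexists.
have w20 : hq w2 = 0.
  rewrite Ew2 Ew addrAC subrr add0r scalerA; apply: pencil_null => //.
  by rewrite hformBr pp1 hqE p0 subrr.
have p1w : H p1 w = 0.
  by rewrite Ew hformDr hformZr hformBr hqE p10 (hform_eq0C pp1) subrr mulr0 addr0.
have p1w2 : H p1 w2 = 0.
  by rewrite Ew2 hformDr hformZr hformBr p1w (hform_eq0C pp1) subrr mulr0 addr0.
have [e [e0 ep ep1]] := null_dual2 p1n pn indep p10 p0 (hform_eq0C pp1).
have ew : H e w = b^* by rewrite Ew hformDr hformZr hformBr ep1 ep subr0 add0r mulr1.
have ew2 : H e w2 = t2^* * b^* by rewrite Ew2 hformDr hformZr hformBr ew ep subr0 add0r.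
(* The factor [i] keeps [zt t] on the null cone, because [H e p1 = 1] is real. *)
pose zt (t : R) := p1 + t%:C%C *: (I' *: e).
have ne := nr_ge0 e.
have i0 : I' != 0 by rewrite -nc_eq0 nc_i oner_neq0.
have ztE (t : R) : [/\ hq (zt t) = 0, H p (zt t) = 0, H (zt t) w = (t%:C%C * I') * b^* &
    H (zt t) w2 = (t%:C%C * I') * (t2^* * b^*)].
  split.
  - rewrite /zt scalerA hqD hqZ e0 mulr0 addr0 p10 add0r hformZr (hformC e p1) ep1 rmorph1 mulr1.
    by rewrite conjE /= !mulr0 mul0r subrr mulr0.
  - by rewrite hformDr !hformZr pp1 (hform_eq0C ep) !mulr0 addr0.
  - by rewrite hformDl !hformZl p1w ew add0r mulrA.
  - by rewrite hformDl !hformZl p1w2 ew2 add0r mulrA.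
pose d := Num.min (rho / 32 - nr (p1 - c0)) 1 / (nr e + 1).
have d1 : 0 < d by rewrite divr_gt0 ?ltr_wpDl // lt_min subr_gt0 hp1 ltr01.
have hzt (t : R) : 0 < t < d -> nr (zt t - c0) < rho / 32.
  move=> /andP[tp]; rewrite /d ltr_pdivlMr; last by lra.
  rewrite lt_min => /andP[td _].
  have h : nr (t%:C%C *: (I' *: e)) <= t * nr e by rewrite !nrZ nc_real nc_i mul1r gtr0_norm.
  have h2 : t * nr e <= t * (nr e + 1) by rewrite ler_wpM2l ?ltW // ltrDl.
  rewrite /zt -addrA addrC -addrA; apply: le_lt_trans (nrD _ _) _; rewrite [- c0 + _]addrC; lra.
have [y Ey] : exists y, y = (a2 * t2^*)^* *: G w - a^* *: G w2 by eexists.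
have Hy (x : V') : H' x y = a2 * t2^* * H' x (G w) - a * H' x (G w2).
  by rewrite Ey hformBr !hformZr !conjCK.
have : H' ((I' *: e) *m A p1) y = 0.
  have hw2' : nr (w2 - c0) < rho / 32 by rewrite Ew2.
  apply: (@ray_zero p1 (I' *: e) y d) => //; first by lra.
    have K0 x : nr (x - c0) < rho / 32 -> hq x = 0 -> H p1 x = 0 -> K p1 x = 0.
      by move=> hx x0 p1x; apply: (K_null_orth rho0 dG Gnull) => //; exact: lt_trans q32.
    by rewrite Hy -/(K p1 w) -/(K p1 w2) !K0 // !mulr0 subrr.
  move=> t td; have [z0 pz zw zw2] := ztE t.
  have := pencil_limit_eta hp (hzt t td) hw hw2 p0 z0 w0 pz pw ht2 ea ea2.
  rewrite -Ew2 zw zw2 => h.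
  have tbn : t%:C%C * I' * b^* != 0.
    have /andP[tp _] := td.
    by apply: mulf_neq0; [apply: mulf_neq0|]; rewrite ?conjC_eq0 // eq_complex /= gt_eqF.
  apply: (mulfI tbn); rewrite Hy mulr0 -/(K _ w) -/(K _ w2) -/(zt t).
  have -> : t%:C%C * I' * b^* * (a2 * t2^* * K (zt t) w - a * K (zt t) w2) =
     K (zt t) w * (a2 * (t%:C%C * I' * (t2^* * b^*))) - K (zt t) w2 * (a * (t%:C%C * I' * b^*)).
    by ring.
  by rewrite h subrr.
rewrite Hy ea1; rewrite -Ew2 in ea12; rewrite ea12 !hformZl ew ew2 => /eqP.
rewrite subr_eq0 => /eqP h.
have bn' : I' * t2^* * b^* != 0 by apply: mulf_neq0; [apply: mulf_neq0|]; rewrite ?conjC_eq0.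
apply: (mulfI bn').
have -> : I' * t2^* * b^* * (a1 * a2) = a2 * t2^* * (a1 * (I' * b^*)) by ring.
by rewrite h; ring.
Qed.

(** A base point on the line through [w] and [w2] compares [K z w / H z w] with [K z w2 / H z w2]
    only for null [z] orthogonal to it. By [eta_ratio] the constant found at parameter [2 / 3]
    serves all neighbouring parameters, which frees [z] from a single hyperplane. *)
Lemma pencil_ratio (w w2 : V) : nr (w - c0) < rho / 128 -> nr (w2 - c0) < rho / 128 ->
  hq w = 0 -> hq w2 = 0 -> H w w2 = 0 -> (forall c, w2 != c *: w) ->
  exists c, forall (l : C) z, nc (l - (2 / 3)%:C%C) <= 10^-1 -> nr (z - c0) < rho / 32 ->
    hq z = 0 -> H (w + l *: (w2 - w)) z = 0 -> K z w * H z w2 = c * (K z w2 * H z w).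
Proof.
move=> hw hw2 w0 w20 ww2 indep; have rp := rho0.
have wn : w != 0 by apply: ball_neq0; lra.
have [pl Epl] : exists pl, pl = fun l : C => w + l *: (w2 - w) by eexists.
have pl0 : pl 0 = w by rewrite Epl scale0r addr0.
have pl1 : pl 1 = w2 by rewrite Epl scale1r addrC subrK.
have dd : nr (w2 - w) < rho / 64 by apply: (ball_dist hw2 hw); lra.
have plb (l : C) : nc l <= 1 -> nr (pl l - c0) < rho / 32.
  move=> hl; have h : nr (l *: (w2 - w)) <= rho / 64.
    by rewrite nrZ; apply: le_trans (ltW dd); rewrite ler_piMl // nr_ge0.
  by rewrite Epl; apply: (ball_shift hw h); lra.
have plH (l m : C) : H (pl l) (pl m) = 0.
  rewrite Epl !(hformDl, hformDr, hformZl, hformZr, hformNl, hformNr) !hqE w0 w20 ww2 (hform_eq0C ww2).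
  by ring.
have plq (l : C) : hq (pl l) = 0 by rewrite /hq plH.
have pli (l m : C) : l != m -> forall c, pl l != c *: pl m.
  by move=> lm; rewrite Epl; apply: line_indep.
have pleta (l m : C) : nc l <= 1 -> nc m <= 1 -> l != m -> exists2 a, a != 0 & etaP (pl l) (pl m) a.
  move=> hl hm lm; apply: eta_exists => //; last exact: pli.
    by have := plb l hl; lra.
  by have := plb m hm; lra.
have [k Ek] : exists k : C, k = (2 / 3)%:C%C by eexists.
have nk : nc k = 2 / 3 by rewrite Ek nc_real ger0_norm //; lra.
have nk1 : nc k <= 1 by lra.
have k0 : k != 0 by rewrite -nc_gt0; lra.
have k1 : k != 1 by apply/eqP => E; move: nk; rewrite E nc1; lra.
have n01 : nc (0 : C) <= 1 by rewrite nc0.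
have n11 : nc (1 : C) <= 1 by rewrite nc1.
have [a1 a1n ea1] := pleta k 0 nk1 n01 k0.
have [a12 a12n ea12] := pleta k 1 nk1 n11 k1.
rewrite pl0 in ea1; rewrite pl1 in ea12.
rewrite -Ek; exists (a1 / a12) => l z hl hz z0 plz.
have nl : 17 / 30 <= nc l.
  by have := nc_sub_ge k (k - l); rewrite nc_distC in hl; rewrite subKr nk; lra.
have nk2 : nc (k - 1) = 3^-1.
  have -> : k - 1 = (- 3^-1)%:C%C.
    by rewrite Ek; apply/eqP; rewrite eq_complex /= subrr eqxx andbT; apply/eqP; field.
  by rewrite nc_real normrN ger0_norm //; lra.
have nl1 : nc (l - 1) <= 13 / 30.
  by have := ncD (l - k) (k - 1); rewrite addrA subrK nk2; lra.
have l0 : l != 0 by rewrite -nc_gt0; lra.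
have l1 : l != 1 by apply/eqP => E; move: hl; rewrite E nc_distC nk2; lra.
have nll1 : nc l <= 1 by have := ncD (l - k) k; rewrite subrK nk; lra.
(* Seen from the base point [pl l] with end [w], the vector [w2] has parameter [(l - 1) / l], of
   modulus at most 1 because [l] is close to [2 / 3]. *)
have Ew2 : pl l + ((l - 1) / l) *: (w - pl l) = w2.
  rewrite Epl opprD addrA subrr sub0r scalerN scalerA divfK // -scaleNr -addrA -scalerDl.
  by rewrite opprB addrCA subrr addr0 scale1r addrC subrK.
have nt2 : nc ((l - 1) / l) <= 1.
  rewrite ncM ncV ler_pdivrMr ?nc_gt0 // mul1r; apply: le_trans nl1 (le_trans _ nl).
  by rewrite ler_pM2r ?invr_gt0 ?ltr0n // ler_nat.
have pw (m : C) : H (pl m) w = 0 by rewrite -pl0.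
have hlb := plb l nll1; have hkb := plb k nk1.
have hw' : nr (w - c0) < rho / 32 by lra.
have hw2' : nr (w2 - c0) < rho / 32 by lra.
have [a [a2 [ea ea2 a2n rel]]] : exists a a2, [/\ etaP (pl l) w a, etaP (pl l) w2 a2, a2 != 0 &
    a1 * a2 = a12 * a].
  have [->|lk] := eqVneq l k; first by exists a1, a12; split=> //; rewrite mulrC.
  have [a an ea] := pleta l 0 nll1 n01 l0; have [a2 a2n ea2] := pleta l 1 nll1 n11 l1.
  rewrite pl0 in ea; rewrite pl1 in ea2; exists a, a2; split=> //.
  have kl : k - l != 0 by rewrite subr_eq0 eq_sym.
  apply: (@eta_ratio (pl l) (pl k) w (- l / (k - l)) ((l - 1) / l)); rewrite ?Ew2 //.
  - by apply: pli; rewrite eq_sym.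
  - by apply/rowP => j; rewrite Epl !mxE; field.
  - by rewrite mulf_neq0 ?oppr_eq0 ?invr_eq0.
  - by rewrite mulf_neq0 ?invr_eq0 ?subr_eq0.
have plz' : H (pl l) z = 0 by rewrite Epl.
have := @pencil_limit_eta (pl l) z w ((l - 1) / l) a a2 hlb hz hw'.
rewrite Ew2 => /(_ hw2' (plq l) z0 w0 plz' (pw l) nt2 ea ea2) h.
apply: (mulfI (mulf_neq0 a2n a12n)).
have -> : a2 * a12 * (K z w * H z w2) = a12 * (K z w * (a2 * H z w2)) by ring.
rewrite h.
have -> : a12 * (K z w2 * (a * H z w)) = (a12 * a) * (K z w2 * H z w) by ring.
by rewrite -rel; field.
Qed.

(** By [pencil_base] the null vectors covered by [pencil_ratio] fill a neighborhood of [z0] in the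
    cone, and [null_identity] extends the relation to a full ball. *)
Lemma null_pair_ratio (w w2 : V) : nr (w - c0) < rho / 128 -> nr (w2 - c0) < rho / 128 ->
  hq w = 0 -> hq w2 = 0 -> H w w2 = 0 -> (forall c, w2 != c *: w) ->
  exists c, forall z, nr (z - c0) < rho / 8 -> K z w * H z w2 = c * (K z w2 * H z w).
Proof.
move=> hw hw2 w0 w20 ww2 indep; have rp := rho0.
have [c hc] := pencil_ratio hw hw2 w0 w20 ww2 indep.
exists c.
have wn : w != 0 by apply: ball_neq0; lra.
have dl0 : 0 < rho / 256 by lra.
have [z0 [d [d0 z00 hz0 Hz0]]] := pencil_base dl0 wn w0 w20 ww2 indep.
have hz0c : nr (z0 - c0) < 7 * rho / 256.
  have dd : nr (w2 - w) < rho / 64 by apply: (ball_dist hw2 hw); lra.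
  apply: le_lt_trans (nr_triangle z0 w c0) _; lra.
have hz08 : nr (z0 - c0) < rho / 8 by lra.
have z0n : z0 != 0 by apply: ball_neq0; lra.
have dm : 0 < Num.min d (rho / 256) by rewrite lt_min d0.
have [f Ef] : exists f, f = fun z => K z w * H z w2 - c * (K z w2 * H z w) by eexists.
have hf x : nr (x - c0) < rho -> lholo f x.
  move=> hx; rewrite Ef; apply: lholoB.
    by apply: lholoM; [exact: K_lholo dG _ _ hx|exact: hform_lholo].
  apply: lholoM; first exact: lholo_cst.
  by apply: lholoM; [exact: K_lholo dG _ _ hx|exact: hform_lholo].
have f0 x : nr (x - z0) < Num.min d (rho / 256) -> hq x = 0 -> f x = 0.
  rewrite lt_min Ef => /andP[/Hz0[l hl lx] hx] x0; apply/eqP; rewrite subr_eq0; apply/eqP.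
  apply: (hc l) => //; apply: le_lt_trans (nr_triangle x z0 c0) _; lra.
move=> z hz; apply/eqP; rewrite -subr_eq0; apply/eqP.
by have := null_identity rho0 hf hz08 dm z00 z0n f0 hz; rewrite Ef.
Qed.

End Transversal.

Section ChainPoint.
Variables (R : realType) (r s : nat).
Local Notation C := R[i].
Local Notation I' := ('i%C : C).
Local Notation V := ('rV[C]_(r + s + 0)).
Local Notation H := (@hform R r s 0).

(* Near [w0 = c0 + eps e_1 + i eps^2 f_0] every null [w1] is joined to [c0] through
   [w3 = c0 + y f_1], orthogonal to both. *)
Lemma chain_point (c0 : V) (dl : R) : (1 < r)%N -> (r <= s)%N -> hq c0 = 0 -> c0 != 0 ->
  0 < dl -> dl <= nr c0 -> exists w0 d, [/\ 0 < d, hq w0 = 0, nr (w0 - c0) < dl &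
  forall w1 : V, nr (w1 - w0) < d -> hq w1 = 0 -> nr (w1 - c0) < dl /\
  exists w3, [/\ nr (w3 - c0) < dl, hq w3 = 0, H w1 w3 = 0, H w3 c0 = 0 &
    (forall k, w3 != k *: w1) /\ (forall k, c0 != k *: w3)]].
Proof.
move=> r1 rs c00 cn dl0 dlc.
have r0 : (0 < r)%N by apply: ltnW.
have [e [f [F e0]]] := frame_at cn c00 r0 rs.
have [n1 n2 n3 n4] : [/\ 0 <= nr c0, 0 <= nr (e 1%N), 0 <= nr (f 0%N) & 0 <= nr (f 1%N)].
  by split; exact: nr_ge0.
have [M [M0 Mc Me Mf Mf1]] : exists M, [/\ 0 < M, nr c0 <= M, nr (e 1%N) + nr (f 0%N) <= M,
    nr (f 1%N) <= M & 0 <= M].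
  by exists (1 + nr c0 + nr (e 1%N) + nr (f 0%N) + nr (f 1%N)); split; lra.
have rq : 0 < dl / 8 by lra.
have [eps [eps0 eps1 epM _]] := @small_scale R 1 (dl / 8) M 0 ltr01 rq Mf1 (lexx 0).
have ee0 : 0 < eps * eps by rewrite mulr_gt0.
have ee1 : eps * eps <= eps by rewrite ler_piMr // ltW.
have ee2 : 0 < eps * eps / 2 by lra.
have [d [d0 dr dM _]] := @small_scale R (dl / 8) (eps * eps / 2) M 0 rq ee2 Mf1 (lexx 0).
have [c0c0 [c0e1 c0f0 c0f1]] : H c0 c0 = 0 /\ [/\ H c0 (e 1%N) = 0, H c0 (f 0%N) = 1 & H c0 (f 1%N) = 0].
  have [h1 _ h2] := F 0%N 0%N r0 r0; have [h3 _ h4] := F 0%N 1%N r0 r1.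
  by rewrite -e0 h1 h2 h3 h4.
have [e1e1 [f0f0 f1f1] [e1f0 e1f1]] : [/\ H (e 1%N) (e 1%N) = 0,
    H (f 0%N) (f 0%N) = 0 /\ H (f 1%N) (f 1%N) = 0 & H (e 1%N) (f 0%N) = 0 /\ H (e 1%N) (f 1%N) = 1].
  have [h1 h2 h3] := F 1%N 1%N r1 r1; have [_ h4 _] := F 0%N 0%N r0 r0.
  by have [_ _ h5] := F 1%N 0%N r1 r0; rewrite h1 h2 h3 h4 h5.
have f1f0 : H (f 1%N) (f 0%N) = 0 by have [_ h _] := F 1%N 0%N r1 r0.
have [w0 Ew0] : exists w0, w0 = c0 + (eps%:C%C *: e 1%N + (I' * (eps * eps)%:C%C) *: f 0%N) by eexists.
have c0w0 : H c0 w0 = (I' * (eps * eps)%:C%C)^*.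
  by rewrite Ew0 !hformDr !hformZr c0c0 c0e1 c0f0 mulr0 !add0r mulr1.
have f1w0 : H (f 1%N) w0 = eps%:C%C.
  rewrite Ew0 !hformDr !hformZr (hform_eq0C c0f1) f1f0 mulr0 add0r addr0.
  by rewrite (hformC (e 1%N)) e1f1 rmorph1 mulr1 conjE conjc_real.
have w00 : hq w0 = 0.
  rewrite Ew0 hqD c00 add0r hformDr !hformZr c0e1 c0f0 mulr0 add0r mulr1.
  rewrite /hq !(hformDl, hformDr, hformZl, hformZr) e1e1 e1f0 f0f0 (hform_eq0C e1f0).
  by rewrite !mulr0 !addr0 conjE /=; ring.
have hw0 : nr (w0 - c0) <= dl / 8.
  rewrite Ew0 addrAC subrr add0r; apply: le_trans (nrD _ _) _; rewrite !nrZ ncM nc_i mul1r !nc_real.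
  rewrite !gtr0_norm //; apply: le_trans epM.
  have h : eps * eps * nr (f 0%N) <= eps * nr (f 0%N) by rewrite ler_wpM2r.
  have : eps * (nr (e 1%N) + nr (f 0%N)) <= eps * M by rewrite ler_wpM2l // ltW.
  lra.
have nw0 : nc (H c0 w0) = eps * eps.
  by rewrite c0w0 nc_conjC ncM nc_i mul1r nc_real gtr0_norm.
have nfw0 : nc (H (f 1%N) w0) = eps by rewrite f1w0 nc_real gtr0_norm.
exists w0, d; split=> // [|w1 hw1 w10]; first by clear -hw0 dl0; lra.
have [u Eu] : exists u, u = w1 - w0 by eexists.
have Ew1 : w1 = w0 + u by rewrite Eu addrC subrK.
rewrite -Eu in hw1; have nu := nr_ge0 u.
have Md : M * nr u <= eps * eps / 2 by apply: le_trans dM; rewrite ler_wpM2l // ltW.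
have b1 : nc (H c0 u) <= eps * eps / 2.
  by apply: le_trans (hform_le _ _) _; apply: le_trans Md; rewrite ler_wpM2r.
have b2 : nc (H (f 1%N) u) <= eps * eps / 2.
  by apply: le_trans (hform_le _ _) _; apply: le_trans Md; rewrite ler_wpM2r.
have c1 : nc (H c0 w1) <= 2 * (eps * eps).
  by rewrite Ew1 hformDr; have := ncD (H c0 w0) (H c0 u); clear -nw0 b1 ee0; lra.
have c2 : eps * eps / 2 <= nc (H c0 w1).
  by rewrite Ew1 hformDr; have := nc_sub_ge (H c0 w0) (- H c0 u); rewrite opprK ncN; clear -nw0 b1 ee0; lra.
have c3 : eps / 2 <= nc (H (f 1%N) w1).
  rewrite Ew1 hformDr; have := nc_sub_ge (H (f 1%N) w0) (- H (f 1%N) u).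
  by rewrite opprK ncN; clear -nfw0 b2 ee1 eps0; lra.
have fn : H (f 1%N) w1 != 0 by rewrite -nc_gt0; clear -c3 eps0; lra.
have cwn : H c0 w1 != 0 by rewrite -nc_gt0; clear -c2 ee0; lra.
(* The numerator is of order [eps ^ 2] and the denominator of order [eps], so [y] is [O(eps)] and
   [w3] stays close to [c0]. *)
have [y Ey] : exists y, y = - H c0 w1 / H (f 1%N) w1 by eexists.
have yn : y != 0 by rewrite Ey mulf_neq0 ?oppr_eq0 ?invr_eq0.
have ny : nc y <= 4 * eps.
  rewrite Ey ncM ncN ncV; clear -c1 c3 eps0; rewrite ler_pdivrMr; last by lra.
  have : 4 * eps * (eps / 2) <= 4 * eps * nc (H (f 1%N) w1) by rewrite ler_wpM2l //; lra.
  lra.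
have [w3 Ew3] : exists w3, w3 = c0 + y *: f 1%N by eexists.
have hw3 : nr (w3 - c0) < dl.
  rewrite Ew3 addrAC subrr add0r nrZ.
  have : nc y * nr (f 1%N) <= 4 * eps * M by apply: ler_pM; rewrite ?nc_ge0.
  clear -epM dl0; lra.
have w30 : hq w3 = 0 by rewrite Ew3; apply: pencil_null => //; rewrite /hq f1f1.
have c0w3 : H c0 w3 = 0 by rewrite Ew3 hformDr hformZr c0f1 c0c0 mulr0 addr0.
have w3w1 : H w3 w1 = 0 by rewrite Ew3 hformDl hformZl Ey divfK // subrr.
have w3n : w3 != 0 by apply: contraTneq (lt_le_trans hw3 dlc) => ->; rewrite sub0r nrN ltxx.
split.
  by apply: le_lt_trans (nr_triangle w1 w0 c0) _; rewrite -Eu; clear -hw1 hw0 dr dl0; lra.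
exists w3; split=> //; first exact: hform_eq0C.
  exact: hform_eq0C.
split.
- move=> k; apply: contraNneq w3n => E; move: c0w3.
    rewrite E hformZr => /eqP; rewrite mulf_eq0 (negPf cwn) orbF conjC_eq0 => /eqP ->.
    by rewrite scale0r.
- move=> k; apply/eqP => E; have := c0e1; have := c0f0.
    rewrite E Ew3 !(hformZl, hformDl) c0f0 f1f0 c0e1 (hformC (e 1%N)) e1f1 rmorph1 mulr0 addr0 mulr1.
    by move=> ->; rewrite add0r mul1r mulr1 => /eqP; rewrite (negPf yn).
Qed.

End ChainPoint.

(** * The conformal factor *)

Section LocalForm.
Variables (R : realType) (r s r' s' t' : nat).
Local Notation C := R[i].
Local Notation I' := ('i%C : C).
Local Notation V := ('rV[C]_(r + s + 0)).
Local Notation V' := ('rV[C]_(r' + s' + t')).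
Local Notation H := (@hform R r s 0).
Local Notation H' := (@hform R r' s' t').
Implicit Types (p u v w x z : V).
Variables (G : V -> V') (A : V -> 'M[C]_(r + s + 0, r' + s' + t')) (c0 : V) (rho : R) (v0 : V).
Hypothesis rho0 : 0 < rho.
Hypothesis dG : forall x, nr (x - c0) < rho -> gder G x (A x).
Hypothesis Gnull : forall x, nr (x - c0) < rho -> hq x = 0 -> hq (G x) = 0.
Hypothesis Gpos : forall x, nr (x - c0) < rho -> 0 < hq x -> 0 < hq (G x).
Hypothesis r1 : (1 < r)%N.
Hypothesis rs : (r <= s)%N.
Hypothesis r'r : (r' <= 2 * r - 2)%N.
Hypothesis rhoc : rho <= nr c0.
Hypothesis c00 : hq c0 = 0.
Hypothesis transv : forall p w, nr (p - c0) < rho -> nr (w - c0) < rho ->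
  H' (v0 *m A p) (G w) != 0.

Local Notation K := (pulled_form G).

Lemma vcont_id p : vcont id p.
Proof. by move=> e e0; exists e. Qed.

Lemma hform_neq0_near z w : H z w != 0 -> exists2 d, 0 < d &
  forall x y, nr (x - z) < d -> nr (y - w) < d -> H x y != 0.
Proof.
by move=> zw; apply: jcont_neq0 => //; apply: (jcont_hform (f := id) (g := id)); exact: vcont_id.
Qed.

(** The ratios from [w1] to [w3] and from [w3] to [c0] are composed. The composite carries a factor
    [H z w3], cancelled on an open set where it is nonzero; [open_identity] restores the other
    points. *)
Lemma chain_ratio w1 w3 : nr (w1 - c0) < rho / 128 -> nr (w3 - c0) < rho / 128 ->
  hq w1 = 0 -> hq w3 = 0 -> H w1 w3 = 0 -> H w3 c0 = 0 ->
  (forall c, w3 != c *: w1) -> (forall c, c0 != c *: w3) ->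
  exists c, forall z, nr (z - c0) < rho / 8 -> K z w1 * H z c0 = c * (K z c0 * H z w1).
Proof.
move=> h1 h3 w10 w30 w13 w3c i1 i2; have rp := rho0.
have hc : nr (c0 - c0) < rho / 128 by rewrite subrr nr0 divr_gt0.
have [a ha] := @null_pair_ratio _ _ _ _ _ _ _ _ _ _ v0 rho0 dG Gnull r1 rs r'r rhoc transv
  w1 w3 h1 h3 w10 w30 w13 i1.
have [b hb] := @null_pair_ratio _ _ _ _ _ _ _ _ _ _ v0 rho0 dG Gnull r1 rs r'r rhoc transv
  w3 c0 h3 hc w30 c00 w3c i2.
exists (a * b).
have w3n : w3 != 0 by apply: (ball_neq0 rhoc); lra.
have [e ew] := hform_nondeg w3n.
have [|eps [eps0 epe _ _]] := @small_scale R (rho / 16 / (nr e + 1)) 1 0 0 _ ltr01 (lexx 0) (lexx 0).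
  by rewrite !divr_gt0 //; have := nr_ge0 e; lra.
have ne := nr_ge0 e.
have hz1 : nr (c0 + (eps%:C%C *: e) - c0) < rho / 8.
  rewrite addrAC subrr add0r nrZ nc_real gtr0_norm //.
  move: epe; rewrite ler_pdivlMr; last by lra.
  by have : eps * nr e <= eps * (nr e + 1) by [rewrite ler_wpM2l ?ltW // ltrDl]; lra.
have [z1 [hz z1w]] : exists z1, nr (z1 - c0) < rho / 8 /\ H z1 w3 != 0.
  exists (c0 + eps%:C%C *: e); split=> //.
  by rewrite hformDl (hform_eq0C w3c) add0r hformZl ew mulr1 eq_complex /= gt_eqF.
have [d d0 Hd] := hform_neq0_near z1w.
move=> z hz'; apply/eqP; rewrite -subr_eq0; apply/eqP; move: z hz'.
apply: (@open_identity _ _ _ (fun z => K z w1 * H z c0 - a * b * (K z c0 * H z w1)) c0 rho rho0 _ z1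
   (Num.min d (rho / 8 - nr (z1 - c0)))) => //.
- move=> x hx; apply: lholoB; first by apply: lholoM; [exact: K_lholo dG _ _ hx|exact: hform_lholo].
  apply: lholoM; first exact: lholo_cst.
  by apply: lholoM; [exact: K_lholo dG _ _ hx|exact: hform_lholo].
- by rewrite lt_min d0 subr_gt0.
move=> x; rewrite lt_min => /andP[hx hx2].
have hxc : nr (x - c0) < rho / 8 by apply: le_lt_trans (nr_triangle x z1 c0) _; lra.
apply: (mulfI (Hd x w3 hx _)); first by rewrite subrr nr0.
have ea := ha x hxc; have eb := hb x hxc.
have -> : H x w3 * (K x w1 * H x c0 - a * b * (K x c0 * H x w1)) =
  (K x w1 * H x w3) * H x c0 - a * (b * (K x c0 * H x w3)) * H x w1 by ring.
by rewrite ea -eb; ring.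
Qed.

(** The constant of [chain_ratio] depends on [w]; eliminating it between [z] and [z1] leaves an
    identity antiholomorphic in [w], valid for null [w] near [w0]. Its conjugate extends by
    [null_identity]. *)
Lemma triple_ratio z z1 w : nr (z - c0) < rho / 8 -> nr (z1 - c0) < rho / 8 ->
  nr (w - c0) < rho / 8 ->
  K z w * K z1 c0 * H z c0 * H z1 w = K z c0 * K z1 w * H z w * H z1 c0.
Proof.
move=> hz hz1 hw; have rp := rho0.
have cn : c0 != 0 by apply: (ball_neq0 rhoc); rewrite subrr nr0.
have dl0 : 0 < rho / 128 by lra.
have dlc : rho / 128 <= nr c0 by have := rhoc; lra.
have [w0 [d [d0 w00 hw0 Hw]]] := chain_point r1 rs c00 cn dl0 dlc.
have main w1 : nr (w1 - w0) < d -> hq w1 = 0 ->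
    K z w1 * K z1 c0 * H z c0 * H z1 w1 = K z c0 * K z1 w1 * H z w1 * H z1 c0.
  move=> /Hw h /[dup] w10 /h[hw1 [w3 [hw3 w30 w13 w3c [i1 i2]]]].
  have [k hk] := chain_ratio hw1 hw3 w10 w30 w13 w3c i1 i2.
  have ez := hk z hz; have ez1 := hk z1 hz1.
  have -> : K z w1 * K z1 c0 * H z c0 * H z1 w1 = (K z w1 * H z c0) * (K z1 c0 * H z1 w1) by ring.
  have -> : K z c0 * K z1 w1 * H z w1 * H z1 c0 = (K z1 w1 * H z1 c0) * (K z c0 * H z w1) by ring.
  by rewrite ez ez1; ring.
have E (x : V) : K x z * (K z1 c0 * H z c0)^* * H x z1 - (K z c0 * H z1 c0)^* * (K x z1 * H x z) =
    (K z x * K z1 c0 * H z c0 * H z1 x - K z c0 * K z1 x * H z x * H z1 c0)^*.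
  by rewrite rmorphB !rmorphM /= -!KC -!hformC; ring.
apply/eqP; rewrite -subr_eq0 -conjC_eq0 -E; apply/eqP.
apply: (@null_identity _ _ _ (fun x => K x z * (K z1 c0 * H z c0)^* * H x z1 - (K z c0 * H z1 c0)^* * (K x z1 * H x z))
    c0 rho rho0 _ w0 d) => //.
- move=> x hx; apply: lholoB.
    apply: lholoM; [apply: lholoM; [exact: K_lholo dG _ _ hx|exact: lholo_cst]|exact: hform_lholo].
  apply: lholoM; first exact: lholo_cst.
  by apply: lholoM; [exact: K_lholo dG _ _ hx|exact: hform_lholo].
- lra.
- by apply: (ball_neq0 rhoc); lra.
by move=> x hx x0; rewrite E main // subrr rmorph0.
Qed.

(** By [triple_ratio], [K z w] is determined by [K z c0 / H z c0] and [K x0 w], and [K x0 w] in turn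
    by [K w c0 / H w c0]. The point [x0] is chosen positive so that the remaining constant is a
    positive real. *)
Lemma local_form : exists x0 d (g : V -> C), [/\ 0 < d, nr (x0 - c0) + d <= rho / 8,
  forall z, nr (z - x0) < d -> g z != 0 &
  forall z w, nr (z - x0) < d -> nr (w - x0) < d -> K z w = g z * (g w)^* * H z w].
Proof.
have rp := rho0.
have hc : nr (c0 - c0) < rho by rewrite subrr nr0.
have cn : c0 != 0 by apply: (ball_neq0 rhoc).
have [f [f0 fc]] := null_dual cn c00.
have rq : 0 < rho / 16 by lra.
have [eps [eps0 _ epe _]] := @small_scale R 1 (rho / 16) (nr f) 0 ltr01 rq (nr_ge0 f) (lexx 0).
have [x0 Ex0] : exists x0, x0 = c0 + eps%:C%C *: f by eexists.
have hx0 : nr (x0 - c0) <= rho / 16.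
  by rewrite Ex0 addrAC subrr add0r nrZ nc_real gtr0_norm // mulrC.
have x0c : H x0 c0 = eps%:C%C by rewrite Ex0 hformDl hformZl fc hqE c00 add0r mulr1.
have qx0 : 0 < hq x0.
  rewrite Ex0 hqD c00 hqZ f0 mulr0 !add0r hformZr (hformC f) fc rmorph1 mulr1 conjE /=.
  by rewrite mulr_gt0.
have x0cn : H x0 c0 != 0 by rewrite x0c eq_complex /= gt_eqF.
have x0x0 : H x0 x0 != 0 by rewrite hqE eq_complex /= gt_eqF.
have qG : 0 < hq (G x0) by apply: Gpos => //; lra.
have Kx0 : K x0 x0 != 0 by rewrite /pulled_form hqE eq_complex /= gt_eqF.
have hx8 : nr (x0 - c0) < rho / 8 by lra.
have Ka : K x0 c0 != 0.
  (* If [K x0 c0 = 0], [triple_ratio] at [z1 = w = x0] makes [K z c0] vanish near [x0], hence on the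
     ball around [c0], against transversality at [c0]. *)
  apply/negP => /eqP a0.
  have [d d0 Hd] := hform_neq0_near x0x0.
  have Kz z : nr (z - c0) < rho / 8 -> K z c0 = 0.
    apply: (@open_identity _ _ _ (fun z => K z c0) c0 rho rho0 _ x0 (Num.min d (rho / 16))) => //.
    - by move=> x hx; exact: K_lholo dG _ _ hx.
    - by rewrite lt_min d0.
    move=> x; rewrite lt_min => /andP[hx hx1].
    have hxc : nr (x - c0) < rho / 8 by apply: le_lt_trans (nr_triangle x x0 c0) _; lra.
    have := triple_ratio hxc hx8 hx8; rewrite a0 mulr0 !mul0r => /esym/eqP.
    rewrite !mulf_eq0 (negPf Kx0) (negPf x0cn) !orbF.
    by rewrite (negPf (Hd x x0 hx _)) ?subrr ?nr0 // orbF => /eqP.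
  have := transv hc hc; rewrite (@ray_zero _ _ _ _ _ _ G A c0 rho dG c0 v0 (G c0) (rho / 8 / (nr v0 + 1)) hc) ?eqxx //.
  - by rewrite divr_gt0 //; have := nr_ge0 v0; lra.
  - by rewrite -/(K c0 c0) Kz // subrr nr0; lra.
  move=> t /andP[t0]; have nv := nr_ge0 v0; rewrite ltr_pdivlMr; last by lra.
  move=> tv; apply: Kz; rewrite addrAC subrr add0r nrZ nc_real gtr0_norm //.
  have : t * nr v0 <= t * (nr v0 + 1) by rewrite ler_wpM2l ?ltW // ltrDl.
  lra.
have [d1 d10 Hd1] := hform_neq0_near x0cn.
have [d2 d20 Hd2] := hform_neq0_near x0x0.
have [d3 d30 Hd3] : exists2 d, 0 < d & forall x, nr (x - x0) < d -> K x c0 != 0.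
  have hx1 : nr (x0 - c0) < rho by lra.
  have [d d0 Hd] := jcont_neq0 (jcont_hform (gder_vcont (dG hx1)) (gder_vcont (dG hc))) Ka.
  by exists d => // x hx; apply: Hd; rewrite ?subrr ?nr0.
(* [q] equals 1 at [x0]; the constant [hq (G x0) / hq x0] is shared between the two arguments
   through its square root. *)
have [q Eq] : exists q, q = fun z => K z c0 / H z c0 / (K x0 c0 / H x0 c0) by eexists.
exists x0, (Num.min (Num.min d1 d2) (Num.min d3 (rho / 16))).
exists (fun z => (Num.sqrt (hq (G x0) / hq x0))%:C%C * q z).
have kap0 : 0 < hq (G x0) / hq x0 by rewrite divr_gt0.
split.
- by rewrite !lt_min d10 d20 d30.
- have : Num.min (Num.min d1 d2) (Num.min d3 (rho / 16)) <= rho / 16 by rewrite !ge_min lexx !orbT.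
  lra.
- move=> z; rewrite !lt_min => /andP[/andP[h1 h2] /andP[h3 h4]].
  rewrite mulf_neq0 //; first by rewrite eq_complex /= gt_eqF // sqrtr_gt0.
  rewrite Eq mulf_neq0 ?invr_eq0 //; last by rewrite mulf_neq0 ?invr_eq0.
  by rewrite mulf_neq0 ?invr_eq0 ?Hd3 // Hd1 // subrr nr0.
have Kq w : nr (w - x0) < Num.min (Num.min d1 d2) (Num.min d3 (rho / 16)) ->
    [/\ nr (w - c0) < rho / 8, H w c0 != 0, H w x0 != 0 & K w x0 = q w * (hq (G x0) / hq x0)%:C%C * H w x0].
  rewrite !lt_min => /andP[/andP[h1 h2] /andP[h3 h4]].
  have hw : nr (w - c0) < rho / 8 by apply: le_lt_trans (nr_triangle w x0 c0) _; lra.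
  have wc : H w c0 != 0 by apply: Hd1; rewrite // subrr nr0.
  have wx : H w x0 != 0 by apply: Hd2; rewrite // subrr nr0.
  split=> //; have h := triple_ratio hw hx8 hx8.
  have k1 : (hq (G x0) / hq x0)%:C%C = K x0 x0 / H x0 x0 by rewrite /pulled_form !hqE rmorphM fmorphV.
  apply: (mulfI (mulf_neq0 (mulf_neq0 Ka wc) x0x0)).
  rewrite k1 Eq.
  have -> : K x0 c0 * H w c0 * H x0 x0 * K w x0 = K w x0 * K x0 c0 * H w c0 * H x0 x0 by ring.
  rewrite h; field.
  by rewrite Ka wc x0x0 x0cn.
move=> z w hz hw; have [hz8 zc zx _] := Kq z hz; have [hw8 wc wx Kw] := Kq w hw.
have h := triple_ratio hz8 hx8 hw8.
have xw : H x0 w != 0 by rewrite hform_neq0C.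
have cM (a b : C) : (a * b)^* = a^* * b^* by exact: rmorphM.
have Kxw : K x0 w = (q w)^* * (hq (G x0) / hq x0)%:C%C * H x0 w.
  have kc : ((hq (G x0) / hq x0)%:C%C)^* = (hq (G x0) / hq x0)%:C%C :> C by rewrite conjE conjc_real.
  by rewrite KC Kw !cM kc -hformC.
have sq : (hq (G x0) / hq x0)%:C%C = (Num.sqrt (hq (G x0) / hq x0))%:C%C * (Num.sqrt (hq (G x0) / hq x0))%:C%C :> C.
  by rewrite -rmorphM -expr2 sqr_sqrtr // ltW.
have sqc : ((Num.sqrt (hq (G x0) / hq x0))%:C%C)^* = (Num.sqrt (hq (G x0) / hq x0))%:C%C :> C.
  by rewrite conjE conjc_real.
rewrite cM sqc; apply: (mulfI (mulf_neq0 (mulf_neq0 Ka zc) xw)).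
have -> : K x0 c0 * H z c0 * H x0 w * K z w = K z w * K x0 c0 * H z c0 * H x0 w by ring.
rewrite h Kxw sq; move: (q w)^* => cw; rewrite Eq; field.
by rewrite ?Ka ?zc ?x0cn.
Qed.

End LocalForm.

(** * Splitting and globalization *)

Section Splitting.
Variables (R : realType) (r s r' s' t' : nat).
Local Notation C := R[i].
Local Notation n := (r + s + 0)%N.
Local Notation n' := (r' + s' + t')%N.
Local Notation V := ('rV[C]_(r + s + 0)).
Local Notation V' := ('rV[C]_(r' + s' + t')).
Local Notation H := (@hform R r s 0).
Local Notation H' := (@hform R r' s' t').

Lemma hform_delta (u : V) (j : 'I_n) : H u (delta_mx 0 j) = sgn_coef R r s j * u 0 j.
Proof.
rewrite /hform (bigD1 j) //= big1 ?addr0 => [|i ij].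
  by rewrite mxE !eqxx rmorph1 mulr1.
by rewrite mxE (negPf ij) andbF rmorph0 mulr0.
Qed.

Lemma sgn_coef_sqr (j : 'I_n) : sgn_coef R r s j * sgn_coef R r s j = 1.
Proof.
rewrite /sgn_coef; case: ifP => _; first by rewrite mulr1.
by have := ltn_ord j; rewrite [in X in (_ < X)%N]addn0 => ->; rewrite mulrNN mulr1.
Qed.

Lemma hform_rows (u : V) (x : V) : H u x = \sum_j (x 0 j)^* * H u (delta_mx 0 j).
Proof.
by apply: eq_bigr => j _; rewrite hform_delta mulrC.
Qed.

Lemma mulmx_hformr (v : V') (x : V) (L : 'M[C]_(n, n')) :
  H' v (x *m L) = \sum_j (x 0 j)^* * H' v (row j L).
Proof.
by rewrite mulmx_sum_row hform_sumr; apply: eq_bigr => j _; rewrite hformZr.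
Qed.

Section Isometry.
Variable L : 'M[C]_(n, n').
Hypothesis iso : lin_isometry L.

(** Its kernel is the orthogonal complement of the image of [L]. The rows of [L] stand in the second
    slot, so that the condition is linear in the vector. *)
Definition gram_mx : 'M[C]_(n', n) := \matrix_(j, i) H' (delta_mx 0 j) (row i L).

Lemma gram_mxE (v : V') i : (v *m gram_mx) 0 i = H' v (row i L).
Proof.
rewrite mxE [in RHS](row_sum_delta v) hform_suml; apply: eq_bigr => j _.
by rewrite hformZl mxE.
Qed.

Lemma sub_kergram (v : V') : (v <= kermx gram_mx)%MS <-> forall x : V, H' v (x *m L) = 0.
Proof.
split=> [/sub_kermxP h x|h].
  rewrite mulmx_hformr big1 // => j _.
  by rewrite -gram_mxE h mxE mulr0.
by apply/sub_kermxP/rowP => j; rewrite gram_mxE rowE h mxE.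
Qed.

(** The rows of [L] have the diagonal Gram matrix with entries [sgn_coef], which is its own inverse;
    this gives the coordinates of the orthogonal projection. *)
Lemma isometry_decomp (v : V') : exists u : V, (v - u *m L <= kermx gram_mx)%MS.
Proof.
exists (\row_j (sgn_coef R r s j * H' v (row j L))); apply/sub_kergram => x.
rewrite hformBl iso hform_rows mulmx_hformr -sumrB big1 // => j _.
by rewrite hform_delta mxE mulrA sgn_coef_sqr mul1r subrr.
Qed.

Lemma isometry_inj (u : V) : u *m L = 0 -> u = 0.
Proof.
move=> uL; apply: hform_inj => z; rewrite -iso uL !hform0r //.
Qed.

Lemma isometry_direct : mxdirect (<<L>> + kermx gram_mx)%MS.
Proof.
apply/mxdirect_addsP/eqP/rowV0P => v; rewrite sub_capmx genmxE => /andP[/submxP[u ->]].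
move=> /sub_kergram h; suff -> : u = 0 by rewrite mul0mx.
by apply: hform_inj => z; rewrite hform0r hformC -iso h rmorph0.
Qed.

Lemma isometry_full : row_full (<<L>> + kermx gram_mx)%MS.
Proof.
rewrite -sub1mx; apply/row_subP => i; have [u hu] := isometry_decomp (row i 1%:M).
rewrite -[row i _](addrNK (u *m L)) addrC; apply: addmx_sub_adds => //.
by rewrite genmxE submxMl.
Qed.

Lemma isometry_orth (a b : V') : (a <= <<L>>)%MS -> (b <= kermx gram_mx)%MS -> H' a b = 0.
Proof.
by rewrite genmxE => /submxP[u ->] /sub_kergram h; rewrite hformC h rmorph0.
Qed.

(* [N] is maximal among the null subspaces of the complement that are orthogonal to all [b i]. *)
Lemma null_span (I : Type) (b : I -> V') :
  (forall i, (b i <= kermx gram_mx)%MS) -> (forall i j, H' (b i) (b j) = 0) ->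
  exists N : 'M[C]_n', [/\ (N <= kermx gram_mx)%MS, null_space N & forall i, (b i <= N)%MS].
Proof.
move=> bB b0.
pose good (N : 'M[C]_n') := [/\ (N <= kermx gram_mx)%MS, null_space N &
  forall x i, (x <= N)%MS -> H' x (b i) = 0].
pose P k := `[< exists2 N, good N & \rank N = k >].
have exP : exists k, P k.
  exists 0%N; apply/asboolP; exists 0; last by rewrite mxrank0.
  split; first exact: sub0mx.
    by move=> x y; rewrite !submx0 => /eqP -> _; rewrite hform0l.
  by move=> x i; rewrite submx0 => /eqP ->; rewrite hform0l.
have bound k : P k -> (k <= n')%N by move=> /asboolP[N _ <-]; exact: rank_leq_row.
case: (ex_maxnP exP bound) => k /asboolP[N [NB N0 Nb] rN] kmax.
exists N; split=> // i; apply/negPn/negP => bi.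
have sub : (N <= N + b i)%MS by exact: addsmxSl.
have dec (x : V') : (x <= N + b i)%MS -> exists (y : V') (c : C), (y <= N)%MS /\ x = y + c *: b i.
  move=> /sub_addsmxP[[u v] /= ->]; exists (u *m N), (v 0 0); split; first exact: submxMl.
  by rewrite {1}[v]mx11_scalar mul_scalar_mx.
have good' : good (N + b i)%MS.
  split.
  - by rewrite addsmx_sub NB bB.
  - move=> x y /dec[x' [c [hx ->]]] /dec[y' [d [hy ->]]].
    rewrite !(hformDl, hformDr, hformZl, hformZr) (N0 _ _ hx hy) Nb // b0.
    by rewrite (hform_eq0C (Nb y' i hy)) !mulr0 !addr0.
  - move=> x j /dec[x' [c [hx ->]]].
    by rewrite hformDl hformZl Nb // b0 mulr0 addr0.
have := kmax _ (asboolT (ex_intro2 _ _ _ good' erefl)).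
rewrite -rN => le; move: bi; have := mxrank_leqif_sup sub => -[_].
rewrite eqn_leq le mxrankS // => /esym h.
by rewrite (submx_trans _ h) // addsmxSr.
Qed.

End Isometry.

(** The rows of [L] are difference quotients of [Ph]. Paired with values of [Ph] they behave as if
    [Ph] were linear, because forms are preserved. So [L] is an isometry, and the errors
    [Ph z - z *m L] are orthogonal to its image and to one another, as [null_span] requires. *)
Lemma local_splitting (x0 : V) (d : R) (Ph : V -> V') : 0 < d ->
  (forall z w, nr (z - x0) < d -> nr (w - x0) < d -> H' (Ph z) (Ph w) = H z w) ->
  exists L : 'M[C]_(n, n'), lin_isometry L /\
  exists N : 'M[C]_n', [/\ (N <= kermx (gram_mx L))%MS, null_space N &
    forall z, nr (z - x0) < d -> (Ph z - z *m L <= N)%MS].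
Proof.
move=> d0 hP.
have [eps eps0 epd] : exists2 eps : R, 0 < eps & eps < d by exists (d / 2); lra.
pose x (j : 'I_n) : V := x0 + eps%:C%C *: delta_mx 0 j.
have hx0 : nr (x0 - x0) < d by rewrite subrr nr0.
have ndelta (j : 'I_n) : nr (delta_mx 0 j : V) = 1.
  rewrite /nr (bigD1 j) //= big1 ?addr0 => [|i ij]; first by rewrite mxE !eqxx nc1.
  by rewrite mxE (negPf ij) andbF nc0.
have hx j : nr (x j - x0) < d.
  by rewrite /x addrAC subrr add0r nrZ ndelta mulr1 nc_real gtr0_norm.
have en : eps%:C%C != 0 :> C by rewrite eq_complex /= gt_eqF.
have ec : (eps%:C%C)^* = eps%:C%C :> C by rewrite conjE conjc_real.
pose L : 'M[C]_(n, n') := \matrix_j ((eps%:C%C)^-1 *: (Ph (x j) - Ph x0)).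
have PL z v : nr (z - x0) < d -> H' (Ph z) (v *m L) = H z v.
  move=> hz; rewrite mulmx_hformr hform_rows; apply: eq_bigr => j _; congr (_ * _).
  rewrite rowK hformZr hformBr !hP // -hformBr /x addrAC subrr add0r hformZr.
  by rewrite fmorphV /= ec mulKf.
have iso : lin_isometry L.
  move=> u v; rewrite [LHS]hformC mulmx_hformr rmorph_sum /= hformC hform_rows rmorph_sum /=.
  apply: eq_bigr => j _; congr (_ * _)^*; rewrite rowK hformZr hformBr.
  rewrite [H' _ (Ph (x j))]hformC [H' _ (Ph x0)]hformC !PL // -!hformC -hformBr.
  by rewrite /x addrAC subrr add0r hformZr fmorphV /= ec mulKf.
exists L; split=> //.
pose b (i : {z : V | nr (z - x0) < d}) : V' := Ph (sval i) - sval i *m L.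
have [||N [N1 N2 N3]] := @null_span L _ b.
- by case=> z hz; apply/sub_kergram => v; rewrite hformBl PL // iso subrr.
- case=> z hz [w hw]; rewrite /b /= hformBl !hformBr hP // PL // iso.
  by rewrite [H' _ (Ph w)]hformC PL // -hformC !subrr.
by exists N; split=> // z hz; exact: (N3 (exist _ z hz)).
Qed.

End Splitting.

Import numFieldNormedType.Exports.
Local Open Scope classical_set_scope.

(** * From the topology of the statement to real radii *)

Section Interface.
Variable (R : realType).
Local Notation C := R[i].
Local Notation N n := ('rV[C]_n : normedModType C).

Lemma real_pos (d : C) : 0 < d -> exists2 e : R, 0 < e & d = e%:C%C.
Proof.
case: d => a b; rewrite ltcE /= => /andP[/eqP b0 a0]; exists a => //.
by move: b0 => ->.
Qed.

Lemma mxnorm_le_nr n (x : N n) : `|x| <= (nr x)%:C%C.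
Proof.
have E0 : `|x| = mx_norm x by [].
rewrite E0; have [->|x0] := eqVneq (mx_norm x) 0; first by rewrite lecR nr_ge0.
have [[i j] E] := mx_norm_neq0 x0.
by rewrite E /= ord1 nc_normr lecR nr_coord.
Qed.

Lemma nr_le_mxnorm n (x : N n) : (nr x)%:C%C <= n%:R * `|x|.
Proof.
have h (j : 'I_n) : `|x 0 j| <= `|x|.
  have -> : `|x| = mx_norm x by [].
  rewrite /mx_norm -[leLHS]nngE num_le.
  exact: (@le_bigmax _ _ _ _ (fun i : 'I_1 * 'I_n => `|x i.1 i.2|%:nng) (0, j)).
rewrite /nr rmorph_sum /= (@le_trans _ _ (\sum_(j < n) `|x|)) //; last first.
  by rewrite sumr_const card_ord mulr_natl.
by apply: ler_sum => j _; rewrite -nc_normr.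
Qed.

Lemma nbhs_nrP n (x : N n) (W : set (N n)) :
  nbhs x W <-> exists2 d : R, 0 < d & forall y : 'rV[C]_n, nr (y - x) < d -> W y.
Proof.
split=> [/nbhs_ballP[d /= /real_pos[e e0 ->]] H|[d d0 H]].
  exists e => // y hy; apply: H; rewrite -ball_normE /ball_ /=.
  by rewrite distrC; apply: le_lt_trans (mxnorm_le_nr _) _; rewrite ltcR.
apply/nbhs_ballP; exists (d / n.+1%:R)%:C%C; first by rewrite /= ltcR divr_gt0.
move=> y; rewrite -ball_normE /ball_ /= distrC => hy; apply: H.
rewrite -ltcR; apply: le_lt_trans (nr_le_mxnorm _) _.
have n0 : (0 : C) < n.+1%:R by rewrite ltr0n.
have -> : d%:C%C = n.+1%:R * (d / n.+1%:R)%:C%C :> C.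
  by rewrite rmorphM fmorphV rmorph_nat /= mulrC divfK // gt_eqF.
apply: (@le_lt_trans _ _ (n.+1%:R * `|y - x|)); last by rewrite ltr_pM2l.
by rewrite ler_wpM2r // ler_nat.
Qed.

Lemma open_nrP n (W : set (N n)) :
  open W <-> forall x, W x -> exists2 d : R, 0 < d & forall y : 'rV[C]_n, nr (y - x) < d -> W y.
Proof.
rewrite openE; split=> H x Wx; first by apply/nbhs_nrP; exact: H.
by apply/nbhs_nrP; exact: H.
Qed.

Lemma differentiable_gder n m (G : N n -> N m) (x : N n) : differentiable G x ->
  exists A, gder (G : 'rV[C]_n -> 'rV[C]_m) x A.
Proof.
move=> dG; exists (lin1_mx ('d G x)) => e e0.
have /eqaddoP o := diff_locally dG.
have e1 : (0 : C) < (e / m.+1%:R)%:C%C by rewrite ltcR divr_gt0.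
have /nbhs_nrP[d d0 Hd] := o _ e1; exists d => // h hd.
have := Hd h; rewrite subr0 => /(_ hd) /=.
rewrite !fctE /= => oh; rewrite mul_rV_lin1 -lecR.
apply: le_trans (nr_le_mxnorm _) _.
apply: (@le_trans _ _ (m.+1%:R * `|G (x + h) - G x - 'd G x h|)).
  by rewrite ler_wpM2r // ler_nat.
have m0 : (0 : C) < m.+1%:R by rewrite ltr0n.
have -> : G (x + h) - G x - 'd G x h = G (h + x) - (G x + 'd G x h).
  by rewrite [x + h]addrC opprD addrA.
apply: (@le_trans _ _ (m.+1%:R * ((e / m.+1%:R)%:C%C * `|h|))); first by rewrite ler_pM2l.
rewrite mulrA !rmorphM fmorphV rmorph_nat /= mulrCA divff ?gt_eqF // mulr1.
by rewrite ler_wpM2l ?lecR ?(ltW e0) // mxnorm_le_nr.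
Qed.

(** Closedness is stated uniformly near each point of [U]: validity at one nearby point carries over
    to all of them, the form in which analytic continuation delivers it. *)
Lemma connected_closed_open n (U : set (N n)) (P : N n -> Prop) x0 :
  connected U -> open U -> U x0 -> P x0 ->
  (forall x, U x -> P x -> exists2 d : R, 0 < d & forall y : 'rV[C]_n, nr (y - x) < d -> P y) ->
  (forall x, U x -> exists2 d : R, 0 < d & forall y z : 'rV[C]_n,
     nr (y - x) < d -> nr (z - x) < d -> P y -> P z) ->
  forall x, U x -> P x.
Proof.
move=> cU oU Ux0 Px0 Popen Pclosed x Ux.
suff E : U `&` [set x | P x] = U by move: Ux; rewrite -{1}E => -[].
apply: cU; first by exists x0.
  exists (U `&` [set x | P x]); last by rewrite setIA setIid.
  apply/open_nrP => y [Uy Py]; have [d d0 Hd] := Popen y Uy Py.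
  have [d' d'0 Hd'] := (open_nrP U).1 oU y Uy.
  exists (Num.min d d'); first by rewrite lt_min d0.
  by move=> z; rewrite lt_min => /andP[/Hd ? /Hd' ?].
exists (~` (U `&` [set x | ~ P x])).
  rewrite closedC; apply/open_nrP => y [Uy Py]; have [d d0 Hd] := Pclosed y Uy.
  have [d' d'0 Hd'] := (open_nrP U).1 oU y Uy.
  exists (Num.min d d'); first by rewrite lt_min d0.
  move=> z; rewrite lt_min => /andP[zd /Hd' ?]; split=> // Pz; apply: Py.
  by apply: (Hd z) => //; rewrite subrr nr0.
apply/seteqP; split=> y [Uy Py]; split=> //; first by case.
by apply: contrapT => nPy; apply: Py.
Qed.

End Interface.

(** * Splitting as a holomorphic condition *)

Section Globalization.
Variables (R : realType) (r s r' s' t' : nat).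
Local Notation C := R[i].
Local Notation n := (r + s + 0)%N.
Local Notation n' := (r' + s' + t')%N.
Local Notation V := ('rV[C]_(r + s + 0)).
Local Notation V' := ('rV[C]_(r' + s' + t')).
Local Notation H := (@hform R r s 0).
Local Notation H' := (@hform R r' s' t').

(** The center moves from [c0] to a transversal null point [p]. By continuity of the derivative the
    pairing stays nonzero with both arguments varying near [p], as [local_form] requires. *)
Lemma lift_local_form (G : V -> V') (A : V -> 'M[C]_(n, n')) (c0 : V) (rho : R) :
  0 < rho -> (forall x, nr (x - c0) < rho -> gder G x (A x)) ->
  (forall x, nr (x - c0) < rho -> hq x = 0 -> hq (G x) = 0) ->
  (forall x, nr (x - c0) < rho -> 0 < hq x -> 0 < hq (G x)) ->
  (1 < r)%N -> (r <= s)%N -> (r' <= 2 * r - 2)%N -> c0 != 0 -> hq c0 = 0 ->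
  exists x0 d (g : V -> C), [/\ 0 < d, forall z, nr (z - x0) < d -> nr (z - c0) < rho,
    forall z, nr (z - x0) < d -> g z != 0 &
    forall z w, nr (z - x0) < d -> nr (w - x0) < d -> H' (G z) (G w) = g z * (g w)^* * H z w].
Proof.
move=> rho0 dG Gnull Gpos r1 rs r'r cn c00.
have r0 : (0 < r)%N by lia.
have r'r2 : (r' < 2 * r)%N by lia.
have nc0 : 0 < nr c0.
  by rewrite lt_neqAle nr_ge0 andbT eq_sym; apply: contra cn => /eqP /nr_eq0 ->.
have dl0 : 0 < Num.min (rho / 2) (nr c0 / 2) by rewrite lt_min !divr_gt0.
have [p [v [hp p0 pv]]] := transversal_null_point rho0 dG Gnull Gpos r0 rs r'r2 cn c00 dl0.
move: hp; rewrite lt_min => /andP[hp1 hp2].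
have r20 : 0 < rho / 2 by rewrite divr_gt0.
have sub x : nr (x - p) < rho / 2 -> nr (x - c0) < rho.
  by move=> hx; apply: le_lt_trans (nr_triangle x p c0) _; lra.
have np : nr c0 / 2 <= nr p.
  have := nr_triangle c0 p 0; rewrite !subr0 nr_distC; lra.
have hpp : nr (p - c0) < rho by lra.
have cv : vcont (fun x => v *m A x) p.
  by apply: (gder_cont r20) => x /sub; exact: dG.
have [d1 d10 Hd1] := jcont_neq0 (jcont_hform cv (gder_vcont (dG p hpp))) pv.
have [rho2 [rho20 h1 h2 h3]] : exists rho2, [/\ 0 < rho2, rho2 <= rho / 2, rho2 <= d1 & rho2 <= nr p].
  exists (Num.min (Num.min (rho / 2) d1) (nr p)); rewrite !lt_min !ge_min !lexx !orbT r20 d10.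
  by split=> //=; lra.
have sub2 x : nr (x - p) < rho2 -> nr (x - c0) < rho by move=> hx; apply: sub; lra.
have [x0 [d [g [d0 hx0 gn Kg]]]] := @local_form _ _ _ _ _ _ G A p rho2 v rho20
  (fun x hx => dG x (sub2 x hx)) (fun x hx => Gnull x (sub2 x hx))
  (fun x hx => Gpos x (sub2 x hx)) r1 rs r'r h3 p0
  (fun x w hx hw => Hd1 x w (lt_le_trans hx h2) (lt_le_trans hw h2)).
exists x0, d, g; split=> // z hz; apply: sub2.
by apply: le_lt_trans (nr_triangle z x0 p) _; lra.
Qed.

Lemma propto_minors m (y w : 'rV[C]_m) : w != 0 -> y != 0 ->
  (forall i j, y 0 i * w 0 j - y 0 j * w 0 i = 0) -> propto y w.
Proof.
move=> /rV0Pn[j wj] yn E; have Ey : y = (y 0 j / w 0 j) *: w.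
  apply/rowP => i; rewrite mxE mulrAC.
  by have /eqP := E i j; rewrite subr_eq0 => /eqP <-; rewrite mulfK.
exists (y 0 j / w 0 j); split=> //.
by apply: contraNneq yn => h; rewrite Ey h scale0r.
Qed.

(** Proportionality to [z *m L] is written with minors and membership in [N] with a cokernel. For a
    holomorphic lift these are holomorphic equations, so the identity theorem applies, and they are
    invariant under rescaling of [y]. A zero projection is allowed, since the projection of the map
    may be undefined at some points. *)
Definition splits (L : 'M[C]_(n, n')) (N : 'M[C]_n') (z : V) (y : V') :=
  (forall i j, (y *m proj_mx <<L>>%MS (kermx (gram_mx L))) 0 i * (z *m L) 0 j -
     (y *m proj_mx <<L>>%MS (kermx (gram_mx L))) 0 j * (z *m L) 0 i = 0) /\
  y *m proj_mx (kermx (gram_mx L)) <<L>>%MS *m cokermx N = 0.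

Lemma splits_scale L N z y (c : C) : splits L N z y -> splits L N z (c *: y).
Proof.
move=> [h1 h2]; split=> [i j|]; last by rewrite -!scalemxAl h2 scaler0.
by rewrite -scalemxAl !mxE -!mulrA -mulrBr; have := h1 i j; rewrite !mxE => ->; rewrite mulr0.
Qed.

Lemma splits_propto L N z y y' : propto y y' -> splits L N z y <-> splits L N z y'.
Proof.
move=> [c [cn ->]]; split; last exact: splits_scale.
by move=> /(@splits_scale _ _ _ _ c^-1); rewrite scalerA mulVf // scale1r.
Qed.

Lemma gder_mulmx (G : V -> V') m (M : 'M[C]_(n', m)) x A j : gder G x A ->
  lholo (fun y => (G y *m M) 0 j) x.
Proof.
move=> dG; apply: (@lholo_ext _ _ (fun y => \sum_k G y 0 k * M k j)).
  by move=> y; rewrite mxE.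
apply: lholo_sum => k; apply: lholoM; [exact: gder_coord dG|exact: lholo_cst].
Qed.

Lemma lholo_mulmx m (M : 'M[C]_(n, m)) (x : V) j : lholo (fun y : V => (y *m M) 0 j) x.
Proof. by apply: lholo_linear => c u v; rewrite mulmxDl -scalemxAl !mxE. Qed.

Lemma splits_identity (G : V -> V') (A : V -> 'M[C]_(n, n')) c0 rho L N z0 d :
  0 < rho -> (forall x, nr (x - c0) < rho -> gder G x (A x)) ->
  nr (z0 - c0) < rho / 8 -> 0 < d -> (forall x, nr (x - z0) < d -> splits L N x (G x)) ->
  forall x, nr (x - c0) < rho / 8 -> splits L N x (G x).
Proof.
move=> rho0 dG hz0 d0 S x hx; split=> [i j|].
  apply: (@open_identity _ _ _ (fun x => (G x *m proj_mx <<L>>%MS (kermx (gram_mx L))) 0 i * (x *m L) 0 j -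
     (G x *m proj_mx <<L>>%MS (kermx (gram_mx L))) 0 j * (x *m L) 0 i) c0 rho rho0 _ z0 d) => //.
    move=> y hy; apply: lholoB; apply: lholoM; try exact: lholo_mulmx; exact: gder_mulmx (dG y hy).
  by move=> y /S[h _]; exact: h.
apply/rowP => j; rewrite [RHS]mxE -mulmxA.
apply: (@open_identity _ _ _ (fun x => (G x *m (proj_mx (kermx (gram_mx L)) <<L>>%MS *m cokermx N)) 0 j)
   c0 rho rho0 _ z0 d) => //.
  by move=> y hy; exact: gder_mulmx (dG y hy).
by move=> y /S[_ h]; rewrite mulmxA h mxE.
Qed.

End Globalization.

(** * Lifts and continuation along the domain *)

Section LocalLift.
Variables (R : realType) (r s r' s' t' : nat).
Local Notation C := R[i].
Local Notation n := (r + s + 0)%N.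
Local Notation n' := (r' + s' + t')%N.
Local Notation V := ('rV[C]_(r + s + 0)).
Local Notation V' := ('rV[C]_(r' + s' + t')).
Local Notation H := (@hform R r s 0).
Local Notation H' := (@hform R r' s' t').
Variables (U : set V) (F : V -> V').

Lemma lift_at (z : V) : proj_holo_map U F -> U z ->
  exists (G : V -> V') (A : V -> 'M[C]_(n, n')) (rho : R), [/\ 0 < rho,
    forall x, nr (x - z) < rho -> gder G x (A x) &
    forall x, nr (x - z) < rho -> U x /\ propto (G x) (F x)].
Proof.
move=> [_ [_ lift]] /lift[W [G [Wz [WU [[oW dG] GF]]]]].
have [rho rho0 Hrho] := (open_nrP W).1 oW z Wz.
have /choice[A HA] : forall x, exists A, W x -> gder G x A.
  move=> x; have [Wx|nW] := pselect (W x); last by exists 0.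
  by have [A hA] := differentiable_gder (dG x Wx); exists A.
exists G, A, rho; split=> // x /Hrho Wx; first exact: HA.
by split; [exact: WU|exact: GF].
Qed.

Lemma propto_hq (y y' : V') : propto y y' -> exists2 k : R, 0 < k & hq y = k * hq y'.
Proof.
move=> [c [cn ->]]; exists (nc c ^+ 2); last exact: hqZ.
by rewrite exprn_gt0 // nc_gt0.
Qed.

Lemma local_proper_splits : (1 <= r)%N -> (r <= s)%N -> (r' <= 2 * r - 2)%N ->
  @local_proper_map R r s 0 r' s' t' U F ->
  exists (L : 'M[C]_(n, n')) (N : 'M[C]_n'), [/\ lin_isometry L,
    (N <= kermx (gram_mx L))%MS, null_space N,
    forall z, U z -> splits L N z (F z) &
    exists z, U z /\ F z *m proj_mx <<L>>%MS (kermx (gram_mx L)) != 0].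
Proof.
move=> r0 rs r'r [[oU [U0 _]] [cU [hF [[c0 [Uc0 c00']] [Fpos Fnull]]]]].
have c00 : hq c0 = 0 by rewrite /hq c00' raddf0.
have cn : c0 != 0 by apply/eqP => E; apply: U0; rewrite -E.
have [G [A [rho [rho0 dG GF]]]] := lift_at hF Uc0.
have Gnull x : nr (x - c0) < rho -> hq x = 0 -> hq (G x) = 0.
  move=> /GF[Ux /propto_hq[k k0 ->]] x0.
  by rewrite /hq Fnull ?raddf0 ?mulr0 // hqE x0.
have Gpos x : nr (x - c0) < rho -> 0 < hq x -> 0 < hq (G x).
  move=> /GF[Ux /propto_hq[k k0 ->]] x0.
  by rewrite mulr_gt0 // -hform_gt0 Fpos // hform_gt0.
(* For [r = 1] the bound forces [r' = 0], while a positive point near [c0] has a positive image. *)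
have [r1|r1] := ltnP 1 r; last first.
  have [f [f0 fc]] := null_dual cn c00.
  have nf := nr_ge0 f.
  have [eps eps0 epf] : exists2 eps : R, 0 < eps & eps * nr f < rho.
    exists (rho / (nr f + 1)); first by rewrite divr_gt0 // ltr_wpDl.
    by rewrite mulrAC ltr_pdivrMr ?ltr_wpDl // ltr_pM2l // ltrDl.
  have hx : nr (c0 + eps%:C%C *: f - c0) < rho.
    by rewrite addrAC subrr add0r nrZ nc_real gtr0_norm.
  have qx : 0 < hq (c0 + eps%:C%C *: f).
    rewrite hqD c00 hqZ f0 mulr0 !add0r hformZr (hformC f) fc rmorph1 mulr1 conjE /=.
    by rewrite mulr_gt0.
  have : (#|'I_1| <= r')%N.
    apply: (@positive_index R r' s' t' _ (fun=> G (c0 + eps%:C%C *: f))) => [i j|i].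
      by rewrite !ord1 eqxx.
    exact: Gpos.
  by rewrite card_ord => r'1; lia.
have [x0 [d [g [d0 sub gn Kg]]]] := lift_local_form rho0 dG Gnull Gpos r1 rs r'r cn c00.
have iso z w : nr (z - x0) < d -> nr (w - x0) < d ->
    H' ((g z)^-1 *: G z) ((g w)^-1 *: G w) = H z w.
  move=> hz hw; rewrite hformZl hformZr Kg // fmorphV /=.
  have gz := gn z hz; have gw : (g w)^* != 0 by rewrite conjC_eq0 gn.
  by field; rewrite gz gw.
have [L [isoL [N [NB N0 hN]]]] := local_splitting d0 iso.
have cap : (<<L>> :&: kermx (gram_mx L))%MS = 0 by apply/mxdirect_addsP/isometry_direct.
have cap' : (kermx (gram_mx L) :&: <<L>>)%MS = 0 by rewrite capmxC.
have Gdec z : nr (z - x0) < d ->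
    exists2 b, (b <= N)%MS & G z = g z *: (z *m L) + g z *: b.
  move=> hz; exists ((g z)^-1 *: G z - z *m L); first exact: hN.
  by rewrite -scalerDr addrC subrK scalerA divff ?scale1r // gn.
have zL z : (g z *: (z *m L) <= <<L>>)%MS by rewrite genmxE scalemx_sub // submxMl.
have Gproj z : nr (z - x0) < d -> G z *m proj_mx <<L>>%MS (kermx (gram_mx L)) = g z *: (z *m L).
  move=> hz; have [b hb ->] := Gdec z hz.
  rewrite mulmxDl proj_mx_id // proj_mx_0 ?addr0 //.
  by rewrite scalemx_sub // (submx_trans hb).
have Gsplits z : nr (z - x0) < d -> splits L N z (G z).
  move=> hz; split=> [i j|].
    by rewrite Gproj // !mxE mulrAC subrr.
  have [b hb ->] := Gdec z hz; rewrite mulmxDl proj_mx_0 // add0r proj_mx_id //; last first.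
    by rewrite scalemx_sub // (submx_trans hb).
  by apply/eqP; rewrite -submxE scalemx_sub.
have hx0 : nr (x0 - x0) < d by rewrite subrr nr0.
have Fx z : nr (z - x0) < d -> splits L N z (F z).
  move=> hz; have [_ p] := GF z (sub z hz); exact/(splits_propto L N z p)/Gsplits.
have [Ux0 [c [cn0 Gc]]] := GF x0 (sub x0 hx0).
exists L, N; split=> //; last first.
  exists x0; split=> //; apply: contraNneq (gn x0 hx0) => h.
  have := Gproj x0 hx0; rewrite Gc -scalemxAl h scaler0 => /esym/eqP.
  rewrite scaler_eq0 => /orP[//|/eqP/(isometry_inj isoL) x00].
  by case: U0; rewrite -x00.
(* Asking for a whole neighborhood makes the condition open; on a ball carrying a lift it then
   propagates by [splits_identity]. *)
suff main : forall z, U z -> exists2 e : R, 0 < e &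
    forall y, nr (y - z) < e -> splits L N y (F y).
  by move=> z /main[e e0 h]; apply: h; rewrite subrr nr0.
apply: (connected_closed_open cU oU Ux0); first by exists d.
- move=> x _ [e e0 he]; exists (e / 2); first by rewrite divr_gt0.
  move=> y hy; exists (e / 2); first by rewrite divr_gt0.
  by move=> z hz; apply: he; apply: le_lt_trans (nr_triangle z y x) _; lra.
move=> x Ux; have [G1 [A1 [rho1 [rho10 dG1 GF1]]]] := lift_at hF Ux.
have r80 : 0 < rho1 / 8 by rewrite divr_gt0.
have [r81 r82] : rho1 / 8 < rho1 /\ rho1 / 8 + rho1 / 8 < rho1 by split; lra.
exists (rho1 / 8) => // y z hy hz [e e0 he].
have GFs w : nr (w - x) < rho1 -> splits L N w (G1 w) <-> splits L N w (F w).
  by move=> /GF1[_ p]; exact: splits_propto.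
have e10 : 0 < Num.min e (rho1 / 8) by rewrite lt_min e0.
exists (rho1 / 8 - nr (z - x)); first by rewrite subr_gt0.
move=> w hw.
have hwx : nr (w - x) < rho1 / 8 by apply: le_lt_trans (nr_triangle w z x) _; rewrite -ltrBrDr.
apply/GFs; first exact: lt_trans hwx r81.
apply: (splits_identity rho10 dG1 hy e10) => // v; rewrite lt_min => /andP[hv1 hv2].
apply/GFs; last exact: he.
by apply: le_lt_trans (nr_triangle v y x) (lt_trans (ltrD hv2 hy) r82).
Qed.

End LocalLift.

Theorem mainTheorem17 (R : realType) (r s r' s' t' : nat)
    (U : set 'rV[R[i]]_(r + s + 0))
    (F : 'rV[R[i]]_(r + s + 0) -> 'rV[R[i]]_(r' + s' + t')) :
  (1 <= r)%N -> (r <= s)%N -> (r' <= 2 * r - 2)%N ->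
  @local_proper_map R r s 0 r' s' t' U F ->
  @quasi_standard R r s 0 r' s' t' U F.
Proof.
move=> r0 rs r'r hU.
have [L [N [isoL NB N0 sp [z1 [Uz1 Fz1]]]]] := local_proper_splits r0 rs r'r hU.
have [[_ [U0 _]] [_ [[Fn _] _]]] := hU.
have cap : (<<L>> :&: kermx (gram_mx L))%MS = 0 by apply/mxdirect_addsP/isometry_direct.
have zL z : U z -> z *m L != 0.
  by move=> Uz; apply/eqP => /(isometry_inj isoL) E; apply: U0; rewrite -E.
have Fz z : U z -> F z *m proj_mx <<L>>%MS (kermx (gram_mx L)) != 0 ->
    propto (F z *m proj_mx <<L>>%MS (kermx (gram_mx L))) (z *m L).
  by move=> Uz h; have [m _] := sp z Uz; exact: propto_minors (zL z Uz) h m.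
have Fdec z : F z *m proj_mx <<L>>%MS (kermx (gram_mx L)) +
    F z *m proj_mx (kermx (gram_mx L)) <<L>>%MS = F z.
  by apply: add_proj_mx => //; exact: (submx_full _ (isometry_full isoL)).
(* The second summand of a decomposition must be nonzero. If the complement of the image of [L] is
   zero, the map is itself standard. *)
have [B0|Bn] := eqVneq (kermx (gram_mx L)) 0.
  left; exists L; split=> // z Uz; split; first exact: zL.
  have E : F z *m proj_mx <<L>>%MS (kermx (gram_mx L)) = F z.
    rewrite -[RHS]Fdec (_ : F z *m proj_mx (kermx (gram_mx L)) <<L>>%MS = 0) ?addr0 //.
    by apply/eqP; rewrite -submx0 -[X in (_ <= X)%MS]B0 proj_mx_sub.
  by have h := Fz z Uz; rewrite E in h; exact: h (Fn z Uz).
right; exists <<L>>%MS, (kermx (gram_mx L)); split.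
  apply: contraNneq (zL z1 Uz1) => E.
  have : (L <= <<L>>)%MS by rewrite genmxE.
  by rewrite E submx0 => /eqP ->; rewrite mulmx0.
split=> //; split; first exact: isometry_direct.
split; first exact: isometry_full.
split; first by move=> a b ha hb; have := isometry_orth ha hb.
split.
  exists L; split; first by rewrite genmxE.
  split=> //; split; first by exists z1.
  by move=> z Uz h; split; [exact: zL|exact: Fz].
exists N; split=> //; split=> // z Uz.
by have [_ h] := sp z Uz; rewrite submxE; apply/eqP.
Qed.
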